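(* Consider the second order linear recursion with polynomial coefficients $$A(n)\,r_{n+1}-B(n)\,r_n-C(n)\,r_{n-1}=0\qquad(n=1,2,3,\dots),$$ where \begin{align*} A(n)={}&32(n+1)(2n+1)(2n+3)(4n+3)(4n+5)(8n+3)^2(8n+5)^2(8n+7)^2(8n+9)^2 \\&\times\big(654311424n^8-763363328n^7+336592896n^6-62390272n^5+1949696n^4 \\&\qquad+706560n^3-43520n^2-2880n+225\big), \end{align*} \begin{align*} B(n)={}&3(2n+1)\big(1011688620292508221440n^{20}+6913205571998806179840n^{19} \\&+20264522984105850175488n^{18}+32694809236419354034176n^{17} \\&+30311863475685170348032n^{16}+13940981944461731823616n^{15} \\&-511604730729009774592n^{14}-3973361701783984930816n^{13} \\&-1526200168532215332864n^{12}+194737260750799110144n^{11} \\&+269867025941865168896n^{10}+37629485093249613824n^9 \\&-17598923437928087552n^8-5481696915139592192n^7+199010711963172864n^6 \\&+237194722753118208n^5+18366301200549888n^4-2095780639795200n^3 \\&-198344332843200n^2+7359342480000n+776998726875\big), \end{align*} \begin{align*} C(n)={}&1536n^3(6n-1)(6n+1)(8n+1)^2(8n-1)^2(8n-3)^2(8n-5)^2 \\&\times\big(654311424n^8+4471128064n^7+13313769472n^6+22567976960n^5+23822974976n^4 \\&\qquad+16040183808n^3+6728855040n^2+1608382656n+167760801\big). \end{align*} Let $\{q_n\}_{n=0}^\infty$ and $\{p_n\}_{n=0}^\infty$ be the two solutions of this recursion defined by the initial values $$q_0=p_0=1,\qquad q_1=\frac{1289}{160},\qquad p_1=\frac{136185509}{15876000}.$$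 Then $$\lim_{n\to\infty}\frac{p_n}{q_n}=-\frac1{16\pi\sqrt2}\iint\limits_{|x|=|y|=1}\log\big|(x^4+1)y^2-2(x^4-4x^2+1)y+x^4+1\big|\,\frac{\mathrm dx}{x}\,\frac{\mathrm dy}{y}.$$
   Context: The double integral is over complex $x,y$, each running once counterclockwise around the unit circle: with $x=e^{i\theta}$, $y=e^{i\varphi}$, $\theta,\varphi\in[0,2\pi]$, one has $\frac{\mathrm dx}{x}\frac{\mathrm dy}{y}=-\,\mathrm d\theta\,\mathrm d\varphi$. The integrand has logarithmic singularities at zeros of the polynomial on the torus, and the integral converges absolutely. *)

(* Defs.v *)
From Stdlib Require Import Reals.
From HB Require Import structures.
From mathcomp Require Import all_boot all_order all_algebra.
From mathcomp Require Import all_classical all_reals all_analysis.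
From mathcomp Require Import complex.
From mathcomp Require Export Rstruct Rstruct_topology.

Set Implicit Arguments.
Unset Strict Implicit.
Unset Printing Implicit Defensive.

(* The coefficients are written in Stdlib's R, whose numerals are binary:
   MathComp's ring numerals are unary, which rules out the constants below. *)

Section Coefficients.
Local Open Scope R_scope.

Definition rec_coefA (n : R) : R :=
  32 * (n + 1) * (2 * n + 1) * (2 * n + 3) * (4 * n + 3) * (4 * n + 5)
  * (8 * n + 3) ^ 2 * (8 * n + 5) ^ 2 * (8 * n + 7) ^ 2 * (8 * n + 9) ^ 2
  * (654311424 * n ^ 8 - 763363328 * n ^ 7 + 336592896 * n ^ 6
     - 62390272 * n ^ 5 + 1949696 * n ^ 4 + 706560 * n ^ 3
     - 43520 * n ^ 2 - 2880 * n + 225).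

Definition rec_coefB (n : R) : R :=
  3 * (2 * n + 1)
  * (1011688620292508221440 * n ^ 20 + 6913205571998806179840 * n ^ 19
     + 20264522984105850175488 * n ^ 18 + 32694809236419354034176 * n ^ 17
     + 30311863475685170348032 * n ^ 16 + 13940981944461731823616 * n ^ 15
     - 511604730729009774592 * n ^ 14 - 3973361701783984930816 * n ^ 13
     - 1526200168532215332864 * n ^ 12 + 194737260750799110144 * n ^ 11
     + 269867025941865168896 * n ^ 10 + 37629485093249613824 * n ^ 9
     - 17598923437928087552 * n ^ 8 - 5481696915139592192 * n ^ 7
     + 199010711963172864 * n ^ 6 + 237194722753118208 * n ^ 5
     + 18366301200549888 * n ^ 4 - 2095780639795200 * n ^ 3
     - 198344332843200 * n ^ 2 + 7359342480000 * n + 776998726875).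

Definition rec_coefC (n : R) : R :=
  1536 * n ^ 3 * (6 * n - 1) * (6 * n + 1)
  * (8 * n + 1) ^ 2 * (8 * n - 1) ^ 2 * (8 * n - 3) ^ 2 * (8 * n - 5) ^ 2
  * (654311424 * n ^ 8 + 4471128064 * n ^ 7 + 13313769472 * n ^ 6
     + 22567976960 * n ^ 5 + 23822974976 * n ^ 4 + 16040183808 * n ^ 3
     + 6728855040 * n ^ 2 + 1608382656 * n + 167760801).

Definition satisfies_recursion (r : nat -> R) : Prop :=
  forall n : nat, (1 <= n)%N ->
    rec_coefA (INR n) * r n.+1 - rec_coefB (INR n) * r n - rec_coefC (INR n) * r n.-1 = 0.

End Coefficients.

Import Order.TTheory GRing.Theory Num.Theory.
Import numFieldNormedType.Exports.
Local Open Scope classical_set_scope.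
Local Open Scope ring_scope.
Local Open Scope complex_scope.

Section TorusIntegral.
Context {R : realType}.
Implicit Types (F : R[i] -> R[i] -> R[i]) (t : R).

Definition expi t : R[i] := cos t +i* sin t.

(* With x = expi s and y = expi t, dx = i x ds and dy = i y dt. *)
Definition torus_pullback F (z : R * R) : R[i] :=
  let x := expi z.1 in let y := expi z.2 in
  F x y * ('i%C * x) * ('i%C * y).

Definition torus_square : set (R * R) := `[0, 2 * pi] `*` `[0, 2 * pi].

Local Notation lebesgue2 :=
  (@lebesgue_measure R \x @lebesgue_measure R)%E.

Definition torus_integrable F : Prop :=
  lebesgue2.-integrable torus_square
    (fun z => (complex.Re (torus_pullback F z))%:E) /\
  lebesgue2.-integrable torus_square
    (fun z => (complex.Im (torus_pullback F z))%:E).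

(* The double contour integral of F x y dx dy over |x| = |y| = 1,
   counterclockwise in both variables. *)
Definition torus_integral F : R[i] :=
  (\int[lebesgue2]_(z in torus_square) complex.Re (torus_pullback F z))
  +i* (\int[lebesgue2]_(z in torus_square) complex.Im (torus_pullback F z)).

Definition torus_poly (x y : R[i]) : R[i] :=
  (x ^+ 4 + 1) * y ^+ 2 - 2 * (x ^+ 4 - 4 * x ^+ 2 + 1) * y + x ^+ 4 + 1.

(* The norm of R[i] takes its values in R[i], hence the Re.  Since ln 0 = 0,
   the value is junk where torus_poly vanishes, a null set on the torus. *)
Definition log_integrand (x y : R[i]) : R[i] :=
  (ln (complex.Re `|torus_poly x y|))%:C / x / y.

End TorusIntegral.

(* Main.v *)
Require Import Defs.
From Stdlib Require Import Reals Lra.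
From mathcomp Require Import all_boot all_order all_algebra.
From mathcomp Require Import all_classical all_reals all_analysis.
From mathcomp Require Import measurable_realfun.
From mathcomp Require Import complex.
Set Implicit Arguments.
Unset Strict Implicit.
Unset Printing Implicit Defensive.

(** Both the limit and the integral are expressed through the Dirichlet L-value
      [l = 1 + 1/3^2 - 1/5^2 - 1/7^2 + 1/9^2 + 1/11^2 - 1/13^2 - 1/15^2 + ...],
    whose signs depend on the odd denominators modulo [8]. It appears below as
    [1 + chi_period / 16].

    The quotients converge to [l]. For [y = 1/4] and [y = - 1/4], consider
    [S_n(y)], the sum of [(-1) ^ m * R_n (m + y)] over [m >= 0], where [R_n] is the
    rational function [kernel n]. Creative telescoping ([kernel_recursion]) writes the
    recursion applied to [R_n (t)] as [G (t + 2) - G (t)] with a rational function [G]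
    that vanishes at [y] and [1 + y] and has a limit at infinity, so that both
    sequences [S_n(y)] satisfy the recursion ([kernel_sum_recursion]). On the other
    hand, the partial fractions of [R_n], which has double poles at even integers and
    at odd negative integers, express [S_n(y)] through the sums of
    [(-1) ^ k / (k + y) ^ 2]. The symmetry and the zeros of [R_n] imply that
    [S_n(1/4) + S_n(-1/4)] is a positive constant times the sum [q_n] of the
    coefficients at the double poles ([kernel_sum_add]), while
    [S_n(1/4) - S_n(-1/4)] is [32 * (l * q_n - p_n)] for rational numbers [p_n]
    ([kernel_sum_sub]). Comparing the terms of index [0] and [1] identifies [q_n] and
    [p_n] with the two given solutions. The coefficients at the double poles are
    positive and concentrated at large indices, where the remaining tails are small,
    and they dominate those at the simple poles; this gives
    [`|S_n(1/4) - S_n(-1/4)| <= 300 / n * q_n] ([kernel_sum_sub_bound]), hence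
    [p_n / q_n] tends to [l] ([approximants_cvg]).

    The integral is [- 16 * pi * sqrt 2 * l]. At [x = e^(i theta)], [y = e^(i phi)] the
    polynomial is [x^2 * y] times the real number
    [4 * (2 - cos (2 * theta) * (1 - cos phi))], which is nonnegative. By Jensen's
    formula in [phi], the mean of its logarithm is
    [ln 2 + 2 * ln (1 + sqrt 2 * `|sin theta|)] ([Rintegral_log_torus_modulus]). On each
    half period of [theta] this is a sum of two functions
    [ln `|1 - e^(i (theta + gamma))|^2], whose cosine series converge uniformly there;
    integrated term by term, they give the series of [l] ([Rintegral_inner_value]).
    Tonelli's theorem, applied to [ln 16] minus the logarithm, justifies the iterated
    integration and shows that the integral converges absolutely
    ([log_integrand_torus]). *)

(** * A certificate of creative telescoping *)

Section Certificate.
Local Open Scope R_scope.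

(** The polynomial [cert_poly (8 * n) (4 * t)] is the numerator of the certificate.
    Its coefficients solve the linear system that [certificate_identity] expresses;
    the arguments are scaled so that they become integers over a common
    denominator. *)
Definition cert_coef0 (s : R) : R :=
  - 177411 * s ^ 26 - 11515088 * s ^ 25 - 320814146 * s ^ 24 - 4866489272 * s ^ 23 -
  40315837937 * s ^ 22 - 117652168796 * s ^ 21 + 957849906784 * s ^ 20 +
  10560032628784 * s ^ 19 + 26846641265434 * s ^ 18 - 135895340184992 * s ^ 17 -
  972985037903636 * s ^ 16 - 520534541801792 * s ^ 15 + 11448206992577110 * s ^ 14 +
  25325442257596648 * s ^ 13 - 68473011703173296 * s ^ 12 - 264521595556095920 * s ^ 11
  + 195007469073100633 * s ^ 10 + 1466663506223080336 * s ^ 9 +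
  36882872234857318 * s ^ 8 - 4501333832955402504 * s ^ 7 - 1856182290335259093 * s ^ 6
  + 6216838388389072980 * s ^ 5 + 4140408562320746304 * s ^ 4 -
  638447461290096768 * s ^ 3 - 1976208322994558208 * s ^ 2 - 398697839659330560 * s +
  308848326213427200.

Definition cert_coef1 (s : R) : R :=
  - 643422 * s ^ 25 - 42605576 * s ^ 24 - 1220782144 * s ^ 23 - 19380628520 * s ^ 22 -
  176382015934 * s ^ 21 - 750085295384 * s ^ 20 + 1466226950664 * s ^ 19 +
  34184591823680 * s ^ 18 + 135305164690636 * s ^ 17 - 166660184915536 * s ^ 16 -
  2845002835022552 * s ^ 15 - 5063564915943568 * s ^ 14 + 22468974673579964 * s ^ 13 +
  86318742541183632 * s ^ 12 - 63596513507294952 * s ^ 11 - 631057416533067264 * s ^ 10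
  - 192131371304682126 * s ^ 9 + 2520598029281767512 * s ^ 8 +
  1872062111169349624 * s ^ 7 - 5341435901491825800 * s ^ 6 -
  4354855429372714206 * s ^ 5 + 5096067775100638344 * s ^ 4 +
  2047314735991037952 * s ^ 3 - 2420333877371636736 * s ^ 2 - 342727268565035520 * s +
  594474485964134400.

Definition cert_coef2 (s : R) : R :=
  - 888186 * s ^ 24 - 61443824 * s ^ 23 - 1845981442 * s ^ 22 - 31091181552 * s ^ 21 -
  310643648880 * s ^ 20 - 1676963064352 * s ^ 19 - 1599578236204 * s ^ 18 +
  39254021027928 * s ^ 17 + 229332539670672 * s ^ 16 + 158812964338664 * s ^ 15 -
  2994729188227088 * s ^ 14 - 9381904774463816 * s ^ 13 + 12448305983570868 * s ^ 12 +
  100206763629483272 * s ^ 11 + 41770066393658572 * s ^ 10 - 525844163739242936 * s ^ 9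
  - 626283215343806902 * s ^ 8 + 1434853951210317288 * s ^ 7 +
  2424748315953621394 * s ^ 6 - 1730064465678250728 * s ^ 5 -
  3741797097208056996 * s ^ 4 + 461577492127785528 * s ^ 3 + 1845808515349189344 * s ^ 2
  - 26504387187477120 * s - 375148961143257600.

Definition cert_coef3 (s : R) : R :=
  - 460668 * s ^ 23 - 37325600 * s ^ 22 - 1271193588 * s ^ 21 - 23939122384 * s ^ 20 -
  269820770432 * s ^ 19 - 1763687888944 * s ^ 18 - 4798725144024 * s ^ 17 +
  16963013458768 * s ^ 16 + 177443063204352 * s ^ 15 + 362538364809104 * s ^ 14 -
  1382328847431968 * s ^ 13 - 7282069375351696 * s ^ 12 - 822619852261320 * s ^ 11 +
  53374396091871280 * s ^ 10 + 70165480307810520 * s ^ 9 - 183109477634679184 * s ^ 8 -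
  403136771501891204 * s ^ 7 + 218165678858503760 * s ^ 6 + 859081636415998548 * s ^ 5 +
  149597815278358944 * s ^ 4 - 427571243070769080 * s ^ 3 - 118589279876021952 * s ^ 2 +
  83585769893760960 * s + 20861940913516800.

Definition cert_coef4 (s : R) : R :=
  154635 * s ^ 22 + 1723384 * s ^ 21 - 182410644 * s ^ 20 - 6706136160 * s ^ 19 -
  105575548105 * s ^ 18 - 896343481428 * s ^ 17 - 3765867183564 * s ^ 16 -
  405640404104 * s ^ 15 + 69154006819338 * s ^ 14 + 237609714950424 * s ^ 13 -
  237744817370980 * s ^ 12 - 2898218356956264 * s ^ 11 - 2813309160527286 * s ^ 10 +
  15293434169303104 * s ^ 9 + 30352114746456924 * s ^ 8 - 35104148567154072 * s ^ 7 -
  110333919887514757 * s ^ 6 + 18223144724852784 * s ^ 5 + 152591354929653192 * s ^ 4 +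
  12307324156369128 * s ^ 3 - 73554315613281297 * s ^ 2 - 6708952969060140 * s +
  14891096276272800.

Definition cert_coef5 (s : R) : R :=
  337974 * s ^ 21 + 16139656 * s ^ 20 + 302631344 * s ^ 19 + 2450271032 * s ^ 18 -
  265367874 * s ^ 17 - 167948541096 * s ^ 16 - 1288173516168 * s ^ 15 -
  2727654305312 * s ^ 14 + 13432347531860 * s ^ 13 + 80289188214128 * s ^ 12 +
  27630780308184 * s ^ 11 - 704558524273968 * s ^ 10 - 1225356431906028 * s ^ 9 +
  2672447310507664 * s ^ 8 + 7953471347253800 * s ^ 7 - 2390170745322016 * s ^ 6 -
  19208995891214634 * s ^ 5 - 7768709358687864 * s ^ 4 + 9429325989069528 * s ^ 3 +
  5124218515703352 * s ^ 2 - 1821376663893810 * s - 1070766429661800.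

Definition cert_coef6 (s : R) : R :=
  187044 * s ^ 20 + 9629776 * s ^ 19 + 207701510 * s ^ 18 + 2357317296 * s ^ 17 +
  13711422678 * s ^ 16 + 19368215928 * s ^ 15 - 233270628420 * s ^ 14 -
  1235507927672 * s ^ 13 + 78933074564 * s ^ 12 + 15403824637272 * s ^ 11 +
  24662600300712 * s ^ 10 - 91375613229528 * s ^ 9 - 243377016431448 * s ^ 8 +
  267424705159336 * s ^ 7 + 1042153991786468 * s ^ 6 - 283066839692712 * s ^ 5 -
  1961752000645224 * s ^ 4 - 112754442658248 * s ^ 3 + 1041614501090994 * s ^ 2 +
  79505658724680 * s - 228251806444350.

Definition cert_coef7 (s : R) : R :=
  47580 * s ^ 19 + 2470624 * s ^ 18 + 54181588 * s ^ 17 + 636645632 * s ^ 16 +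
  4049545240 * s ^ 15 + 9907921424 * s ^ 14 - 35802809768 * s ^ 13 - 292487521392 * s ^ 12 -
  332453594416 * s ^ 11 + 2380247666320 * s ^ 10 + 6672004883072 * s ^ 9 -
  6949270018352 * s ^ 8 - 39947395006552 * s ^ 7 - 7508322945232 * s ^ 6 +
  93758604321960 * s ^ 5 + 66448629015984 * s ^ 4 - 42631085071980 * s ^ 3 -
  39160317618864 * s ^ 2 + 7500726280620 * s + 8127297615600.

Definition cert_coef8 (s : R) : R :=
  4758 * s ^ 18 + 243256 * s ^ 17 + 5223554 * s ^ 16 + 59485720 * s ^ 15 + 357365948 * s ^ 14 +
  704899384 * s ^ 13 - 4144200484 * s ^ 12 - 25933391752 * s ^ 11 - 12498646040 * s ^ 10 +
  248023683464 * s ^ 9 + 468781541536 * s ^ 8 - 1069952235064 * s ^ 7 -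
  3138777712604 * s ^ 6 + 1760189875560 * s ^ 5 + 7967708531748 * s ^ 4 +
  270696076200 * s ^ 3 - 4479665368158 * s ^ 2 - 332299467360 * s + 1015912201950.

Definition cert_poly (s u : R) : R :=
  (cert_coef0 s + cert_coef1 s * u + cert_coef2 s * u ^ 2 + cert_coef3 s * u ^ 3
   + cert_coef4 s * u ^ 4 + cert_coef5 s * u ^ 5 + cert_coef6 s * u ^ 6
   + cert_coef7 s * u ^ 7 + cert_coef8 s * u ^ 8) / 16384.

Definition zero_factor (t i : R) : R := (t + i) ^ 2 - (/ 4) ^ 2.

(** The telescoping relation of [kernel_recursion] after division by the factors
    common to all its terms. *)
Lemma certificate_identity n t :
  1536 * (n + 1) ^ 3 * (6 * n + 5) * (6 * n + 7)
  * (8 * n + 3) ^ 2 * (8 * n + 5) ^ 2 * (8 * n + 7) ^ 2 * (8 * n + 9) ^ 2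
  * (654311424 * n ^ 8 - 763363328 * n ^ 7 + 336592896 * n ^ 6
     - 62390272 * n ^ 5 + 1949696 * n ^ 4 + 706560 * n ^ 3
     - 43520 * n ^ 2 - 2880 * n + 225)
  * ((2 * t + 2 * n + 3) * zero_factor t (2 * n - 1) * zero_factor t (2 * n)
     * zero_factor t (2 * n + 1) * zero_factor t (2 * n + 2)
     * (t + 2 * n - 1) ^ 2 * (t + 2 * n + 1) ^ 2)
  - rec_coefB n
    * ((2 * t + 2 * n + 1) * zero_factor t (2 * n - 1) * zero_factor t (2 * n)
       * (t - 2 * n - 2) ^ 2 * (t + 2 * n - 1) ^ 2
       * (t + 4 * n + 3) ^ 2 * (t + 4 * n + 5) ^ 2)
  - 32 * n * (2 * n - 1) * (2 * n + 1) * (4 * n - 1) * (4 * n + 1)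
    * (8 * n + 1) ^ 2 * (8 * n - 1) ^ 2 * (8 * n - 3) ^ 2 * (8 * n - 5) ^ 2
    * (654311424 * n ^ 8 + 4471128064 * n ^ 7 + 13313769472 * n ^ 6
       + 22567976960 * n ^ 5 + 23822974976 * n ^ 4 + 16040183808 * n ^ 3
       + 6728855040 * n ^ 2 + 1608382656 * n + 167760801)
    * ((2 * t + 2 * n - 1) * (t - 2 * n) ^ 2 * (t - 2 * n - 2) ^ 2
       * (t + 4 * n - 1) ^ 2 * (t + 4 * n + 1) ^ 2
       * (t + 4 * n + 3) ^ 2 * (t + 4 * n + 5) ^ 2)
  = cert_poly (8 * n) (4 * (t + 2)) * zero_factor t (2 * n - 1) * zero_factor t (2 * n)
    * (t - 2 * n - 2) ^ 2 * (t + 2 * n - 1) ^ 2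
    - cert_poly (8 * n) (4 * t) * zero_factor t (-1) * zero_factor t 0
      * t ^ 2 * (t + 4 * n + 5) ^ 2.
Proof.
rewrite /cert_poly /zero_factor /rec_coefB /cert_coef0 /cert_coef1 /cert_coef2.
rewrite /cert_coef3 /cert_coef4 /cert_coef5 /cert_coef6 /cert_coef7 /cert_coef8.
field.
Qed.

(** The same relation with the common factors restored: [Z], [D] and [E] stand for
    products whose number of factors depends on [n], and [c] for the normalizing
    constant. Keeping them as atoms makes [field] feasible. *)
Lemma certificate_reduced (n t c Z D E : R) :
  0 < n - 1 / 2 -> D <> 0 -> E <> 0 -> t - 2 * n <> 0 -> t - 2 * n - 2 <> 0 -> t <> 0 ->
  t + 2 * n - 1 <> 0 -> t + 2 * n + 1 <> 0 -> t + 4 * n - 1 <> 0 -> t + 4 * n + 1 <> 0 ->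
  t + 4 * n + 3 <> 0 -> t + 4 * n + 5 <> 0 ->
  rec_coefA n
  * (c * (48 * (n + 1) ^ 2 * (6 * n + 5) * (6 * n + 7)
          / ((2 * n + 1) * (2 * n + 3) * (4 * n + 3) * (4 * n + 5)))
     * (2 * t + 2 * n + 3)
     * (Z * zero_factor t (2 * n - 1) * zero_factor t (2 * n)
        * zero_factor t (2 * n + 1) * zero_factor t (2 * n + 2))
     / (D * (t - 2 * n) ^ 2 * (t - 2 * n - 2) ^ 2
        * (E * (t + 4 * n - 1) ^ 2 * (t + 4 * n + 1) ^ 2
           * (t + 4 * n + 3) ^ 2 * (t + 4 * n + 5) ^ 2 / (t + 2 * n + 1) ^ 2)))
  - rec_coefB n
    * (c * (2 * t + 2 * n + 1) * (Z * zero_factor t (2 * n - 1) * zero_factor t (2 * n))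
       / (D * (t - 2 * n) ^ 2 * (E * (t + 4 * n - 1) ^ 2 * (t + 4 * n + 1) ^ 2)))
  - rec_coefC n
    * (c / (48 * n ^ 2 * (6 * n - 1) * (6 * n + 1)
            / ((2 * n - 1) * (2 * n + 1) * (4 * n - 1) * (4 * n + 1)))
       * (2 * t + 2 * n - 1) * Z / (D * (E * (t + 2 * n - 1) ^ 2)))
  = c * cert_poly (8 * n) (4 * (t + 2))
    * (Z * zero_factor t (2 * n - 1) * zero_factor t (2 * n))
    / (D * (t - 2 * n) ^ 2
       * (E * (t + 4 * n - 1) ^ 2 * (t + 4 * n + 1) ^ 2
          * (t + 4 * n + 3) ^ 2 * (t + 4 * n + 5) ^ 2))
    - c * cert_poly (8 * n) (4 * t) * (zero_factor t (-1) * zero_factor t 0 * Z)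
      / (D * (t - 2 * n) ^ 2 * (t - 2 * n - 2) ^ 2 / t ^ 2
         * ((t + 2 * n - 1) ^ 2 * E * (t + 4 * n - 1) ^ 2 * (t + 4 * n + 1) ^ 2
            * (t + 4 * n + 3) ^ 2)).
Proof.
move=> n0 D0 E0 h1 h2 h3 h4 h5 h6 h7 h8 h9.
pose W := c * Z / (D * (t - 2 * n) ^ 2 * (t - 2 * n - 2) ^ 2 * E * (t + 2 * n - 1) ^ 2
  * (t + 4 * n - 1) ^ 2 * (t + 4 * n + 1) ^ 2 * (t + 4 * n + 3) ^ 2 * (t + 4 * n + 5) ^ 2).
have := certificate_identity n t.
set z1 := zero_factor t (2 * n - 1); set z2 := zero_factor t (2 * n).
set z3 := zero_factor t (2 * n + 1); set z4 := zero_factor t (2 * n + 2).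
set y1 := zero_factor t (-1); set y2 := zero_factor t 0.
set g1 := cert_poly _ (4 * (t + 2)); set g2 := cert_poly _ (4 * t).
set P1 := (X in X - _ - _ = _); set P2 := (X in _ - X - _ = _).
set P3 := (X in _ - _ - X = _); set Q1 := (X in _ = X - _); set Q2 := (X in _ = _ - X).
move=> eqPQ; have eqW : W * P1 - W * P2 - W * P3 = W * Q1 - W * Q2.
  by rewrite -!Rmult_minus_distr_l eqPQ.
apply: etrans (etrans eqW _).
  congr (Rminus (Rminus _ _) _).
  - rewrite /W /P1 /rec_coefA; set a := (654311424 * n ^ 8 - _ + _ - _ + _ + _ - _ - _ + _).
    clearbody a z1 z2 z3 z4; clear eqW eqPQ; field; repeat split; lra.
  - rewrite /W /P2; set b := rec_coefB n; clearbody b z1 z2 z3 z4.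
    clear eqW eqPQ; field; repeat split; lra.
  - rewrite /W /P3 /rec_coefC; set a := (654311424 * n ^ 8 + _ + _ + _ + _ + _ + _ + _ + _).
    clearbody a; clear eqW eqPQ; field; repeat split; lra.
congr (Rminus _ _).
- rewrite /W /Q1; clearbody g1 z1 z2; clear eqW eqPQ; field; repeat split; lra.
- rewrite /W /Q2; clearbody g2 y1 y2; clear eqW eqPQ; field; repeat split; lra.
Qed.

End Certificate.

(** * Initial values and leading coefficient *)

Section InitialData.
Local Open Scope R_scope.

(** The initial values written with small numerals only, since the numerals of an
    abstract ring are unary. *)
Lemma p1_digits : 136185509 / 15876000 =
  ((((1 * 100 + 36) * 100 + 18) * 100 + 55) * 100 + 9) / (2 ^ 5 * 3 ^ 4 * 5 ^ 3 * 7 ^ 2).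
Proof. field. Qed.

Lemma q1_digits : 1289 / 160 = (12 * 100 + 89) / (2 ^ 5 * 5).
Proof. field. Qed.

(** The octic factor has positive coefficients only when it is expanded at [1]. *)
Lemma rec_coefA_gt0 n : 1 <= n -> 0 < rec_coefA n.
Proof.
move=> n1; have -> : n = (n - 1) + 1 by ring.
have : 0 <= n - 1 by lra.
move: (n - 1) => m m0 {n n1}; rewrite /rec_coefA.
have -> : 654311424 * (m + 1) ^ 8 - 763363328 * (m + 1) ^ 7 + 336592896 * (m + 1) ^ 6
     - 62390272 * (m + 1) ^ 5 + 1949696 * (m + 1) ^ 4 + 706560 * (m + 1) ^ 3
     - 43520 * (m + 1) ^ 2 - 2880 * (m + 1) + 225 =
  654311424 * m ^ 8 + 4471128064 * m ^ 7 + 13313769472 * m ^ 6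
     + 22567976960 * m ^ 5 + 23822974976 * m ^ 4 + 16040183808 * m ^ 3
     + 6728855040 * m ^ 2 + 1608382656 * m + 167760801 by ring.
have pow_ge0 e : 0 <= m ^ e by apply: pow_le.
have := pow_ge0 2%nat; have := pow_ge0 3%nat; have := pow_ge0 4%nat.
have := pow_ge0 5%nat; have := pow_ge0 6%nat; have := pow_ge0 7%nat; have := pow_ge0 8%nat.
move=> *; repeat (apply: Rmult_lt_0_compat; last first); try (apply: pow_lt); lra.
Qed.

End InitialData.

From mathcomp Require Import ring lra zify.
Import Order.TTheory GRing.Theory Num.Theory.
Import numFieldNormedType.Exports.
Local Open Scope classical_set_scope.
Local Open Scope ring_scope.

(** * Partial fractions with double poles *)

Lemma horner_deriv_prod (F : fieldType) (I : Type) (r : seq I) (Q : pred I)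
    (f : I -> {poly F}) (w : F) :
  (forall i, Q i -> (f i).[w] != 0) ->
  (\prod_(i <- r | Q i) f i)^`().[w] =
  (\prod_(i <- r | Q i) (f i).[w]) * \sum_(i <- r | Q i) (f i)^`().[w] / (f i).[w].
Proof.
move=> f_neq0; elim: r => [|i r IHr]; first by rewrite !big_nil derivC horner0 mulr0.
rewrite !big_cons; case: ifP => // Qi.
rewrite derivM hornerD !hornerM IHr horner_prod mulrDr.
by field; apply: f_neq0.
Qed.

Lemma dvdp_XsubC_sqr (F : fieldType) (p : {poly F}) (c : F) :
  p.[c] = 0 -> p^`().[c] = 0 -> ('X - c%:P) ^+ 2 %| p.
Proof.
move=> /eqP/factor_theorem[q ->]; rewrite derivM derivXsubC mulr1 hornerD hornerM.
rewrite hornerXsubC subrr mulr0 add0r => /eqP/factor_theorem[q' ->].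
by rewrite -mulrA -expr2 dvdp_mull.
Qed.

Lemma dvdp_prod_XsubC_sqr (F : fieldType) (I : eqType) (r : seq I) (v : I -> F)
    (p : {poly F}) :
  injective v -> uniq r -> (forall i, i \in r -> ('X - (v i)%:P) ^+ 2 %| p) ->
  \prod_(i <- r) ('X - (v i)%:P) ^+ 2 %| p.
Proof.
move=> v_inj; elim: r => [|i r IHr] /=; first by rewrite big_nil dvd1p.
case/andP=> ir r_uniq dvd; rewrite big_cons Gauss_dvdp.
  by rewrite dvd ?mem_head //= IHr // => k kr; apply: dvd; rewrite inE kr orbT.
rewrite coprimep_expl // coprimep_sym coprimep_XsubC rootE horner_prod.
rewrite prodf_seq_neq0; apply/allP => k kr /=.
rewrite horner_exp hornerXsubC expf_neq0 // subr_eq0 (inj_eq v_inj).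
by apply: contraNneq ir => ->.
Qed.

Section DoublePoles.
Context {F : fieldType} {I : finType}.
Context (v : I -> F) (P : {poly F}).
Context (v_inj : injective v) (sizeP : (size P <= 2 * #|I|)%N).

Definition double_residue j : F := P.[v j] / \prod_(k | k != j) (v j - v k) ^+ 2.

(** The derivative at [v j] of the polynomial [P] divided by the squares of the
    other linear factors. *)
Definition simple_residue j : F :=
  (P^`().[v j] - 2 * P.[v j] * \sum_(k | k != j) (v j - v k)^-1)
  / \prod_(k | k != j) (v j - v k) ^+ 2.

Let W j : {poly F} := \prod_(k | k != j) ('X - (v k)%:P) ^+ 2.

Let node_neq j k : k != j -> v j - v k != 0.
Proof. by move=> kj; rewrite subr_eq0 (inj_eq v_inj) eq_sym. Qed.

Let horner_W j w : (W j).[w] = \prod_(k | k != j) (w - v k) ^+ 2.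
Proof. by rewrite horner_prod; apply: eq_bigr => k _; rewrite horner_exp hornerXsubC. Qed.

Let horner_W_neq0 j : (W j).[v j] != 0.
Proof.
by rewrite horner_W; apply/prodf_neq0 => k kj; rewrite expf_neq0 // node_neq.
Qed.

Let horner_deriv_W j :
  (W j)^`().[v j] = (W j).[v j] * (2 * \sum_(k | k != j) (v j - v k)^-1).
Proof.
rewrite /W horner_deriv_prod; last first.
  by move=> k kj; rewrite horner_exp hornerXsubC expf_neq0 // node_neq.
rewrite horner_prod; congr (_ * _); rewrite mulr_sumr; apply: eq_bigr => k kj.
rewrite deriv_exp derivXsubC mul1r /= expr1 hornerMn horner_exp hornerXsubC.
by field; apply: node_neq.
Qed.

Let T := \sum_j ((double_residue j)%:P
                 + simple_residue j *: ('X - (v j)%:P)) * W j.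

Let size_W j : size (W j) = (2 * #|I|).-1.
Proof.
rewrite /W size_prod => [|k _]; last by rewrite expf_neq0 // polyXsubC_eq0.
under eq_bigr do rewrite size_exp_XsubC.
rewrite sum_nat_const.
have -> : #|(fun k => k != j)| = #|I|.-1.
  by rewrite -(cardC1 j); apply: eq_card => k; rewrite !inE.
have : (0 < #|I|)%N by apply/card_gt0P; exists j.
by lia.
Qed.

Let monic_W j : W j \is monic.
Proof. by apply: monic_prod => k _; rewrite monic_exp // monicXsubC. Qed.

Let size_T : (size T <= 2 * #|I|)%N.
Proof.
apply: (leq_trans (size_sum _ _ _)); apply/bigmax_leqP => j _.
apply: (leq_trans (size_polyMleq _ _)); rewrite size_W.
have : (0 < #|I|)%N by apply/card_gt0P; exists j.
suff : (size ((double_residue j)%:P + simple_residue j *: ('X - (v j)%:P))%R <= 2)%N by lia.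
apply: (leq_trans (size_polyD _ _)); rewrite geq_max (leq_trans (size_polyC_leq1 _)) //=.
by apply: (leq_trans (size_scale_leq _ _)); rewrite size_XsubC.
Qed.

(** Hermite interpolation: the difference has a double zero at each of the [#|I|]
    points [v j], and a degree less than [2 * #|I|]. *)
Let P_eq_T : P = T.
Proof.
apply/eqP; rewrite -subr_eq0; apply/negPn/negP => PT0.
have : \prod_(i <- index_enum I) ('X - (v i)%:P) ^+ 2 %| P - T.
  apply: dvdp_prod_XsubC_sqr; rewrite ?index_enum_uniq // => j _.
  rewrite /T (bigD1 j) //= opprD addrA dvdp_sub //.
    apply: dvdp_XsubC_sqr; rewrite ?derivB hornerD hornerN.
      rewrite hornerM hornerD hornerC hornerZ hornerXsubC subrr mulr0 addr0.
      by rewrite horner_W /double_residue divfK ?subrr // -horner_W.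
    rewrite derivM derivD derivC derivZ derivXsubC add0r hornerD !hornerM hornerD.
    rewrite !hornerZ !hornerC hornerXsubC subrr mulr0 addr0 horner_deriv_W.
    rewrite mulr1 /double_residue /simple_residue -horner_W.
    by field; apply: horner_W_neq0.
  apply: (big_ind (fun p => ('X - (v j)%:P) ^+ 2 %| p)) => [|p q|k kj];
    [exact: dvdp0|exact: dvdp_add|].
  apply: dvdp_mull; rewrite /W (bigD1 j) 1?eq_sym //=; exact: dvdp_mulr.
move=> /dvdp_leq => /(_ PT0); rewrite size_prod; last first.
  by move=> k _; rewrite expf_neq0 // polyXsubC_eq0.
under eq_bigr do rewrite size_exp_XsubC.
move=> le1.
have : (size (P - T)%R <= 2 * #|I|)%N.
  by apply: (leq_trans (size_polyD _ _)); rewrite size_polyN geq_max sizeP size_T.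
move: le1; rewrite sum_nat_const; have -> : #|xpredT : pred I| = #|I| by exact: eq_card.
have absurd c : ((c * 3).+1 - c <= 2 * c)%N = false by lia.
by move=> /leq_trans le2 /le2; rewrite absurd.
Qed.

Lemma partial_fractions w : (forall j, w != v j) ->
  P.[w] / \prod_j (w - v j) ^+ 2 =
  \sum_j (double_residue j / (w - v j) ^+ 2 + simple_residue j / (w - v j)).
Proof.
move=> wv; rewrite {1}P_eq_T /T horner_sum mulr_suml; apply: eq_bigr => j _.
have wj k : w - v k != 0 by rewrite subr_eq0 wv.
rewrite hornerM hornerD hornerC hornerZ hornerXsubC horner_W [X in _ / X](bigD1 j) //=.
have : \prod_(k | k != j) (w - v k) ^+ 2 != 0.
  by apply/prodf_neq0 => k _; rewrite expf_neq0.
by move: (wj j); set D := w - _; set E := \prod_(_ | _) _ => D0 E0; field; rewrite D0.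
Qed.

(** The sum is the coefficient of degree [2 * #|I| - 1] of [P]. *)
Lemma sum_simple_residue : (size P < 2 * #|I|)%N -> \sum_j simple_residue j = 0.
Proof.
move=> ltP; have : T`_(2 * #|I|).-1 = 0.
  by rewrite -P_eq_T nth_default // -ltnS (leq_trans ltP) // leqSpred.
rewrite /T coef_sum => T0; rewrite -[RHS]T0; apply: eq_bigr => j _.
have I0 : (0 < #|I|)%N by apply/card_gt0P; exists j.
have -> : ((double_residue j)%:P + simple_residue j *: ('X - (v j)%:P)) * W j =
    simple_residue j *: (W j * 'X)
    + (double_residue j - simple_residue j * v j) *: W j.
  by rewrite -!mul_polyC !polyCD polyCN polyCM; ring.
rewrite coefD !coefZ coefMX [in X in _ + _ * X]nth_default ?size_W // mulr0 addr0.
have -> : ((2 * #|I|).-1 == 0)%N = false by lia.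
by have /monicP := monic_W j; rewrite /lead_coef size_W => ->; rewrite mulr1.
Qed.

End DoublePoles.

(** * The kernel and its partial fractions *)

Section Kernel.
Context {K : realFieldType}.
Implicit Types (n j m : nat) (t : K).

Definition kernel_const n : K :=
  \prod_(i < n) (48 * (i%:R + 1) ^+ 2 * (6 * i%:R + 5) * (6 * i%:R + 7)
                 / ((2 * i%:R + 1) * (2 * i%:R + 3) * (4 * i%:R + 3) * (4 * i%:R + 5))).

(** The kernel is of very-well-poised type: the reflection [t -> - 2n - 1 - t]
    preserves the zeros [- i +- 1/4] and exchanges the two families of double poles,
    [2 j] and [- 2n - 1 - 2j]. Up to the linear factor, it is thus a function of
    [v = t (t + 2n + 1)], and the linear factor is [dv / dt]. *)
Definition kernel n t : K :=
  kernel_const n * (2 * t + (2 * n + 1)%:R)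
  * (\prod_(i < 2 * n) ((t + i.+1%:R) ^+ 2 - 4^-1 ^+ 2))
  / \prod_(j < n.+1) ((t - (2 * j)%:R) ^+ 2 * (t + (2 * n + 2 * j + 1)%:R) ^+ 2).

(** The value of [v = t (t + 2n + 1)] at the poles [2 j] and [- 2n - 1 - 2j]. *)
Definition node n j : K := (2 * j * (2 * n + 2 * j + 1))%:R.

Definition num_root n i : K := (i%:R + 3 / 4) * ((2 * n - i)%:R + 1 / 4).

(** The product of the zero factors of the kernel, as a polynomial in
    [v = t (t + 2n + 1)]: see [horner_num_poly]. *)
Definition num_poly n : {poly K} := \prod_(i < 2 * n) ('X + (num_root n i)%:P).

(** The distance of the two poles at which [v = node n j]. *)
Definition pole_gap n j : K := (2 * n + 4 * j + 1)%:R.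

Definition coefB n (j : 'I_n.+1) : K :=
  kernel_const n * simple_residue (fun k : 'I_n.+1 => node n k) (num_poly n) j.

Definition coefA n (j : 'I_n.+1) : K :=
  kernel_const n * double_residue (fun k : 'I_n.+1 => node n k) (num_poly n) j
  / pole_gap n j.

Lemma kernel_const_gt0 n : 0 < kernel_const n.
Proof.
apply: prodr_gt0 => i _; have : 0 <= i%:R :> K by [].
by move: (i%:R : K) => {}i i0; rewrite divr_gt0 // ?mulr_gt0 ?exprn_gt0 //; lra.
Qed.

Lemma node_inj n : injective (fun k : 'I_n.+1 => node n k).
Proof.
move=> i j /eqP; rewrite eqr_nat => /eqP eq_ij; apply/val_inj => /=; nia.
Qed.

(** The zero [- i - 1 + 1/4] is paired with its mirror image, which is the zero
    [- (2n - i) - 1/4]; their product is a polynomial in [v]. *)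
Lemma horner_num_poly n t :
  (num_poly n).[t * (t + (2 * n + 1)%:R)] =
  \prod_(i < 2 * n) ((t + i.+1%:R) ^+ 2 - 4^-1 ^+ 2).
Proof.
have rev : \prod_(i < 2 * n) (t + i.+1%:R + 4^-1)
    = \prod_(i < 2 * n) (t + (2 * n - i)%:R + 4^-1).
  rewrite (reindex_inj rev_ord_inj) /=; apply: eq_bigr => i _.
  by rewrite subnSK.
transitivity (\prod_(i < 2 * n) (t + i.+1%:R - 4^-1)
              * \prod_(i < 2 * n) (t + i.+1%:R + 4^-1)).
  rewrite rev -big_split horner_prod; apply: eq_bigr => i _ /=.
  rewrite hornerD hornerX hornerC /num_root.
  have -> : (2 * n + 1)%:R = (2 * n - i)%:R + i%:R + 1 :> K.
    by rewrite -natrD subnK ?natr1 ?addn1 // ltnW.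
  by rewrite -natr1; field.
by rewrite -big_split; apply: eq_bigr => i _ /=; ring.
Qed.

Lemma size_num_poly n : size (num_poly n) = (2 * n).+1.
Proof.
rewrite /num_poly (eq_bigr (fun i : 'I_(2 * n) => 'X - (- num_root n i)%:P)).
  by rewrite size_prod_XsubC [index_enum _]unlock -enumT size_enum_ord.
by move=> i _; rewrite polyCN opprK.
Qed.

Lemma node_sub n (j : nat) t :
  t * (t + (2 * n + 1)%:R) - node n j = (t - (2 * j)%:R) * (t + (2 * n + 2 * j + 1)%:R).
Proof. by rewrite /node; ring. Qed.

(** Each term of the partial fractions in [v], multiplied by [dv / dt], splits into
    poles in [t]: [v - node n j] is the product of the two linear factors, and
    [dv / dt] is their sum. *)
Lemma kernel_partial_fractions n t :
  (forall j, t - (2 * j)%:R != 0) -> (forall j, t + j%:R != 0) ->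
  kernel n t =
  \sum_(j < n.+1)
    (coefA j * ((t - (2 * j)%:R) ^- 2 - (t + (2 * n + 2 * j + 1)%:R) ^- 2)
     + coefB j * ((t - (2 * j)%:R)^-1 + (t + (2 * n + 2 * j + 1)%:R)^-1)).
Proof.
move=> t1 t2; pose w := t * (t + (2 * n + 1)%:R).
have size_ok : (size (num_poly n) <= 2 * #|'I_n.+1|)%N.
  by rewrite size_num_poly card_ord; lia.
have w_neq (j : 'I_n.+1) : w != node n j.
  by rewrite -subr_eq0 node_sub mulf_neq0.
have := partial_fractions (@node_inj n) size_ok w_neq.
rewrite horner_num_poly; under eq_bigr do rewrite node_sub exprMn.
move=> eqK; rewrite /kernel -mulrA eqK mulr_sumr; apply: eq_bigr => j _.
rewrite node_sub /coefA /coefB /pole_gap.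
have := t1 j; have := t2 (2 * n + 2 * j + 1)%N.
have : (2 * n + 4 * j + 1)%:R != 0 :> K by rewrite pnatr_eq0 addn1.
set a := _ j; set b := _ j; set c := kernel_const n => h1 h2 h3.
field; apply/and3P; split;
  [apply: contra_neq h2 | apply: contra_neq h3 | apply: contra_neq h1] => <-; ring.
Qed.

Lemma sum_coefB n : \sum_(j < n.+1) coefB j = 0.
Proof.
by rewrite -mulr_sumr (sum_simple_residue (@node_inj n)) ?mulr0 //
  size_num_poly card_ord; lia.
Qed.

End Kernel.

(** * Bounds for the coefficients *)

Section Estimates.
Context {K : realFieldType}.
Implicit Types (n j m : nat) (t : K).

Lemma prod_dist_sqr n j : (j <= n)%N ->
  \prod_(0 <= k < n.+1 | k != j) (j%:R - k%:R : K) ^+ 2 = (j`! * (n - j)`!)%:R ^+ 2.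
Proof.
move=> jn; rewrite (big_cat_nat (n := j)) //=; last exact: leq_trans jn _.
rewrite [X in _ * X]big_ltn_cond ?ltnS // eqxx /=.
have -> : \prod_(0 <= k < j | k != j) (j%:R - k%:R : K) ^+ 2 = j`!%:R ^+ 2.
  rewrite big_nat_cond (eq_bigl (fun k => (0 <= k < j) && true)%N); last first.
    by move=> k; lia.
  rewrite -big_nat_cond big_nat_rev /= fact_prod natr_prod -prodrXl big_add1 /=.
  by rewrite !big_nat; apply: eq_bigr => k kj; rewrite add0n -natrB ?subKn //; lia.
have -> : \prod_(j.+1 <= k < n.+1 | k != j) (j%:R - k%:R : K) ^+ 2 = (n - j)`!%:R ^+ 2.
  rewrite big_nat_cond (eq_bigl (fun k => (j.+1 <= k < n.+1) && true)%N); last first.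
    by move=> k; lia.
  rewrite -big_nat_cond -[j.+1]add0n big_addn subSS fact_prod natr_prod -prodrXl.
  rewrite big_add1 /=; apply: eq_big_nat => k kj.
  have -> : j%:R - (k + j.+1)%:R = - k.+1%:R :> K by ring.
  by rewrite sqrrN.
by rewrite natrM exprMn.
Qed.

(** The differences of nodes are [2 (j - k) (2n + 2j + 2k + 1)]; this collects the
    last factors, including the one for [k = j]. *)
Definition odd_prod n j : K := \prod_(0 <= k < n.+1) (2 * n + 2 * (j + k) + 1)%:R.

(** The value of [num_poly n] at [node n j]. *)
Definition num_value n j : K := \prod_(0 <= i < 2 * n) ((2 * j + i.+1)%:R ^+ 2 - 4^-1 ^+ 2).

Lemma pole_gap_neq0 n j : pole_gap n j != 0 :> K.
Proof. by rewrite pnatr_eq0 addn1. Qed.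

Lemma odd_prod_gt0 n j : 0 < odd_prod n j.
Proof. by apply: prodr_gt0 => k _; rewrite ltr0n addn1. Qed.

Lemma coefA_closed n (j : 'I_n.+1) :
  coefA j = kernel_const n * num_value n j * pole_gap n j
            / (4 ^+ n * (j`! * (n - j)`!)%:R ^+ 2 * odd_prod n j ^+ 2) :> K.
Proof.
have jn : (j <= n)%N by rewrite -ltnS.
have -> : coefA j = kernel_const n / pole_gap n j * (num_poly n).[node n j]
   / \prod_(k < n.+1 | k != j) (node n j - node n k) ^+ 2 :> K.
  by rewrite /coefA /double_residue !mulrA mulrAC; congr (_ / _); rewrite mulrAC.
have -> : (num_poly n).[node n j] = num_value n j :> K.
  have -> : node n j = (2 * j)%:R * ((2 * j)%:R + (2 * n + 1)%:R) :> K.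
    by rewrite /node; ring.
  rewrite horner_num_poly /num_value big_mkord; apply: eq_bigr => i _.
  by rewrite natrD.
have -> : \prod_(k < n.+1 | k != j) (node n j - node n k : K) ^+ 2
    = 4 ^+ n * (j`! * (n - j)`!)%:R ^+ 2 * (odd_prod n j / pole_gap n j) ^+ 2.
  have -> : odd_prod n j / pole_gap n j
      = \prod_(k < n.+1 | k != j) (2 * n + 2 * (j + k) + 1)%:R.
    rewrite /odd_prod big_mkord (bigD1 j) //= mulrAC.
    have -> : pole_gap n j = (2 * n + 2 * (j + j) + 1)%:R :> K.
      by congr (_%:R); lia.
    by rewrite divff ?mul1r // pnatr_eq0 addn1.
  rewrite -prod_dist_sqr // big_mkord.
  have -> : 4 ^+ n = \prod_(k < n.+1 | k != j) 4 :> K.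
    rewrite prodr_const; congr (_ ^+ _).
    have := cardC1 j; rewrite card_ord /= => {1}<-.
    by apply: eq_card => k; rewrite !inE.
  rewrite -prodrXl -!big_split; apply: eq_bigr => k _ /=.
  by rewrite /node; ring.
have := pole_gap_neq0 n j; set g := pole_gap n j => g0.
have : 4 ^+ n != 0 :> K by rewrite expf_neq0 // pnatr_eq0.
have : (j`! * (n - j)`!)%:R != 0 :> K by rewrite lt0r_neq0 // ltr0n muln_gt0 !fact_gt0.
have := lt0r_neq0 (odd_prod_gt0 n j).
set u := (_`! * _)%:R; set r := 4 ^+ n; set w := odd_prod n j => w0 u0 r0.
by clearbody g u r w; field; rewrite g0 w0 u0 r0.
Qed.

Lemma num_value_gt0 n j : 0 < num_value n j.
Proof.
apply: prodr_gt0 => i _.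
have : 1 <= (2 * j + i.+1)%:R :> K by rewrite ler1n addnS.
by move: (_ + _)%:R => x x1; nra.
Qed.

Lemma coefA_gt0 n (j : 'I_n.+1) : 0 < coefA j :> K.
Proof.
rewrite coefA_closed; apply: divr_gt0.
  by rewrite !mulr_gt0 ?kernel_const_gt0 ?num_value_gt0 // ltr0n addn1.
apply: mulr_gt0; last by rewrite exprn_gt0 // odd_prod_gt0.
by apply: mulr_gt0; rewrite exprn_gt0 // ltr0n // muln_gt0 !fact_gt0.
Qed.

Lemma num_value_succ n j :
  num_value n j.+1 * (((2 * j + 1)%:R ^+ 2 - 4^-1 ^+ 2) * ((2 * j + 2)%:R ^+ 2 - 4^-1 ^+ 2))
  = num_value n j * (((2 * j + 2 * n + 1)%:R ^+ 2 - 4^-1 ^+ 2)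
                     * ((2 * j + 2 * n + 2)%:R ^+ 2 - 4^-1 ^+ 2)) :> K.
Proof.
rewrite /num_value; pose z m : K := (2 * j + m)%:R ^+ 2 - 4^-1 ^+ 2.
have -> : \prod_(0 <= i < 2 * n) ((2 * j.+1 + i.+1)%:R ^+ 2 - 4^-1 ^+ 2)
    = \prod_(0 <= i < 2 * n) z i.+3 :> K.
  by apply: eq_bigr => i _; rewrite /z; congr (_%:R ^+ _ - _); lia.
have shift_l : \prod_(0 <= i < (2 * n).+2) z i.+1
    = z 1%N * (z 2%N * \prod_(0 <= i < 2 * n) z i.+3) by rewrite 2?big_nat_recl.
have shift_r : \prod_(0 <= i < (2 * n).+2) z i.+1
    = \prod_(0 <= i < 2 * n) z i.+1 * z (2 * n).+1 * z (2 * n).+2.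
  by rewrite 2?big_nat_recr.
have -> : (2 * j + 2 * n + 1 = 2 * j + (2 * n).+1)%N by lia.
have -> : (2 * j + 2 * n + 2 = 2 * j + (2 * n).+2)%N by lia.
by rewrite mulrC -mulrA -[LHS]shift_l shift_r mulrA.
Qed.

Lemma odd_prod_succ n j :
  odd_prod n j.+1 * (2 * n + 2 * j + 1)%:R = odd_prod n j * (4 * n + 2 * j + 3)%:R.
Proof.
rewrite /odd_prod mulrC; pose f k : K := (2 * n + 2 * (j + k) + 1)%:R.
have -> : \prod_(0 <= k < n.+1) (2 * n + 2 * (j.+1 + k) + 1)%:R
    = \prod_(0 <= k < n.+1) f k.+1 by apply: eq_bigr => k _; rewrite /f; congr (_%:R); lia.
have -> : (2 * n + 2 * j + 1)%:R = f 0%N by rewrite /f addn0.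
rewrite -big_nat_recl // big_nat_recr //=; congr (_ * _).
by rewrite /f; congr (_%:R); lia.
Qed.

(** Subtracting [(1/4) ^ 2] from both of [a <= b] can only decrease the quotient of
    [a] by [b]. It is thus enough to compare the unshifted squares, for which the
    inequality is the square of one between products of linear forms. *)
Lemma growth_inequality (x y : K) : 0 <= y -> 2 * (y + 1) <= x ->
  x ^+ 2 * (4 * x + 2 * y + 3) ^+ 2
    * (((2 * y + 1) ^+ 2 - 4^-1 ^+ 2) * ((2 * y + 2) ^+ 2 - 4^-1 ^+ 2)) <=
  (x - y) ^+ 2 * (2 * x + 2 * y + 1) ^+ 2
    * (((2 * x + 2 * y + 1) ^+ 2 - 4^-1 ^+ 2) * ((2 * x + 2 * y + 2) ^+ 2 - 4^-1 ^+ 2)).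
Proof.
move=> y0 yx; set u := 2 * x + 2 * y + 1; set v := 4 * x + 2 * y + 3.
have -> : 2 * x + 2 * y + 2 = u + 1 by rewrite /u; ring.
have u_ge : 2 * x + 1 <= u by rewrite /u; lra.
have x2 : 2 <= x by lra.
set z1 := (2 * y + 1) ^+ 2 - _; set z2 := (2 * y + 2) ^+ 2 - _.
set z3 := u ^+ 2 - _; set z4 := (u + 1) ^+ 2 - _.
have shift_le (a b : K) : a <= b ->
    (a - 4^-1 ^+ 2) * b <= a * (b - 4^-1 ^+ 2) by move=> ab; lra.
have z1u : z1 * u ^+ 2 <= (2 * y + 1) ^+ 2 * z3.
  by apply: shift_le; rewrite ler_sqr ?nnegrE; lra.
have z2u : z2 * (u + 1) ^+ 2 <= (2 * y + 2) ^+ 2 * z4.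
  by apply: shift_le; rewrite ler_sqr ?nnegrE; lra.
have z1_ge0 : 0 <= z1 by rewrite /z1; nra.
have z2_ge0 : 0 <= z2 by rewrite /z2; nra.
have poly_le : x * v * ((2 * y + 1) * (2 * y + 2)) <= (x - y) * u * (u * (u + 1)).
  have le1 : x * v * ((2 * y + 1) * (2 * y + 2)) <= x * (2 * u + 1) * (x * x).
    apply: ler_pM; rewrite ?mulr_ge0 //; try (rewrite /v /u; lra).
      by apply: ler_wpM2l; rewrite /v /u; lra.
    by apply: ler_pM; lra.
  have le2 : x * u * (u * x) <= (x - y) * u * (u * (u + 1)).
    suff : 0 <= u * u * ((x - y) * (u + 1) - x * x) by nra.
    have xy : 0 <= (x - y - x / 2) * (u + 1) by apply: mulr_ge0; lra.
    have xu : 0 <= x * (u + 1 - 2 * x) by apply: mulr_ge0; lra.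
    by apply: mulr_ge0; [apply: mulr_ge0|]; lra.
  apply: le_trans le1 (le_trans _ le2).
  suff : 0 <= x * x * (u * u - x * (2 * u + 1)) by nra.
  have uu : 0 <= u * (u - (2 * x + 1)) by apply: mulr_ge0; lra.
  by apply: mulr_ge0; [apply: mulr_ge0|]; lra.
have v_ge0 : 0 <= v by rewrite /v; lra.
have u_gt0 : 0 < u by lra.
have sq_le : x ^+ 2 * v ^+ 2 * ((2 * y + 1) ^+ 2 * (2 * y + 2) ^+ 2)
    <= (x - y) ^+ 2 * u ^+ 2 * (u ^+ 2 * (u + 1) ^+ 2).
  by rewrite -!exprMn ler_sqr ?nnegrE ?mulr_ge0 //; lra.
have zz_le : z1 * z2 * (u ^+ 2 * (u + 1) ^+ 2)
    <= (2 * y + 1) ^+ 2 * (2 * y + 2) ^+ 2 * (z3 * z4).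
  rewrite mulrACA [leRHS]mulrACA; apply: ler_pM => //.
    by rewrite mulr_ge0 // exprn_ge0 // ltW.
  by rewrite mulr_ge0 // exprn_ge0; lra.
have c_gt0 : 0 < u ^+ 2 * (u + 1) ^+ 2 by rewrite mulr_gt0 // exprn_gt0; lra.
have z34_ge0 : 0 <= z3 * z4 by rewrite mulr_ge0 // /z3 /z4; nra.
rewrite -(ler_pM2r c_gt0).
apply: (@le_trans _ _ (x ^+ 2 * v ^+ 2 * ((2 * y + 1) ^+ 2 * (2 * y + 2) ^+ 2 * (z3 * z4)))).
  rewrite -[leLHS]mulrA; apply: ler_wpM2l zz_le.
  by apply: mulr_ge0; rewrite exprn_ge0 //; lra.
by rewrite mulrA [leRHS]mulrAC; apply: ler_wpM2r.
Qed.

(** The shape of two consecutive coefficients in [coefA_closed], with the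
    factorials [f] and [h] of the smaller arguments as atoms; [le] is the inequality
    that remains after all common factors are cancelled. *)
Lemma ratio_le_of_growth (c r f h N N' O O' x y w g g' u v z z' : K) :
  0 < c -> 0 < r -> 0 < f -> 0 < h -> 0 < N -> 0 < O -> 0 <= y -> 0 < w ->
  0 < u -> 0 < v -> 0 < z -> 0 <= g <= g' ->
  O' * u = O * v -> N' * z = N * z' ->
  x ^+ 2 * v ^+ 2 * z <= w ^+ 2 * u ^+ 2 * z' ->
  c * N * g / (r * (f * (w * h)) ^+ 2 * O ^+ 2) * x ^+ 2
  <= c * N' * g' / (r * ((y + 1) * f * h) ^+ 2 * O' ^+ 2) * (y + 1) ^+ 2.
Proof.
move=> c0 r0 f0 h0 N0 O0 y0 w0 u0 v0 z0 /andP[g0 gg'] eqO eqN le.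
have -> : O' = O * v / u by rewrite -eqO mulfK ?lt0r_neq0.
have -> : N' = N * z' / z by rewrite -eqN mulfK ?lt0r_neq0.
have y1 : 0 < y + 1 by lra.
pose k := c * N / (r * f ^+ 2 * h ^+ 2 * O ^+ 2).
have -> : c * N * g / (r * (f * (w * h)) ^+ 2 * O ^+ 2) * x ^+ 2
    = k * (g * (x ^+ 2 / w ^+ 2)) by rewrite /k; field; rewrite ?lt0r_neq0.
have -> : c * (N * z' / z) * g' / (r * ((y + 1) * f * h) ^+ 2 * (O * v / u) ^+ 2)
    * (y + 1) ^+ 2 = k * (g' * (z' * u ^+ 2 / (z * v ^+ 2))).
  by rewrite /k; field; rewrite ?lt0r_neq0.
apply: ler_wpM2l.
  by rewrite divr_ge0 // ?mulr_ge0 ?exprn_ge0 // ltW.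
have sq0 (a : K) : 0 <= a ^+ 2 by rewrite sqr_ge0.
apply: ler_pM => //; first by rewrite divr_ge0.
rewrite ler_pdivrMr ?exprn_gt0 // mulrAC ler_pdivlMr; last by rewrite mulr_gt0 ?exprn_gt0.
lra.
Qed.

(** The first half of the [coefA j] grows so fast that little of their sum sits at
    indices small compared with [n]: see [sum_coefA_weighted]. *)
Lemma coefA_growth n (j i : 'I_n.+1) : i = j.+1 :> nat -> (2 * i <= n)%N ->
  coefA j * n%:R ^+ 2 <= coefA i * i%:R ^+ 2 :> K.
Proof.
move=> ij le_in; rewrite !coefA_closed ij.
have jn : (j < n)%N by lia.
have y0 : 0 <= (j : nat)%:R :> K by [].
have yx : 2 * ((j : nat)%:R + 1) <= n%:R :> K.
  by rewrite natr1 -natrM ler_nat -ij.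
have -> : (j`! * (n - j)`!)%:R = j`!%:R * ((n%:R - j%:R) * (n - j.+1)`!%:R) :> K.
  by rewrite -subnSK // factS subnSK // !natrM natrB // ltnW.
rewrite factS !natrM -[j.+1%:R]natr1.
apply: (@ratio_le_of_growth (kernel_const n) (4 ^+ n) j`!%:R (n - j.+1)`!%:R
  (num_value n j) (num_value n j.+1) (odd_prod n j) (odd_prod n j.+1)
  n%:R j%:R (n%:R - j%:R) (pole_gap n j) (pole_gap n j.+1)
  (2 * n + 2 * j + 1)%:R (4 * n + 2 * j + 3)%:R
  (((2 * j + 1)%:R ^+ 2 - 4^-1 ^+ 2) * ((2 * j + 2)%:R ^+ 2 - 4^-1 ^+ 2))
  (((2 * j + 2 * n + 1)%:R ^+ 2 - 4^-1 ^+ 2)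
    * ((2 * j + 2 * n + 2)%:R ^+ 2 - 4^-1 ^+ 2))).
- exact: kernel_const_gt0.
- by rewrite exprn_gt0.
- by rewrite ltr0n fact_gt0.
- by rewrite ltr0n fact_gt0.
- exact: num_value_gt0.
- exact: odd_prod_gt0.
- by [].
- lra.
- by rewrite ltr0n addn1.
- by rewrite ltr0n addn3.
- have pos (a : nat) : (0 < a)%N -> 0 < (2 * j + a)%:R ^+ 2 - 4^-1 ^+ 2 :> K.
    move=> a0; have : 1 <= (2 * j + a)%:R :> K by rewrite ler1n; lia.
    by move: (_ + _)%:R => b b1; nra.
  by rewrite mulr_gt0 // pos.
- by rewrite ler0n ler_nat /=; lia.
- exact: odd_prod_succ.
- exact: num_value_succ.
- have := growth_inequality y0 yx.
  have -> : (4 * n + 2 * j + 3)%:R = 4 * n%:R + 2 * j%:R + 3 :> K by ring.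
  have -> : (2 * n + 2 * j + 1)%:R = 2 * n%:R + 2 * j%:R + 1 :> K by ring.
  have -> : (2 * j + 2 * n + 1)%:R = 2 * n%:R + 2 * j%:R + 1 :> K by ring.
  have -> : (2 * j + 2 * n + 2)%:R = 2 * n%:R + 2 * j%:R + 2 :> K by ring.
  have -> : (2 * j + 1)%:R = 2 * j%:R + 1 :> K by ring.
  by have -> : (2 * j + 2)%:R = 2 * j%:R + 2 :> K by ring.
Qed.

Lemma num_root_ge n i : (i < 2 * n)%N -> 3 / 2 * n%:R <= num_root n i :> K.
Proof.
move=> lt_i; have : i%:R + (2 * n - i)%:R = 2 * n%:R :> K.
  by rewrite -natrD subnKC ?natrM // ltnW.
have : 1 <= (2 * n - i)%:R :> K by rewrite ler1n subn_gt0.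
have : 0 <= i%:R :> K by [].
rewrite /num_root; move: (i%:R : K) ((2 * n - i)%:R : K) (n%:R : K) => x m y x0 m1 eq_y; nra.
Qed.

Lemma node_ge0 n j : 0 <= node n j :> K. Proof. exact: ler0n. Qed.

Lemma node_dist n j k : k != j -> 4 * n%:R <= `|node n j - node n k| :> K.
Proof.
have node_subE : node n j - node n k = (j%:R - k%:R) * (2 * (2 * n + 2 * j + 2 * k + 1)%:R) :> K.
  by rewrite /node; ring.
move=> kj; rewrite node_subE normrM -[leLHS]mul1r; apply: ler_pM; rewrite ?mulr_ge0 //.
  case: (ltngtP k j) kj => // lt_kj _.
    by rewrite -natrB 1?ltnW // normr_nat ler1n subn_gt0.
  by rewrite distrC -natrB 1?ltnW // normr_nat ler1n subn_gt0.
by rewrite -[2 * _]natrM normr_nat -natrM ler_nat; lia.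
Qed.

(** The quotient of [coefB j] by [coefA j] is the logarithmic derivative of
    [num_poly n] minus that of the denominator, times [pole_gap n j]. The values
    [- num_root n i] and the other nodes keep a distance of order [n] from
    [node n j], so that both logarithmic derivatives are bounded. *)
Lemma coefB_bound n (j : 'I_n.+1) : (0 < n)%N ->
  `|coefB j| <= 13 * n%:R * coefA j :> K.
Proof.
move=> n0; have n0K : 0 < n%:R :> K by rewrite ltr0n.
pose L : K := \sum_(i < 2 * n) (node n j + num_root n i)^-1.
pose S : K := \sum_(k < n.+1 | k != j) (node n j - node n k)^-1.
have shift_ge (i : 'I_(2 * n)) : 3 / 2 * n%:R <= node n j + num_root n i :> K.
  by have := num_root_ge (ltn_ord i); have := node_ge0 n j; lra.
have shift_gt0 (i : 'I_(2 * n)) : 0 < node n j + num_root n i :> K.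
  by have := shift_ge i; lra.
have derivP : (num_poly n)^`().[node n j] = (num_poly n).[node n j] * L :> K.
  rewrite /num_poly horner_deriv_prod => [|i _]; last first.
    by rewrite hornerD hornerX hornerC lt0r_neq0.
  rewrite horner_prod; congr (_ * _); apply: eq_bigr => i _.
  by rewrite derivD derivX derivC addr0 hornerD hornerX !hornerC mul1r.
have -> : coefB j = coefA j * (pole_gap n j * (L - 2 * S)) :> K.
  rewrite /coefA /coefB /simple_residue /double_residue derivP -/S.
  set c := kernel_const n; set D := \prod_(_ < _ | _) _; set g := pole_gap n j.
  have g0 : g != 0 by exact: pole_gap_neq0.
  have D0 : D != 0.
    apply/prodf_neq0 => k kj; rewrite expf_neq0 // subr_eq0.
    by rewrite (inj_eq (@node_inj K n)) eq_sym.
  by clearbody c D g; field; rewrite ?g0 ?D0.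
have A0 := coefA_gt0 j; rewrite normrM gtr0_norm // [leRHS]mulrC.
apply: ler_wpM2l; first exact: ltW.
have L_le : `|L| <= 4 / 3.
  apply: le_trans (ler_norm_sum _ _ _) _.
  apply: (@le_trans _ _ (\sum_(i < 2 * n) (3 / 2 * n%:R)^-1)).
    apply: ler_sum => i _; rewrite gtr0_norm ?invr_gt0 //.
    by rewrite lef_pV2 ?posrE //; lra.
  rewrite sumr_const card_ord -[leLHS]mulr_natl natrM.
  by rewrite le_eqVlt; apply/orP; left; apply/eqP; field; rewrite lt0r_neq0.
have S_le : `|S| <= 1 / 4.
  apply: le_trans (ler_norm_sum _ _ _) _.
  apply: (@le_trans _ _ (\sum_(k < n.+1 | k != j) (4 * n%:R)^-1)).
    apply: ler_sum => k kj; have d := node_dist n kj.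
    rewrite normfV lef_pV2 ?posrE ?mulr_gt0 //.
    by apply: lt_le_trans d; rewrite mulr_gt0.
  rewrite sumr_const -[leLHS]mulr_natl (_ : #|_| = n).
    by rewrite le_eqVlt; apply/orP; left; apply/eqP; field; rewrite lt0r_neq0.
  have := cardC1 j; rewrite card_ord /= => card_neq; rewrite -[RHS]card_neq.
  by apply: eq_card => k; rewrite !inE.
have g_le : pole_gap n j <= 7 * n%:R :> K.
  by rewrite -natrM ler_nat; have := ltn_ord j; lia.
have g0 : 0 <= pole_gap n j :> K by [].
rewrite normrM ger0_norm //.
have : `|L - 2 * S| <= 11 / 6.
  apply: le_trans (ler_normB _ _) _; rewrite normrM normr_nat; lra.
have : 0 <= `|L - 2 * S| by [].
move: (`|_ - _|) => z z0 z1.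
apply: le_trans (ler_pM g0 z0 g_le z1) _; lra.
Qed.

(** If [2 * j.+1 <= n], the term is at most [coefA j.+1 / n ^ 2] by [coefA_growth];
    otherwise the weight itself is at most [4 / n ^ 2]. *)
Lemma sum_coefA_weighted n : (0 < n)%N ->
  \sum_(j < n.+1) coefA j / j.+1%:R ^+ 2 <=
  5 / n%:R ^+ 2 * \sum_(j < n.+1) coefA j :> K.
Proof.
move=> n0; have n0K : 0 < n%:R ^+ 2 :> K by rewrite exprn_gt0 ?ltr0n.
(* The coefficients extended by 0 to all indices, so that they can be shifted. *)
pose a m : K := if (m < n.+1)%N =P true is ReflectT lt_m then coefA (Ordinal lt_m) else 0.
have aE (j : 'I_n.+1) : coefA j = a j.
  rewrite /a; case: eqP => [lt_j|]; last by rewrite ltn_ord.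
  by congr coefA; apply: val_inj.
have a_ge0 m : 0 <= a m by rewrite /a; case: eqP => // ?; rewrite ltW ?coefA_gt0.
rewrite mulrAC ler_pdivlMr // mulr_suml.
apply: (@le_trans _ _ (\sum_(0 <= j < n.+1) (a j.+1 + 4 * a j))).
  rewrite big_mkord; apply: ler_sum => j _; rewrite aE mulrAC.
  have j0K : 0 < j.+1%:R ^+ 2 :> K by rewrite exprn_gt0 ?ltr0n.
  rewrite ler_pdivrMr //; have := a_ge0 j; have := a_ge0 j.+1 => a1 a0.
  case: (leqP (2 * j.+1) n) => [le_jn|lt_nj].
    have lt_j1 : (j.+1 < n.+1)%N by lia.
    have := @coefA_growth n j (Ordinal lt_j1) erefl le_jn.
    rewrite !aE /= => /le_trans; apply; apply: ler_wpM2r; first exact: ltW.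
    by lra.
  have n_le : n%:R <= 2 * j.+1%:R :> K by rewrite -[2 * _]natrM ler_nat ltnW.
  have : n%:R ^+ 2 <= 4 * j.+1%:R ^+ 2 :> K.
    have : 0 <= n%:R :> K by [].
    by move: (n%:R : K) (j.+1%:R : K) n_le => x y; nra.
  by move: (n%:R ^+ 2) (j.+1%:R ^+ 2) n0K j0K a0 a1 => x y x0 y0 a0 a1 xy; nra.
rewrite big_split -mulr_sumr /= (_ : 5 = 1 + 4) // [leRHS]mulrDl mul1r.
have -> : \sum_(j < n.+1) coefA j = \sum_(0 <= j < n.+1) a j.
  by rewrite big_mkord; apply: eq_bigr => j _; rewrite aE.
rewrite lerD2r -(@big_add1 _ _ _ _ n.+2 (fun=> true) a).
rewrite [leRHS]big_ltn // big_nat_recr //=.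
have -> : a n.+1 = 0 by rewrite /a; case: eqP => // lt_n; exfalso; move: lt_n; rewrite ltnn.
by rewrite addr0 lerDr.
Qed.

End Estimates.

(** * The recursion for the kernel *)

(** The rational function whose increments over [2] give the recursion of index
    [n = k + 1]. *)
Definition kernel_cert (k : nat) (t : R) : R :=
  (kernel_const k.+1 * cert_poly (8 * k.+1%:R)%R (4 * t)%R
   * (\prod_(i < 2 * k.+1) ((t + i%:R - 1) ^+ 2 - 4^-1 ^+ 2))
   / ((\prod_(j < k.+2) (t - (2 * j.+1)%:R) ^+ 2)
      * (\prod_(l < k.+4) (t + (2 * k + 2 * l + 1)%:R) ^+ 2)))%R.

Lemma kernel_const_pred (k : nat) (n := k.+1%:R : R) :
  kernel_const k = kernel_const k.+1 / (48 * n ^+ 2 * (6 * n - 1) * (6 * n + 1)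
    / ((2 * n - 1) * (2 * n + 1) * (4 * n - 1) * (4 * n + 1))).
Proof.
have nE : n = k%:R + 1 by rewrite /n -natr1.
rewrite {2}/kernel_const big_ord_recr /= -/(kernel_const k) nE.
have : 0 <= k%:R :> R by [].
move: (kernel_const k) (k%:R : R) => c x x0 {n nE}.
by field; do ![apply/andP; split]; lra.
Qed.

Lemma kernel_recursion (k : nat) (t : R) :
  (forall j : nat, t != j%:R) -> (forall j : nat, t + j%:R != 0) ->
  rec_coefA (INR k.+1) * kernel k.+2 t - rec_coefB (INR k.+1) * kernel k.+1 t
    - rec_coefC (INR k.+1) * kernel k t
  = kernel_cert k (t + 2) - kernel_cert k t.
Proof.
move=> tN tP; rewrite INRE; pose n : R := k.+1%:R.
pose c : R := kernel_const k.+1.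
pose Z : R := \prod_(i < 2 * k) ((t + i.+1%:R) ^+ 2 - 4^-1 ^+ 2).
pose D : R := \prod_(j < k.+1) (t - (2 * j)%:R) ^+ 2.
pose e (l : nat) : R := (t + (2 * k + 2 * l + 3)%:R) ^+ 2.
pose E : R := \prod_(l < k) e l.
have tN' (j : nat) : t - j%:R != 0 by rewrite subr_eq0 tN.
have D0 : D != 0 by apply/prodf_neq0 => j _; rewrite expf_neq0 // tN'.
have E0 : E != 0 by apply/prodf_neq0 => l _; rewrite expf_neq0 // tP.
have nP (a b : nat) : t + a%:R * n + b%:R != 0 by rewrite -addrA -natrM -natrD tP.
have nM (a b : nat) : (b <= a)%N -> t + a%:R * n - b%:R != 0.
  move=> ba; rewrite -addrA -natrM -natrB ?tP //.
  by rewrite (leq_trans ba) // leq_pmulr.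
have n_gt : 0 < n - 1 / 2 by rewrite subr_gt0 (@lt_le_trans _ _ 1) ?ler1n //; lra.
have nN (a b : nat) : t - a%:R * n - b%:R != 0.
  by rewrite -addrA -opprD -natrM -natrD tN'.
have nE : n = k%:R + 1 by rewrite /n -natr1.
have prodD2 : \prod_(j < k.+2) (t - (2 * j)%:R) ^+ 2 = D * (t - 2 * n) ^+ 2.
  by rewrite big_ord_recr /= natrM.
have prodD3 : \prod_(j < k.+3) (t - (2 * j)%:R) ^+ 2
    = D * (t - 2 * n) ^+ 2 * (t - 2 * n - 2) ^+ 2.
  rewrite big_ord_recr prodD2 /=; congr (_ * _ ^+ 2).
  by rewrite natrM -natr1 /n; ring.
have prodD' : \prod_(j < k.+2) (t - (2 * j.+1)%:R) ^+ 2
    = D * (t - 2 * n) ^+ 2 * (t - 2 * n - 2) ^+ 2 / t ^+ 2.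
  have t0 : t != 0 := tN 0%N.
  rewrite -prodD3 [in RHS]big_ord_recl /= muln0 subr0 mulrAC divff ?expf_neq0 //.
  by rewrite mul1r.
have e_k : e k = (t + 4 * n - 1) ^+ 2.
  by rewrite /e; congr (_ ^+ 2); rewrite nE; ring.
have e_k1 : e k.+1 = (t + 4 * n + 1) ^+ 2.
  by rewrite /e; congr (_ ^+ 2); rewrite nE; ring.
have e_k2 : e k.+2 = (t + 4 * n + 3) ^+ 2.
  by rewrite /e; congr (_ ^+ 2); rewrite nE; ring.
have e_k3 : e k.+3 = (t + 4 * n + 5) ^+ 2.
  by rewrite /e; congr (_ ^+ 2); rewrite nE; ring.
have prodE1 : \prod_(j < k.+1) (t + (2 * k + 2 * j + 1)%:R) ^+ 2
    = E * (t + 2 * n - 1) ^+ 2.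
  rewrite big_ord_recl mulrC /=; congr (_ * _ ^+ 2).
    by apply: eq_bigr => j _; rewrite /e; congr ((_ + _%:R) ^+ 2); rewrite /bump /=; lia.
  by rewrite nE; ring.
have prodE2 : \prod_(j < k.+2) (t + (2 * k.+1 + 2 * j + 1)%:R) ^+ 2
    = E * (t + 4 * n - 1) ^+ 2 * (t + 4 * n + 1) ^+ 2.
  transitivity (\prod_(j < k.+2) e j); last by rewrite 2!big_ord_recr /= e_k e_k1.
  by apply: eq_bigr => j _; rewrite /e; congr ((_ + _%:R) ^+ 2); lia.
have prodE4 : \prod_(j < k.+4) e j
    = E * (t + 4 * n - 1) ^+ 2 * (t + 4 * n + 1) ^+ 2
      * (t + 4 * n + 3) ^+ 2 * (t + 4 * n + 5) ^+ 2.
  by rewrite 4!big_ord_recr /= e_k e_k1 e_k2 e_k3.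
have prodE3 : \prod_(j < k.+3) (t + (2 * k.+2 + 2 * j + 1)%:R) ^+ 2
    = E * (t + 4 * n - 1) ^+ 2 * (t + 4 * n + 1) ^+ 2
      * (t + 4 * n + 3) ^+ 2 * (t + 4 * n + 5) ^+ 2 / (t + 2 * n + 1) ^+ 2.
  have e0 : e 0%N = (t + 2 * n + 1) ^+ 2.
    by rewrite /e; congr (_ ^+ 2); rewrite nE; ring.
  rewrite -prodE4 [in RHS]big_ord_recl /= e0 mulrAC divff ?expf_neq0 // ?mul1r; last exact: nP 2 1.
  by apply: eq_bigr => j _; rewrite /e; congr ((_ + _%:R) ^+ 2); rewrite /bump /=; lia.
have prodE' : \prod_(l < k.+4) (t + (2 * k + 2 * l + 1)%:R) ^+ 2
    = (t + 2 * n - 1) ^+ 2 * E * (t + 4 * n - 1) ^+ 2 * (t + 4 * n + 1) ^+ 2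
      * (t + 4 * n + 3) ^+ 2.
  transitivity ((t + 2 * n - 1) ^+ 2 * \prod_(j < k.+3) e j).
    rewrite big_ord_recl /=; congr (_ ^+ 2 * _); first by rewrite nE; ring.
    by apply: eq_bigr => j _; rewrite /e; congr ((_ + _%:R) ^+ 2); rewrite /bump /=; lia.
  by rewrite 3!big_ord_recr /= e_k e_k1 e_k2 !mulrA.
have prodZ2 : \prod_(i < 2 * k.+1) ((t + i.+1%:R) ^+ 2 - 4^-1 ^+ 2)
    = Z * ((t + (2 * n - 1)) ^+ 2 - 4^-1 ^+ 2) * ((t + 2 * n) ^+ 2 - 4^-1 ^+ 2).
  rewrite mulnS 2!big_ord_recr /=; congr (_ * (_ ^+ 2 - _) * (_ ^+ 2 - _)).
  - by rewrite nE; ring.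
  - by rewrite nE; ring.
have prodZ4 : \prod_(i < 2 * k.+2) ((t + i.+1%:R) ^+ 2 - 4^-1 ^+ 2)
    = Z * ((t + (2 * n - 1)) ^+ 2 - 4^-1 ^+ 2) * ((t + 2 * n) ^+ 2 - 4^-1 ^+ 2)
      * ((t + (2 * n + 1)) ^+ 2 - 4^-1 ^+ 2) * ((t + (2 * n + 2)) ^+ 2 - 4^-1 ^+ 2).
  rewrite mulnS 2!big_ord_recr /= prodZ2; congr (_ * (_ ^+ 2 - _) * (_ ^+ 2 - _)).
  - by rewrite nE; ring.
  - by rewrite nE; ring.
have prodZ' : \prod_(i < 2 * k.+1) ((t + i%:R - 1) ^+ 2 - 4^-1 ^+ 2)
    = ((t - 1) ^+ 2 - 4^-1 ^+ 2) * ((t + 0) ^+ 2 - 4^-1 ^+ 2) * Z.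
  rewrite mulnS 2!big_ord_recl /= mulrA; congr ((_ ^+ 2 - _) * (_ ^+ 2 - _) * _).
  - by rewrite addr0.
  - by rewrite /bump /=; ring.
  - apply: eq_bigr => i _; congr (_ ^+ 2 - _).
    by rewrite /bump /= !add1n; ring.
have shiftZ : \prod_(i < 2 * k.+1) ((t + 2 + i%:R - 1) ^+ 2 - 4^-1 ^+ 2)
    = Z * ((t + (2 * n - 1)) ^+ 2 - 4^-1 ^+ 2) * ((t + 2 * n) ^+ 2 - 4^-1 ^+ 2).
  by rewrite -prodZ2; apply: eq_bigr => i _; congr (_ ^+ 2 - _); ring.
have shiftD : \prod_(j < k.+2) (t + 2 - (2 * j.+1)%:R) ^+ 2 = D * (t - 2 * n) ^+ 2.
  by rewrite -prodD2; apply: eq_bigr => i _; congr (_ ^+ 2); ring.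
have shiftE4 : \prod_(l < k.+4) (t + 2 + (2 * k + 2 * l + 1)%:R) ^+ 2
    = E * (t + 4 * n - 1) ^+ 2 * (t + 4 * n + 1) ^+ 2
      * (t + 4 * n + 3) ^+ 2 * (t + 4 * n + 5) ^+ 2.
  by rewrite -prodE4; apply: eq_bigr => i _; rewrite /e; congr (_ ^+ 2); ring.
have prod_split m :
    \prod_(j < m.+1) ((t - (2 * j)%:R) ^+ 2 * (t + (2 * m + 2 * j + 1)%:R) ^+ 2)
    = (\prod_(j < m.+1) (t - (2 * j)%:R) ^+ 2)
      * \prod_(j < m.+1) (t + (2 * m + 2 * j + 1)%:R) ^+ 2 by rewrite big_split.
have H := @certificate_reduced n t c Z D E.
rewrite /zero_factor (_ : IZR (-1) = - IZR 1) // in H.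
rewrite ?(R0E, R1E, RplusE, RminusE, RmultE, RdivE, RinvE, RpowE, RoppE, IZRposE, INRE) /= in H.
rewrite /kernel_cert shiftZ shiftD shiftE4 prodZ' prodD' prodE'.
rewrite /kernel !prod_split prodZ2 prodZ4 prodD2 prodD3 prodE1 prodE2 prodE3.
have const2 : kernel_const k.+2 = c * (48 * (n + 1) ^+ 2 * (6 * n + 5) * (6 * n + 7)
    / ((2 * n + 1) * (2 * n + 3) * (4 * n + 3) * (4 * n + 5))) :> R.
  by rewrite {1}/kernel_const big_ord_recr.
have const0 : kernel_const k = c / (48 * n ^+ 2 * (6 * n - 1) * (6 * n + 1)
    / ((2 * n - 1) * (2 * n + 1) * (4 * n - 1) * (4 * n + 1))) :> R.
  exact: kernel_const_pred.
have lin2 : 2 * t + (2 * k.+2 + 1)%:R = 2 * t + 2 * n + 3 by rewrite nE; ring.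
have lin1 : 2 * t + (2 * k.+1 + 1)%:R = 2 * t + 2 * n + 1 by rewrite nE; ring.
have lin0 : 2 * t + (2 * k + 1)%:R = 2 * t + 2 * n - 1 by rewrite nE; ring.
rewrite const2 const0 lin2 lin1 lin0; apply: etrans (etrans (H _ _ _ _ _ _ _ _ _ _ _ _) _).
all: rewrite -/n -/c //.
- exact/RltP.
all: apply/eqP => //; try exact: nN; try exact: tN 0%N.
- by have := nN 2%N 0%N; rewrite subr0.
- exact: (nM 2%N 1%N).
- exact: (nP 2%N 1%N).
- exact: (nM 4%N 1%N).
- exact: (nP 4%N 1%N).
Qed.

(** * Alternating series *)

Section Alternating.
Context {K : realType}.
Implicit Types (u : nat -> K) (phi : K -> K) (y : K).

Definition alt_sum u N : K := \sum_(1 <= k < N) (-1) ^+ k * u k.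

Lemma alt_sumS u N : (0 < N)%N -> alt_sum u N.+1 = alt_sum u N + (-1) ^+ N * u N.
Proof. by move=> N0; rewrite /alt_sum big_nat_recr. Qed.

Section Leibniz.
Context (u : nat -> K).
Context (u_decr : forall k, (0 < k)%N -> u k.+1 <= u k) (u_cvg0 : u @ \oo --> (0 : K)).

Lemma alternating_term_ge0 k : (0 < k)%N -> 0 <= u k.
Proof.
move=> k0; apply: (cvgr_to_le u_cvg0); near=> m.
have /subnKC <- : (k <= m)%N by near: m; exact: nbhs_infty_ge.
elim: (m - k)%N => [|d IHd]; first by rewrite addn0.
by apply: le_trans IHd; rewrite addnS u_decr // addn_gt0 k0.
Unshelve. all: by end_near. Qed.

(** Leibniz: a block of consecutive terms has the sign of its first term and does
    not exceed it. *)
Lemma alternating_block N d : (0 < N)%N ->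
  0 <= (-1) ^+ N * (alt_sum u (N + d) - alt_sum u N) <= u N.
Proof.
elim: d N => [|d IHd] N N0.
  by rewrite addn0 subrr mulr0 lexx alternating_term_ge0.
have /andP[] := IHd N.+1 isT; rewrite addSnnS alt_sumS //.
have := u_decr N0; have := alternating_term_ge0 N0.
have : (-1) ^+ N * (-1) ^+ N = 1 :> K by rewrite -expr2 sqrr_sign.
rewrite exprS; move: ((-1) ^+ N) (alt_sum u (N + d.+1)) (alt_sum u N) (u N) (u N.+1)
  => s a b v v' ss v0 vv' h1 h2.
have -> : s * (a - b) = s * s * v + s * (a - (b + s * v)) by ring.
by rewrite ss; apply/andP; split; lra.
Qed.

Lemma alternating_dist N M : (0 < N <= M)%N -> `|alt_sum u M - alt_sum u N| <= u N.
Proof.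
case/andP=> N0 /subnKC <-; have /andP[h1 h2] := alternating_block (M - N) N0.
rewrite -[`|_|]mul1r -(normr_sign K (odd N)) signr_odd -normrM ger0_norm //.
Qed.

Lemma is_cvg_alternating : cvgn (alt_sum u).
Proof.
apply/cauchy_cvgP/cauchy_exP => e e0.
have : \forall m \near \oo, u m < e by apply: cvgr_lt u_cvg0 _ e0.
case=> N _ uN; exists (alt_sum u N.+1).
suff : \forall m \near \oo, ball (alt_sum u N.+1) e (alt_sum u m) by [].
near=> m; rewrite /= -ball_normE /= distrC.
apply: le_lt_trans (@alternating_dist N.+1 m _) _; last by apply: uN => /=.
by apply/andP; split=> //; near: m; exact: nbhs_infty_ge.
Unshelve. all: by end_near. Qed.

Lemma alternating_tail N : (0 < N)%N -> `|limn (alt_sum u) - alt_sum u N| <= u N.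
Proof.
move=> N0.
have : (fun m => alt_sum u m - alt_sum u N) @ \oo --> limn (alt_sum u) - alt_sum u N.
  by apply: cvgB; [exact: is_cvg_alternating|exact: cvg_cst].
move=> /cvg_norm cvg_dist; apply: (cvgr_to_le cvg_dist).
near=> m; apply: alternating_dist; rewrite N0 /=.
by near: m; exact: nbhs_infty_ge.
Unshelve. all: by end_near. Qed.

End Leibniz.

(** An odd shift of the summation index reverses the signs: what is left is the
    tail of the original series, with the opposite sign. *)
Lemma cvg_alternating_up phi y b (T : K) :
  alt_sum (fun k => phi (k%:R + y)) @ \oo --> T ->
  (fun M => \sum_(0 <= m < M) (-1) ^+ m * phi (m%:R + (2 * b + 1)%:R + y)) @ \oo -->
  alt_sum (fun k => phi (k%:R + y)) (2 * b + 1) - T.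
Proof.
move=> cvT; set s := alt_sum _.
have -> : (fun M => \sum_(0 <= m < M) (-1) ^+ m * phi (m%:R + (2 * b + 1)%:R + y))
    = (fun M => s (2 * b + 1)%N - s (M + (2 * b + 1))%N).
  apply/funext => M; elim: M => [|M IHM]; first by rewrite add0n subrr big_nil.
  rewrite big_nat_recr //= IHM addSn /s alt_sumS ?addn_gt0 ?addn1 ?orbT //.
  rewrite exprD exprS exprM sqrrN !expr1n mulr1 mulrN1 natrD.
  by rewrite mulNr opprD opprK addrA.
by apply: cvgB; [exact: cvg_cst|rewrite cvg_shiftn].
Qed.

(** The terms with [m < 2 * e] have negative arguments; the parity [eps] of [phi]
    folds them back to a partial sum at [- y], the term [m = 2 * e] gives [phi y],
    and the rest is the full series. *)
Lemma cvg_alternating_down phi (eps : K) y e (T : K) :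
  (forall z, phi (- z) = eps * phi z) ->
  alt_sum (fun k => phi (k%:R + y)) @ \oo --> T ->
  (fun M => \sum_(0 <= m < M) (-1) ^+ m * phi (m%:R - (2 * e)%:R + y)) @ \oo -->
  eps * alt_sum (fun k => phi (k%:R - y)) (2 * e + 1) + phi y + T.
Proof.
move=> phiN cvT; set s := alt_sum _; pose s' := alt_sum (fun k => phi (k%:R + y)).
rewrite -(cvg_shiftn (2 * e)) -(cvg_shiftn 1).
rewrite (_ : [sequence _]_n = (fun M => eps * s (2 * e + 1)%N + phi y + s' (M + 1)%N)).
  by apply: cvgD; [exact: cvg_cst|rewrite cvg_shiftn].
apply/funext => M /=; rewrite (big_cat_nat (n := 2 * e)) //=; last by lia.
rewrite -addrA; congr (_ + _).
  rewrite big_nat_rev /= /s /alt_sum addn1 big_add1 /= mulr_sumr.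
  apply: eq_big_nat => m /andP[_ lt_m]; rewrite add0n natrB // mulrCA -phiN.
  have -> : (-1) ^+ (2 * e - m.+1) = (-1) ^+ m.+1 :> K.
    by rewrite -signr_odd oddB // oddM addFb signr_odd.
  by congr (_ * phi _); ring.
rewrite -{1}[(2 * e)%N]add0n big_addn addnK addn1 big_nat_recl //= /s' /alt_sum.
rewrite big_add1 /= !add0n exprM sqrrN expr1n expr1n mul1r.
congr (phi _ + _); first by ring.
apply: eq_bigr => m _; rewrite exprD exprM sqrrN expr1n expr1n mulr1.
by congr (_ * phi _); rewrite natrD; ring.
Qed.

End Alternating.

(** * Alternating sums of the kernel *)

Section KernelSums.
Context {K : realType}.
Implicit Types (y : K) (n i j N : nat).

Definition alt_inv y N : K := alt_sum (fun k => (k%:R + y)^-1) N.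
Definition alt_inv2 y N : K := alt_sum (fun k => (k%:R + y) ^- 2) N.

Lemma shift_ge y (k : nat) : `|y| = 4^-1 -> (0 < k)%N -> 3 / 4 <= k%:R + y.
Proof.
move=> hy k0; have : 1 <= k%:R :> K by rewrite ler1n.
by have := ler_norm (- y); rewrite normrN hy; lra.
Qed.

Lemma shift_neq0 y (a b : nat) : `|y| = 4^-1 -> a%:R - b%:R + y != 0.
Proof.
move=> hy; apply/negP => /eqP ab0.
have le1 := ler_norm y; have le2 := ler_norm (- y); rewrite normrN hy in le2.
rewrite hy in le1; case: (ltngtP a b) => [||eq_ab].
- by rewrite -(ler_nat K) -natr1; lra.
- by rewrite -(ler_nat K) -natr1; lra.
have y0 : y = 0 by move: ab0; rewrite eq_ab; lra.
by move: hy; rewrite y0 normr0; lra.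
Qed.

Lemma inv_shift_decr y (k : nat) : `|y| = 4^-1 -> (0 < k)%N ->
  (k.+1%:R + y)^-1 <= (k%:R + y)^-1.
Proof.
move=> hy k0; have := shift_ge hy k0; rewrite -natr1 => ge.
by rewrite lef_pV2 ?posrE; lra.
Qed.

Lemma inv2_shift_decr y (k : nat) : `|y| = 4^-1 -> (0 < k)%N ->
  (k.+1%:R + y) ^- 2 <= (k%:R + y) ^- 2.
Proof.
move=> hy k0; have := shift_ge hy k0; rewrite -natr1 => ge.
by rewrite lef_pV2 ?posrE ?exprn_gt0 ?ler_sqr ?nnegrE; lra.
Qed.

Lemma inv_shift_cvg0 y : (fun k : nat => (k%:R + y)^-1) @ \oo --> (0 : K).
Proof.
have cvy : (fun k : nat => k%:R + y) @ \oo --> +oo.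
  apply/cvgryPge => a; near=> k; rewrite -lerBlDr.
  by near: k; exact: nbhs_infty_ger.
apply/(gtr0_cvgV0 _) => //; near=> k.
have : 1 - y <= k%:R by near: k; exact: nbhs_infty_ger.
by lra.
Unshelve. all: by end_near. Qed.

Lemma inv2_shift_cvg0 y : (fun k : nat => (k%:R + y) ^- 2) @ \oo --> (0 : K).
Proof.
rewrite -(mulr0 0) (_ : (fun k : nat => _) = (fun k : nat => (k%:R + y)^-1 * (k%:R + y)^-1)).
  by apply: cvgM; exact: inv_shift_cvg0.
by apply/funext => k; rewrite expr2 invfM.
Qed.

Lemma is_cvg_alt_inv y : `|y| = 4^-1 -> cvgn (alt_inv y).
Proof.
move=> hy; apply: is_cvg_alternating; last exact: inv_shift_cvg0.
by move=> k; exact: inv_shift_decr.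
Qed.

Lemma is_cvg_alt_inv2 y : `|y| = 4^-1 -> cvgn (alt_inv2 y).
Proof.
move=> hy; apply: is_cvg_alternating; last exact: inv2_shift_cvg0.
by move=> k; exact: inv2_shift_decr.
Qed.

Lemma alt_inv2_tail y N : `|y| = 4^-1 -> (0 < N)%N ->
  `|limn (alt_inv2 y) - alt_inv2 y N| <= (N%:R + y) ^- 2.
Proof.
move=> hy N0; apply: alternating_tail => //; last exact: inv2_shift_cvg0.
by move=> k; exact: inv2_shift_decr.
Qed.

(** The partial fractions are summed pole by pole: the pole [2 j] turns into an even
    shift, the pole [- 2n - 1 - 2j] into an odd one. The term
    [y^-1] that would accompany each [coefB j] disappears because the [coefB j] sum
    to [0]. *)
Lemma kernel_sum_cvg n i y : (i <= n)%N -> `|y| = 4^-1 ->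
  (fun M => \sum_(0 <= m < M) (-1) ^+ m * kernel n (m%:R - (2 * i)%:R + y)) @ \oo -->
  \sum_(j < n.+1)
    (coefA j * (2 * limn (alt_inv2 y) + y ^- 2 + alt_inv2 (- y) (2 * (i + j) + 1)
                - alt_inv2 y (2 * (n - i + j) + 1))
     + coefB j * (alt_inv y (2 * (n - i + j) + 1) - alt_inv (- y) (2 * (i + j) + 1))).
Proof.
move=> le_in hy.
pose s (phi : K -> K) z M := \sum_(0 <= m < M) (-1) ^+ m * phi (m%:R + z + y).
have -> : (fun M => \sum_(0 <= m < M) (-1) ^+ m * kernel n (m%:R - (2 * i)%:R + y))
    = (fun M => \sum_(j < n.+1)
        (coefA j * (s (fun z => z ^- 2) (- (2 * (i + j))%:R) M
                    - s (fun z => z ^- 2) (2 * (n - i + j) + 1)%:R M)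
         + coefB j * (s GRing.inv (- (2 * (i + j))%:R) M
                    + s GRing.inv (2 * (n - i + j) + 1)%:R M))).
  apply/funext => M.
  pose f (m j : nat) (A B : K) := (-1) ^+ m *
    (A * ((m%:R - (2 * (i + j))%:R + y) ^- 2 - (m%:R + (2 * (n - i + j) + 1)%:R + y) ^- 2)
     + B * ((m%:R - (2 * (i + j))%:R + y)^-1 + (m%:R + (2 * (n - i + j) + 1)%:R + y)^-1)).
  transitivity (\sum_(j < n.+1) \sum_(0 <= m < M) f m j (coefA j) (coefB j)).
    rewrite exchange_big; apply: eq_bigr => m _ /=.
    rewrite kernel_partial_fractions => [|j|j]; last 2 first.
    - have -> : m%:R - (2 * i)%:R + y - (2 * j)%:R = m%:R - (2 * i + 2 * j)%:R + y :> K.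
        by rewrite natrD; ring.
      exact: shift_neq0.
    - have -> : m%:R - (2 * i)%:R + y + j%:R = (m + j)%:R - (2 * i)%:R + y :> K.
        by rewrite natrD; ring.
      exact: shift_neq0.
    rewrite mulr_sumr; apply: eq_bigr => j _; rewrite /f.
    have -> : m%:R - (2 * i)%:R + y - (2 * j)%:R = m%:R - (2 * (i + j))%:R + y :> K.
      by ring.
    have -> // : m%:R - (2 * i)%:R + y + (2 * n + 2 * j + 1)%:R
      = m%:R + (2 * (n - i + j) + 1)%:R + y :> K.
    have -> : (2 * n + 2 * j + 1 = 2 * (n - i + j) + 1 + 2 * i)%N by lia.
    by rewrite natrD; ring.
  apply: eq_bigr => j _; rewrite /s -sumrB -big_split /= !mulr_sumr -big_split /=.
  by apply: eq_bigr => m _; rewrite /f; ring.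
have cvg2 : alt_sum (fun k => (k%:R + y) ^- 2) @ \oo --> limn (alt_inv2 y).
  exact: is_cvg_alt_inv2.
have cvg1 : alt_sum (fun k => (k%:R + y)^-1) @ \oo --> limn (alt_inv y).
  exact: is_cvg_alt_inv.
have -> : \sum_(j < n.+1)
    (coefA j * (2 * limn (alt_inv2 y) + y ^- 2 + alt_inv2 (- y) (2 * (i + j) + 1)
                - alt_inv2 y (2 * (n - i + j) + 1))
     + coefB j * (alt_inv y (2 * (n - i + j) + 1) - alt_inv (- y) (2 * (i + j) + 1)))
  = \sum_(j < n.+1)
    (coefA j * (1 * alt_inv2 (- y) (2 * (i + j) + 1) + y ^- 2 + limn (alt_inv2 y)
                - (alt_inv2 y (2 * (n - i + j) + 1) - limn (alt_inv2 y)))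
     + coefB j * (-1 * alt_inv (- y) (2 * (i + j) + 1) + y^-1 + limn (alt_inv y)
                 + (alt_inv y (2 * (n - i + j) + 1) - limn (alt_inv y)))).
  (* The two sides differ by multiples of the vanishing sum of the coefB. *)
  have B0 : \sum_(j < n.+1) coefB j * y^-1 = 0 by rewrite -mulr_suml sum_coefB mul0r.
  apply/eqP; rewrite -subr_eq0 -sumrB; apply/eqP.
  transitivity (- \sum_(j < n.+1) coefB j * y^-1); last by rewrite B0 oppr0.
  by rewrite -sumrN; apply: eq_bigr => j _; ring.
apply: cvg_big => [|j _]; first exact: add_continuous.
apply: cvgD; apply: cvgM; try exact: cvg_cst.
- apply: cvgB; last exact: cvg_alternating_up.
  apply: (cvg_alternating_down _ cvg2) => z.
  by rewrite sqrrN mul1r.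
- apply: cvgD; last exact: cvg_alternating_up.
  apply: (cvg_alternating_down _ cvg1) => z.
  by rewrite invrN mulN1r.
Qed.

End KernelSums.

(** * The linear forms *)

Section LinearForms.
Context {K : realType}.
Implicit Types (y : K) (n i j N : nat).

Definition kernel_partial_sum n y (M : nat) : K :=
  \sum_(0 <= m < M) (-1) ^+ m * kernel n (m%:R + y).

Definition kernel_sum n y : K := limn (kernel_partial_sum n y).

Definition coefA_sum n : K := \sum_(j < n.+1) coefA j.

(** The sum of [(-1) ^ k / (k + 1/4) ^ 2] over all integers [k], counted twice. *)
Definition beta_period : K := 2 * (limn (alt_inv2 4^-1) + limn (alt_inv2 (- 4^-1))) + 32.

(** If [l] is the sum of [chi(u) / u ^ 2] over the odd [u > 0], where [chi] is the
    character modulo [8] with [chi(3) = 1] and [chi(5) = -1], this is [16 * (l - 1)]: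
    see [chi_partial_cvg]. *)
Definition chi_period : K := limn (alt_inv2 4^-1) - limn (alt_inv2 (- 4^-1)).

Let norm_quarter : `|4^-1 : K| = 4^-1. Proof. by rewrite ger0_norm // invr_ge0. Qed.
Let norm_Nquarter : `|- 4^-1 : K| = 4^-1. Proof. by rewrite normrN. Qed.

Lemma kernel_partial_sum_cvg0 n y : `|y| = 4^-1 ->
  kernel_partial_sum n y @ \oo -->
  \sum_(j < n.+1)
    (coefA j * (2 * limn (alt_inv2 y) + y ^- 2 + alt_inv2 (- y) (2 * j + 1)
                - alt_inv2 y (2 * (n + j) + 1))
     + coefB j * (alt_inv y (2 * (n + j) + 1) - alt_inv (- y) (2 * j + 1))).
Proof.
move=> hy; have := kernel_sum_cvg (leq0n n) hy; rewrite subn0.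
have -> // : (fun M => \sum_(0 <= m < M) (-1) ^+ m * kernel n (m%:R - (2 * 0)%:R + y))
  = kernel_partial_sum n y.
by apply/funext => M; apply: eq_bigr => m _; rewrite muln0 subr0.
Qed.

Lemma kernel_eq0 n y k : `|y| = 4^-1 -> (0 < k <= 2 * n)%N -> kernel n (- k%:R + y) = 0.
Proof.
move=> hy /andP[k0 kn]; have lt_k : (k.-1 < 2 * n)%N by lia.
rewrite /kernel (bigD1 (Ordinal lt_k)) //= prednK // addrAC addNr add0r.
by rewrite -(real_normK (num_real y)) hy subrr mul0r mulr0 mul0r.
Qed.

(** The kernel vanishes at [- k + y] for [1 <= k <= 2 * n], so that the sum may as
    well start at [- 2 * n]. This exchanges the roles of the two families of poles,
    hence the lengths of the partial sums at [y] and at [- y]. *)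
Lemma kernel_partial_sum_cvg1 n y : `|y| = 4^-1 ->
  kernel_partial_sum n y @ \oo -->
  \sum_(j < n.+1)
    (coefA j * (2 * limn (alt_inv2 y) + y ^- 2 + alt_inv2 (- y) (2 * (n + j) + 1)
                - alt_inv2 y (2 * j + 1))
     + coefB j * (alt_inv y (2 * j + 1) - alt_inv (- y) (2 * (n + j) + 1))).
Proof.
move=> hy; have := kernel_sum_cvg (leqnn n) hy; rewrite subnn -(cvg_shiftn (2 * n)).
have -> // : [sequence \sum_(0 <= m < M + 2 * n)
                 (-1) ^+ m * kernel n (m%:R - (2 * n)%:R + y)]_M
  = kernel_partial_sum n y.
apply/funext => M /=; rewrite (big_cat_nat (n := 2 * n)) //=; last by lia.
rewrite big1_seq ?add0r => [|m]; last first.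
  rewrite mem_index_iota => /andP[_ lt_m].
  have -> : m%:R - (2 * n)%:R + y = - (2 * n - m)%:R + y by rewrite natrB ?opprB // ltnW.
  by rewrite kernel_eq0 ?mulr0 //; lia.
rewrite -{1}[(2 * n)%N]add0n big_addn addnK; apply: eq_bigr => m _.
rewrite exprD exprM sqrrN !expr1n mulr1 natrD.
by congr (_ * kernel _ _); ring.
Qed.

Lemma kernel_partial_sum_cvg n y : `|y| = 4^-1 ->
  kernel_partial_sum n y @ \oo --> kernel_sum n y.
Proof.
move=> hy; have cv := kernel_partial_sum_cvg0 (n := n) hy.
by rewrite /kernel_sum (cvg_lim _ cv).
Qed.

(** With the sum at [1/4] started at [0] and the one at [- 1/4] started at [- 2n], all
    partial sums cancel, and only the multiple of the period is left. *)
Lemma kernel_sum_add n :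
  kernel_sum n 4^-1 + kernel_sum n (- 4^-1) = coefA_sum n * beta_period.
Proof.
rewrite /kernel_sum (cvg_lim _ (kernel_partial_sum_cvg0 (n := n) norm_quarter)) //.
rewrite (cvg_lim _ (kernel_partial_sum_cvg1 (n := n) norm_Nquarter)) //.
rewrite -big_split mulr_suml; apply: eq_bigr => j _ /=.
by rewrite opprK /beta_period sqrrN; field.
Qed.

(** These differences decrease to [0], so that the simple poles contribute partial
    sums of a Leibniz series. *)
Definition inv_gap (k : nat) : K := (k%:R - 4^-1)^-1 - (k%:R + 4^-1)^-1.

Lemma inv_gapE (k : nat) : (0 < k)%N -> inv_gap k = (2 * (k%:R ^+ 2 - 16^-1))^-1.
Proof.
move=> k0; have : 1 <= k%:R :> K by rewrite ler1n.
rewrite /inv_gap; move: k%:R => x x1.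
by field; do ![apply/andP; split]; nra.
Qed.

Lemma inv_gap_decr (k : nat) : (0 < k)%N -> inv_gap k.+1 <= inv_gap k.
Proof.
move=> k0; rewrite !inv_gapE // -[k.+1%:R]natr1; have : 1 <= k%:R :> K by rewrite ler1n.
by move: k%:R => x x1; rewrite lef_pV2 ?posrE; nra.
Qed.

Lemma inv_gap_cvg0 : inv_gap @ \oo --> (0 : K).
Proof.
rewrite -[0]subr0; apply: cvgB; last exact: inv_shift_cvg0.
exact: inv_shift_cvg0.
Qed.

Lemma alt_sum_inv_gap N : alt_sum inv_gap N = alt_inv (- 4^-1) N - alt_inv 4^-1 N.
Proof.
rewrite /alt_inv /alt_sum -sumrB; apply: eq_bigr => k _.
by rewrite /inv_gap mulrBr.
Qed.

(** With both sums started at [0], the coefficients of [coefA j] are tails of the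
    series for [chi_period]. *)
Lemma kernel_sum_sub n :
  kernel_sum n 4^-1 - kernel_sum n (- 4^-1) =
  \sum_(j < n.+1)
    (coefA j * ((chi_period - (alt_inv2 4^-1 (2 * j + 1) - alt_inv2 (- 4^-1) (2 * j + 1)))
        + (chi_period
           - (alt_inv2 4^-1 (2 * (n + j) + 1) - alt_inv2 (- 4^-1) (2 * (n + j) + 1))))
     - coefB j * (alt_sum inv_gap (2 * j + 1) + alt_sum inv_gap (2 * (n + j) + 1))).
Proof.
rewrite /kernel_sum (cvg_lim _ (kernel_partial_sum_cvg0 (n := n) norm_quarter)) //.
rewrite (cvg_lim _ (kernel_partial_sum_cvg0 (n := n) norm_Nquarter)) //.
rewrite -sumrB; apply: eq_bigr => j _ /=.
by rewrite opprK /chi_period sqrrN !alt_sum_inv_gap; ring.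
Qed.

(** All partial sums that occur have length at least [2 * j + 1]; this compares the
    first omitted term with the weight of [sum_coefA_weighted]. *)
Lemma quarter_tail_le j N : (2 * j + 1 <= N)%N ->
  (N%:R - 4^-1) ^- 2 <= 2 / j.+1%:R ^+ 2 :> K.
Proof.
move=> le_N; have : 2 * j%:R + 1 <= N%:R :> K by rewrite -natrM natr1 ler_nat -addn1.
rewrite -[j.+1%:R]natr1; have : 0 <= j%:R :> K by [].
move: (j%:R : K) (N%:R : K) => x y x0 xy.
rewrite ler_pdivlMr ?exprn_gt0 ?ltr_wpDl // mulrC ler_pdivrMr ?exprn_gt0 //; last lra.
have : 3 / 4 * (x + 1) <= y - 4^-1 by lra.
have : 0 <= 3 / 4 * (x + 1) by lra.
move: (y - _) => z h0 h1; have : (3 / 4 * (x + 1)) ^+ 2 <= z ^+ 2.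
  by rewrite ler_sqr ?nnegrE //; lra.
by have := sqr_ge0 (x + 1); lra.
Qed.

(** Both the coefficient of [coefA j] and that of [coefB j] are tails, of size
    [1 / j.+1 ^ 2]: for the latter, the partial sums of [inv_gap] may be replaced by
    their distance to the limit [W], as the [coefB j] sum to [0]. By [coefB_bound]
    the sum is then of order [n] times the weighted sum of the [coefA j], which is of
    order [n ^- 2]. *)
Lemma kernel_sum_sub_bound n : (0 < n)%N ->
  `|kernel_sum n 4^-1 - kernel_sum n (- 4^-1)| <= 300 / n%:R * coefA_sum n.
Proof.
move=> n0; set W := limn (alt_sum inv_gap).
have n1 : 1 <= n%:R :> K by rewrite ler1n.
have chi_tail j N : (2 * j + 1 <= N)%N ->
    `|chi_period - (alt_inv2 4^-1 N - alt_inv2 (- 4^-1) N)| <= 4 / j.+1%:R ^+ 2.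
  move=> le_N; have N0 : (0 < N)%N by lia.
  have N1 : 1 <= N%:R :> K by rewrite ler1n.
  have -> : chi_period - (alt_inv2 4^-1 N - alt_inv2 (- 4^-1) N) =
    (limn (alt_inv2 4^-1) - alt_inv2 4^-1 N)
    - (limn (alt_inv2 (- 4^-1)) - alt_inv2 (- 4^-1) N) by rewrite /chi_period; ring.
  apply: le_trans (ler_normB _ _) _.
  have := alt_inv2_tail norm_quarter N0; have := alt_inv2_tail norm_Nquarter N0.
  have := quarter_tail_le le_N.
  have : (N%:R + 4^-1) ^- 2 <= (N%:R - 4^-1) ^- 2 :> K.
    by rewrite lef_pV2 ?posrE ?exprn_gt0 ?ler_sqr ?nnegrE; lra.
  by move: (j.+1%:R ^+ 2) => z; lra.
have gap_tail j N : (2 * j + 1 <= N)%N -> `|W - alt_sum inv_gap N| <= 1 / j.+1%:R ^+ 2.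
  move=> le_N; have N0 : (0 < N)%N by lia.
  have N1 : 1 <= N%:R :> K by rewrite ler1n.
  apply: le_trans (alternating_tail inv_gap_decr inv_gap_cvg0 N0) _.
  rewrite inv_gapE //; have := quarter_tail_le le_N.
  have : (2 * (N%:R ^+ 2 - 16^-1))^-1 <= (2 * (N%:R - 4^-1) ^+ 2)^-1 :> K.
    by rewrite lef_pV2 ?posrE; nra.
  rewrite invfM; move: (j.+1%:R ^+ 2) => z; lra.
have -> : kernel_sum n 4^-1 - kernel_sum n (- 4^-1) =
  \sum_(j < n.+1)
    (coefA j * ((chi_period - (alt_inv2 4^-1 (2 * j + 1) - alt_inv2 (- 4^-1) (2 * j + 1)))
        + (chi_period
           - (alt_inv2 4^-1 (2 * (n + j) + 1) - alt_inv2 (- 4^-1) (2 * (n + j) + 1))))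
     + coefB j * ((W - alt_sum inv_gap (2 * j + 1))
                  + (W - alt_sum inv_gap (2 * (n + j) + 1)))).
  rewrite kernel_sum_sub.
  have B0 : \sum_(j < n.+1) coefB j * (2 * W) = 0 by rewrite -mulr_suml sum_coefB mul0r.
  apply/eqP; rewrite -subr_eq0 -sumrB; apply/eqP.
  transitivity (- \sum_(j < n.+1) coefB j * (2 * W)); last by rewrite B0 oppr0.
  by rewrite -sumrN; apply: eq_bigr => j _; ring.
apply: le_trans (ler_norm_sum _ _ _) _.
apply: (@le_trans _ _ (\sum_(j < n.+1) (34 * n%:R) * (coefA j / j.+1%:R ^+ 2))).
  apply: ler_sum => j _; apply: le_trans (ler_normD _ _) _.
  rewrite [`|coefA j * _|]normrM [`|coefB j * _|]normrM.
  have A0 : 0 < coefA j :> K by exact: coefA_gt0.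
  rewrite [`|coefA j|]gtr0_norm //.
  have := coefB_bound (K := K) j n0.
  have le1 := chi_tail j _ (leqnn _).
  have le2 : (2 * j + 1 <= 2 * (n + j) + 1)%N by lia.
  have le3 := chi_tail j _ le2.
  have le4 := gap_tail j _ (leqnn _).
  have le5 := gap_tail j _ le2.
  set a := coefA j in A0 *; set b := `|coefB j|; set z := j.+1%:R ^+ 2 in le1 le3 le4 le5 *.
  move=> b_le.
  have z0 : 0 <= z^-1 by rewrite invr_ge0 exprn_ge0.
  have le6 : a * `|chi_period - (alt_inv2 4^-1 (2 * j + 1) - alt_inv2 (- 4^-1) (2 * j + 1))
     + (chi_period - (alt_inv2 4^-1 (2 * (n + j) + 1) - alt_inv2 (- 4^-1) (2 * (n + j) + 1)))|
     <= a * (8 * z^-1).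
    by apply: ler_wpM2l; [exact: ltW|apply: le_trans (ler_normD _ _) _; lra].
  have le7 : b * `|W - alt_sum inv_gap (2 * j + 1) + (W - alt_sum inv_gap (2 * (n + j) + 1))|
     <= 13 * n%:R * a * (2 * z^-1).
    apply: (ler_pM _ _ b_le _) => //; first exact: normr_ge0.
    by apply: le_trans (ler_normD _ _) _; lra.
  apply: le_trans (lerD le6 le7) _.
  have az0 : 0 <= a * z^-1 by apply: mulr_ge0 => //; exact: ltW.
  have : 0 <= a * z^-1 * (n%:R - 1) by apply: mulr_ge0; rewrite ?subr_ge0.
  lra.
rewrite -mulr_sumr; apply: le_trans (ler_wpM2l _ (sum_coefA_weighted n0)) _.
  by rewrite mulr_ge0.
rewrite -/(coefA_sum n) mulrA; apply: ler_wpM2r.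
  by apply: sumr_ge0 => j _; rewrite ltW ?coefA_gt0.
rewrite -mulrA; move: n1; move: (n%:R : K) => x x1.
have -> : 34 * (x * (5 / x ^+ 2)) = 170 / x by field; lra.
by apply: ler_wpM2r; [rewrite invr_ge0; lra|lra].
Qed.

Lemma beta_period_gt0 : 0 < beta_period.
Proof.
have := alt_inv2_tail norm_quarter (ltn0Sn 0); have := alt_inv2_tail norm_Nquarter (ltn0Sn 0).
rewrite /alt_inv2 /alt_sum !big_geq // !subr0 => h1 h2.
have q1 : (1%:R - 4^-1 : K) ^- 2 <= 2 by rewrite -[X in X <= _]mul1r ler_pdivrMr; nra.
have q2 : (1%:R + 4^-1 : K) ^- 2 <= 2 by rewrite -[X in X <= _]mul1r ler_pdivrMr; nra.
have := ler_norm (- limn (alt_sum (fun k => (k%:R + 4^-1) ^- 2 : K))).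
have := ler_norm (- limn (alt_sum (fun k => (k%:R - 4^-1) ^- 2 : K))).
by rewrite !normrN /beta_period /alt_inv2; lra.
Qed.

End LinearForms.

(** * The recursion for the sums *)

Section RationalLimit.
Context {K : realType}.

Lemma cvg_prod_one (m : nat) (f : nat -> nat -> K) :
  (forall i, f i @ \oo --> (1 : K)) ->
  (fun M => \prod_(i < m) f i M) @ \oo --> (1 : K).
Proof.
move=> cvf; have one : \prod_(i < m) (1 : K) = 1 by rewrite big1.
rewrite -[X in _ --> X]one; apply: cvg_big => [|i _]; [exact: mul_continuous|exact: cvf].
Qed.

Lemma is_cvg_rational (w : nat -> K) (d m1 m2 m3 : nat) (c a1 a2 a3 : nat -> K) (b : K) :
  w @ \oo --> (0 : K) ->
  cvgn (fun M => (\sum_(i < d) c i * w M ^+ i)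
    * (\prod_(i < m1) ((1 + a1 i * w M) ^+ 2 - (b * w M) ^+ 2))
    / ((\prod_(i < m2) (1 + a2 i * w M) ^+ 2) * \prod_(i < m3) (1 + a3 i * w M) ^+ 2)).
Proof.
move=> w0.
have lin (a : K) : (fun M => 1 + a * w M) @ \oo --> (1 : K).
  suff : (fun M => 1 + a * w M) @ \oo --> (1 + a * 0 : K) by rewrite mulr0 addr0.
  by apply: cvgD; [exact: cvg_cst|apply: cvgM => //; exact: cvg_cst].
have sq (f : nat -> K) (l : K) : f @ \oo --> l -> (fun M => f M ^+ 2) @ \oo --> (l ^+ 2 : K).
  by move=> cvf; rewrite expr2; under eq_cvg do rewrite expr2; exact: cvgM.
have lin2 (a : K) : (fun M => (1 + a * w M) ^+ 2) @ \oo --> (1 : K).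
  by have := sq _ _ (lin a); rewrite expr1n.
have num i : (fun M => (1 + a1 i * w M) ^+ 2 - (b * w M) ^+ 2) @ \oo --> (1 : K).
  suff : (fun M => (1 + a1 i * w M) ^+ 2 - (b * w M) ^+ 2) @ \oo --> (1 - (b * 0) ^+ 2 : K).
    by rewrite mulr0 expr0n subr0.
  by apply: cvgB; [exact: lin2|apply: sq; apply: cvgM => //; exact: cvg_cst].
have pow e : cvgn (fun M => w M ^+ e).
  elim: e => [|e IHe]; first exact: is_cvg_cst.
  under eq_fun do rewrite exprS.
  by apply: is_cvgM => //; exact: cvgP w0.
have poly : cvgn (fun M => \sum_(i < d) c i * w M ^+ i).
  elim: d => [|d IHd]; first by under eq_fun do rewrite big_ord0; exact: is_cvg_cst.
  under eq_fun do rewrite big_ord_recr.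
  by apply: is_cvgD => //; apply: is_cvgM => //; exact: is_cvg_cst.
apply: is_cvgM.
  by apply: is_cvgM => //; have cvN := cvg_prod_one m1 num; exact: cvgP cvN.
have cvD := cvgM (cvg_prod_one m2 (fun i => lin2 (a2 i))) (cvg_prod_one m3 (fun i => lin2 (a3 i))).
have one_neq0 : 1 * 1 != 0 :> K by rewrite mulr1 oner_eq0.
exact: cvgP (cvgV one_neq0 (cvD _)).
Qed.

Lemma cvg_linear_form (a b c l1 l2 l3 : K) (u1 u2 u3 : nat -> K) :
  u1 @ \oo --> l1 -> u2 @ \oo --> l2 -> u3 @ \oo --> l3 ->
  (fun M => a * u1 M - b * u2 M - c * u3 M) @ \oo --> a * l1 - b * l2 - c * l3.
Proof.
by move=> cv1 cv2 cv3; apply: cvgB; [apply: cvgB|]; apply: cvgM => //; exact: cvg_cst.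
Qed.

Lemma cvg_alternating_increment (g : nat -> K) :
  cvgn g -> (fun M => (-1) ^+ M * (g M - g M.+1)) @ \oo --> (0 : K).
Proof.
move=> cvg_g; apply/norm_cvg0P.
have -> : (fun M => `|(-1) ^+ M * (g M - g M.+1)|) = (fun M => `|g M - g M.+1|).
  by apply/funext => M; rewrite normrM normrX normrN1 expr1n mul1r.
apply/norm_cvg0P; rewrite -(subrr (limn g)); apply: cvgB => //.
have : g @ \oo --> limn g by [].
by rewrite -(cvg_shiftn 1); under eq_fun do rewrite addn1.
Qed.

Lemma cvg_seq_unique (u : nat -> K) (a b : K) : u @ \oo --> a -> u @ \oo --> b -> a = b.
Proof. by move=> ua ub; rewrite -(cvg_lim _ ua) // (cvg_lim _ ub). Qed.

End RationalLimit.

(** Used to extract the power of [t] from products of factors quadratic in [t]. *)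
Lemma prod_homog (K : comRingType) (m : nat) (t : K) (f g : nat -> K) :
  (forall i, f i = t ^+ 2 * g i) -> \prod_(i < m) f i = t ^+ (2 * m) * \prod_(i < m) g i.
Proof.
move=> fg; elim: m => [|m IHm]; first by rewrite !big_ord0 mulr1.
by rewrite !big_ord_recr /= IHm fg mulnS addnC exprD; ring.
Qed.

(** The coefficients of [t -> cert_poly s (4 * t)] by decreasing degree. *)
Definition cert_rev_coefs (s : R) : seq R :=
  [:: cert_coef8 s * 4 ^+ 8 / IZR 16384; cert_coef7 s * 4 ^+ 7 / IZR 16384;
      cert_coef6 s * 4 ^+ 6 / IZR 16384; cert_coef5 s * 4 ^+ 5 / IZR 16384;
      cert_coef4 s * 4 ^+ 4 / IZR 16384; cert_coef3 s * 4 ^+ 3 / IZR 16384;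
      cert_coef2 s * 4 ^+ 2 / IZR 16384; cert_coef1 s * 4 / IZR 16384;
      cert_coef0 s / IZR 16384]%R.

Lemma cert_poly_homog (s t : R) : t != 0 ->
  cert_poly s (4 * t)%R = (t ^+ 8 * \sum_(i < 9) (cert_rev_coefs s)`_i * t^-1 ^+ i)%R.
Proof.
move=> t0; rewrite !big_ord_recl big_ord0 /=.
rewrite /cert_poly ?(RplusE, RminusE, RmultE, RdivE, RinvE, RpowE, RoppE).
have : IZR 16384 != 0 by apply/eqP; apply: not_0_IZR.
move: (IZR 16384) (cert_coef0 s) (cert_coef1 s) (cert_coef2 s) (cert_coef3 s) (cert_coef4 s)
  (cert_coef5 s) (cert_coef6 s) (cert_coef7 s) (cert_coef8 s) => d c0 c1 c2 c3 c4 c5 c6 c7 c8 d0.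
by field; rewrite d0 t0.
Qed.

(** In terms of [t^-1] the certificate is a rational function regular at [0]: the
    degrees of its numerator and its denominator in [t] are equal. *)
Lemma is_cvg_kernel_cert (k : nat) (y : R) : `|y| = 4^-1 ->
  cvgn (fun M => kernel_cert k (M%:R + y)%R).
Proof.
move=> hy; have w0 := inv_shift_cvg0 y.
have -> : (fun M => kernel_cert k (M%:R + y)%R) = (fun M => let w := (M%:R + y)^-1 in
    (\sum_(i < 9) kernel_const k.+1 * (cert_rev_coefs (8 * k.+1%:R)%R)`_i * w ^+ i)
    * (\prod_(i < 2 * k.+1) ((1 + (i%:R - 1) * w) ^+ 2 - (4^-1 * w) ^+ 2))
    / ((\prod_(j < k.+2) (1 + (- (2 * j.+1)%:R) * w) ^+ 2)
       * (\prod_(l < k.+4) (1 + (2 * k + 2 * l + 1)%:R * w) ^+ 2)))%R.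
  apply/funext => M; set t := (M%:R + y)%R.
  have t0 : t != 0 by have := shift_neq0 M 0 hy; rewrite subr0.
  rewrite /kernel_cert cert_poly_homog // /=.
  rewrite (@prod_homog _ _ t (fun i => (t + i%:R - 1) ^+ 2 - 4^-1 ^+ 2)%R
      (fun i => (1 + (i%:R - 1) * t^-1) ^+ 2 - (4^-1 * t^-1) ^+ 2)%R)
    => [|i]; last by field; rewrite t0.
  rewrite (@prod_homog _ _ t (fun j => (t - (2 * j.+1)%:R) ^+ 2)%R
      (fun j => (1 + (- (2 * j.+1)%:R) * t^-1) ^+ 2)%R)
    => [|j]; last by field; rewrite t0.
  rewrite (@prod_homog _ _ t (fun l => (t + (2 * k + 2 * l + 1)%:R) ^+ 2)%R
      (fun l => (1 + (2 * k + 2 * l + 1)%:R * t^-1) ^+ 2)%R)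
    => [|l]; last by field; rewrite t0.
  under [in RHS]eq_bigr do rewrite -mulrA; rewrite -mulr_sumr.
  set PN := \prod_(i < _) _; set PD := \prod_(j < _) _; set PE := \prod_(l < _) _.
  set h := \sum_(i < 9) _.
  have powE : t ^+ 8 * t ^+ (2 * (2 * k.+1)) = t ^+ (2 * k.+2) * t ^+ (2 * k.+4).
    by rewrite -!exprD; congr (_ ^+ _); lia.
  have td : t ^+ (2 * k.+2) * t ^+ (2 * k.+4) != 0 by rewrite mulf_neq0 ?expf_neq0.
  rewrite mulrACA [X in _ / X]mulrACA -powE.
  rewrite -powE in td; set T := t ^+ (2 * (2 * k.+1)) in td *.
  transitivity (kernel_const k.+1 * h * PN * ((t ^+ 8 * T) / (t ^+ 8 * T)) / (PD * PE))%R.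
    by rewrite [in LHS]invfM; ring.
  by rewrite divff // mulr1.
exact: (@is_cvg_rational _ _ _ _ _ _ (fun i => kernel_const k.+1
  * (cert_rev_coefs (8 * k.+1%:R)%R)`_i)%R (fun i => i%:R - 1)%R
  (fun j => - (2 * j.+1)%:R)%R (fun l => (2 * k + 2 * l + 1)%:R) 4^-1 w0).
Qed.

Lemma alternating_telescope (K : comRingType) (g : nat -> K) M :
  \sum_(0 <= m < M) (-1) ^+ m * (g m.+2 - g m)
  = (-1) ^+ M * (g M - g M.+1) - (g 0 - g 1%N).
Proof.
elim: M => [|M IHM]; first by rewrite big_nil mul1r subrr.
by rewrite big_nat_recr //= IHM exprS; ring.
Qed.

(** The zeros of the certificate make the boundary terms at [m = 0] and [m = 1] of the
    telescoping sum vanish. *)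
Lemma kernel_cert_eq0 k (y : R) : `|y| = 4^-1 ->
  kernel_cert k y = 0 /\ kernel_cert k (1 + y)%R = 0.
Proof.
move=> hy; have y2 : y ^+ 2 - 4^-1 ^+ 2 = 0.
  by rewrite -(real_normK (num_real y)) hy subrr.
have zero (i : nat) (t : R) : (i < 2 * k.+1)%N -> (t + i%:R - 1 = y)%R -> kernel_cert k t = 0.
  move=> lt_i ty; rewrite /kernel_cert (bigD1 (Ordinal lt_i)) //= ty y2.
  by rewrite mul0r mulr0 mul0r.
by split; [apply: (zero 1%N)|apply: (zero 0%N)]; rewrite ?mulnS //; ring.
Qed.

(** Summed with alternating signs, the increments of the certificate over [2] telescope
    to the difference of two consecutive values at infinity, where the certificate
    has a limit, since the values at the lower end vanish. *)
Lemma kernel_sum_recursion (y : R) : `|y| = 4^-1 ->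
  satisfies_recursion (fun n => kernel_sum n y).
Proof.
move=> hy [//|k] _ /=.
rewrite ?(R0E, RplusE, RminusE, RmultE).
pose g (m : nat) := kernel_cert k (m%:R + y)%R.
have cvL : (fun M => rec_coefA (INR k.+1) * kernel_partial_sum k.+2 y M
    - rec_coefB (INR k.+1) * kernel_partial_sum k.+1 y M
    - rec_coefC (INR k.+1) * kernel_partial_sum k y M)%R @ \oo -->
  (rec_coefA (INR k.+1) * kernel_sum k.+2 y - rec_coefB (INR k.+1) * kernel_sum k.+1 y
    - rec_coefC (INR k.+1) * kernel_sum k y)%R.
  by apply: cvg_linear_form; exact: kernel_partial_sum_cvg.
have eqL : (fun M => rec_coefA (INR k.+1) * kernel_partial_sum k.+2 y M
    - rec_coefB (INR k.+1) * kernel_partial_sum k.+1 y M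
    - rec_coefC (INR k.+1) * kernel_partial_sum k y M)%R
  = (fun M => (-1) ^+ M * (g M - g M.+1))%R.
  apply/funext => M; rewrite /kernel_partial_sum !mulr_sumr -!sumrB.
  have [g0 g1] := kernel_cert_eq0 k hy.
  transitivity (\sum_(0 <= m < M) (-1) ^+ m * (g m.+2 - g m)); last first.
    by rewrite alternating_telescope /g add0r g0 g1 subrr subr0.
  apply: eq_bigr => m _.
  have -> : g m.+2 = kernel_cert k ((m%:R + y) + 2)%R.
    by rewrite /g; congr (kernel_cert k _); rewrite -addn2 natrD; ring.
  rewrite -kernel_recursion; first by ring.
    move=> j; rewrite -subr_eq0.
    have -> : m%:R + y - j%:R = m%:R - j%:R + y by ring.
    exact: shift_neq0.
  move=> j; have -> : m%:R + y + j%:R = (m + j)%:R - 0%:R + y by rewrite natrD; ring.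
  exact: shift_neq0.
rewrite eqL in cvL; apply: (cvg_seq_unique cvL).
exact: cvg_alternating_increment (is_cvg_kernel_cert hy).
Qed.

(** * The limit of the quotients *)

Lemma recursion_unique (r s : nat -> R) :
  satisfies_recursion r -> satisfies_recursion s ->
  r 0%N = s 0%N -> r 1%N = s 1%N -> r =1 s.
Proof.
move=> hr hs e0 e1 n; suff [] : r n = s n /\ r n.+1 = s n.+1 by [].
elim: n => [//|n [IH0 IH1]]; split=> //.
have := hr n.+1 isT; have := hs n.+1 isT; rewrite /= IH0 IH1.
have : rec_coefA (INR n.+1) != 0.
  apply/eqP/Rgt_not_eq; apply: rec_coefA_gt0.
  by apply/RleP; rewrite INRE R1E ler1n.
rewrite ?(R0E, RplusE, RminusE, RmultE) => A0 h1 h2; apply: (mulfI A0).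
lra.
Qed.

Lemma recursion_linear (a b : R) (r s : nat -> R) :
  satisfies_recursion r -> satisfies_recursion s ->
  satisfies_recursion (fun n => a * r n + b * s n)%R.
Proof.
move=> hr hs n n1; have := hr n n1; have := hs n n1.
rewrite ?(R0E, RplusE, RminusE, RmultE).
set A := rec_coefA _; set B := rec_coefB _; set C := rec_coefC _ => h1 h2.
have -> : A * (a * r n.+1 + b * s n.+1) - B * (a * r n + b * s n)
    - C * (a * r n.-1 + b * s n.-1)
  = a * (A * r n.+1 - B * r n - C * r n.-1) + b * (A * s n.+1 - B * s n - C * s n.-1)
  by ring.
by rewrite h1 h2 !mulr0 addr0.
Qed.

Lemma coefA_sum0 (K : realType) : coefA_sum 0 = 1 :> K.
Proof.
rewrite /coefA_sum big_ord_recl big_ord0 coefA_closed /kernel_const big_ord0.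
by rewrite /num_value /odd_prod /pole_gap big_nil big_nat1 /= fact0; field.
Qed.

(** The coefficients for [n = 1], which determine the linear forms with index [1] and
    hence match the initial values. *)
Lemma coefA_1 (K : realType) (j : 'I_2) :
  coefA j = (if j == 0 :> nat then 147 / (32 * 10) else (24 * 100 + 31) / (32 * 10)) :> K.
Proof.
rewrite coefA_closed /kernel_const big_ord_recl big_ord0 /num_value /odd_prod /pole_gap.
by case: j => [[|[|//]] ?] /=;
  rewrite !(@big_ltn _ _ _ 0) // !(@big_ltn _ _ _ 1) // !big_geq //= !factS fact0; field.
Qed.

Lemma coefB_1 (K : realType) (j : 'I_2) :
  coefB j = (if j == 0 :> nat then 1 else -1) * ((82 * 100 + 67) / (48 * 100)) :> K.
Proof.
have B0 : coefB (ord0 : 'I_2) = (82 * 100 + 67) / (48 * 100) :> K.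
  have P1 : num_poly 1 = ('X + (27 / 16)%:P) * ('X + (35 / 16)%:P) :> {poly K}.
    have r0 : num_root 1 0 = 27 / 16 :> K.
      by rewrite /num_root (_ : (2 * 1 - 0)%N = 2) //; field.
    have r1 : num_root 1 1 = 35 / 16 :> K.
      by rewrite /num_root (_ : (2 * 1 - 1)%N = 1%N) //; field.
    by rewrite /num_poly 2!big_ord_recl big_ord0 mulr1 /bump /= r0 r1.
  have node0 : node 1 0 = 0 :> K by rewrite /node muln0 mul0n.
  have node1 : node 1 1 = 10 :> K by [].
  rewrite /coefB /simple_residue /kernel_const big_ord_recl big_ord0 P1.
  rewrite [\sum_(_ < _ | _) _]big_mkcond [\prod_(_ < _ | _) _]big_mkcond /=.
  rewrite !big_ord_recl !big_ord0 /= /bump /= node0 node1.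
  rewrite derivM !derivD !derivX !derivC hornerD !hornerM !hornerD !hornerX !hornerC.
  by field.
have := sum_coefB (K := K) 1; rewrite 2!big_ord_recl big_ord0 addr0 B0.
case: (unliftP ord0 j) => [i ->|->] /=; last by rewrite B0 mul1r.
by rewrite (ord1 i); lra.
Qed.

Lemma kernel_sum_sub0 (K : realType) :
  kernel_sum 0 4^-1 - kernel_sum 0 (- 4^-1) = 2 * chi_period :> K.
Proof.
rewrite kernel_sum_sub; have := coefA_sum0 K; have := sum_coefB (K := K) 0.
rewrite /coefA_sum !big_ord_recl !big_ord0 !addr0 => -> ->.
rewrite /alt_inv2 /alt_sum /= !big_geq //.
by ring.
Qed.

Lemma coefA_sum1 (K : realType) : coefA_sum 1 = (12 * 100 + 89) / (2 ^+ 5 * 5) :> K.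
Proof. by rewrite /coefA_sum 2!big_ord_recl big_ord0 !coefA_1 /=; field. Qed.

Lemma kernel_sum_sub1 (K : realType) :
  kernel_sum 1 4^-1 - kernel_sum 1 (- 4^-1)
  = 32 * ((1 + chi_period / 16) * ((12 * 100 + 89) / (2 ^+ 5 * 5))
          - ((((1 * 100 + 36) * 100 + 18) * 100 + 55) * 100 + 9)
            / (2 ^+ 5 * 3 ^+ 4 * 5 ^+ 3 * 7 ^+ 2)) :> K.
Proof.
rewrite kernel_sum_sub 2!big_ord_recl big_ord0 !coefA_1 !coefB_1 /= /bump /=.
rewrite /alt_inv2 /alt_sum /= !(@big_geq _ _ _ 1 1) //.
rewrite !(@big_nat_recr _ _ _ 4) // !(@big_nat_recr _ _ _ 3) // !(@big_nat_recr _ _ _ 2) //.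
rewrite !(@big_nat_recr _ _ _ 1) // !(@big_geq _ _ _ 1 1) //= /inv_gap.
by field.
Qed.

Lemma cvg_of_dist_harmonic (K : realType) (u : nat -> K) (l c : K) :
  (forall n, (0 < n)%N -> `|l - u n| <= c / n%:R) -> u @ \oo --> l.
Proof.
move=> le_u; apply/cvgrPdist_le => e e0; near=> n.
have n0 : (0 < n)%N by near: n; exact: nbhs_infty_gt.
apply: le_trans (le_u n n0) _; rewrite ler_pdivrMr ?ltr0n // mulrC -ler_pdivrMr //.
by near: n; exact: nbhs_infty_ger.
Unshelve. all: by end_near. Qed.

(** Uniqueness of solutions gives [q = coefA_sum] and, with [l] for the limit,
    [32 * (l * q n - p n)] for the difference of the two alternating sums. The bound
    of [kernel_sum_sub_bound] then reads [`|l - p n / q n| <= 300 / (32 * n)]. *)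
Theorem approximants_cvg (p q : nat -> R) :
  satisfies_recursion p -> satisfies_recursion q -> q 0%N = 1 -> p 0%N = 1 ->
  q 1%N = (1289 / 160)%coqR -> p 1%N = (136185509 / 15876000)%coqR ->
  (fun n => p n / q n) @ \oo --> 1 + chi_period / 16.
Proof.
move=> hp hq q0 p0 q1 p1.
have {q1}q1 : (q 1%N = (12 * 100 + 89) / (2 ^+ 5 * 5))%R.
  rewrite q1 q1_digits ?(R0E, R1E, RplusE, RmultE, RdivE, RpowE, IZRposE, INRE) /=; by [].
have {p1}p1 : (p 1%N = ((((1 * 100 + 36) * 100 + 18) * 100 + 55) * 100 + 9)
            / (2 ^+ 5 * 3 ^+ 4 * 5 ^+ 3 * 7 ^+ 2))%R.
  rewrite p1 p1_digits ?(R0E, R1E, RplusE, RmultE, RdivE, RpowE, IZRposE, INRE) /=; by [].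
have quarter : `|4^-1 : R| = 4^-1 by rewrite ger0_norm // invr_ge0.
have Nquarter : `|- 4^-1 : R| = 4^-1 by rewrite normrN.
have hS := kernel_sum_recursion quarter; have hS' := kernel_sum_recursion Nquarter.
have beta0 : beta_period != 0 :> R by rewrite lt0r_neq0 // beta_period_gt0.
have qE : q =1 coefA_sum.
  move=> n; have := recursion_linear beta_period^-1 beta_period^-1 hS hS'.
  have -> : (fun n => beta_period^-1 * kernel_sum n 4^-1
      + beta_period^-1 * kernel_sum n (- 4^-1))%R = @coefA_sum R.
    by apply/funext => m; rewrite -mulrDr kernel_sum_add mulrC mulfK.
  move=> hA; apply: (recursion_unique hq hA); first by rewrite q0 coefA_sum0.
  by rewrite q1 coefA_sum1.
pose l : R := (1 + chi_period / 16)%R.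
have hD := recursion_linear 1 (-1) hS hS'.
have subE (n : nat) : 1 * kernel_sum n 4^-1 + -1 * kernel_sum n (- 4^-1)
    = kernel_sum n 4^-1 - kernel_sum n (- 4^-1) :> R by rewrite mul1r mulN1r.
have qp (n : nat) : 32 * l * q n + (- 32) * p n = kernel_sum n 4^-1 - kernel_sum n (- 4^-1).
  rewrite -subE; apply: (recursion_unique (recursion_linear _ _ hq hp) hD).
    by rewrite subE q0 p0 kernel_sum_sub0 /l; field.
  by rewrite subE q1 p1 kernel_sum_sub1 /l; ring.
apply: (@cvg_of_dist_harmonic _ _ _ 10) => n n0.
have A0 : 0 < coefA_sum n :> R.
  apply: (@lt_le_trans _ _ (coefA (ord0 : 'I_n.+1))); first exact: coefA_gt0.
  rewrite /coefA_sum big_ord_recl lerDl sumr_ge0 // => j _; exact/ltW/coefA_gt0.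
have := kernel_sum_sub_bound (K := R) n0.
have -> : kernel_sum n 4^-1 - kernel_sum n (- 4^-1) = 32 * (coefA_sum n * (l - p n / q n)).
  by rewrite -qp qE; field; rewrite lt0r_neq0.
rewrite !normrM (gtr0_norm A0) normr_nat -/l => le1.
rewrite -(ler_pM2l A0); move: le1; set d := `|_ - _| => le1.
have : 0 <= coefA_sum n / n%:R :> R by rewrite divr_ge0 // ltW.
lra.
Qed.

(** * The cosine series of a logarithm *)

Section LogSeries.
Context {R : realType}.
Implicit Types (r s phi : R).

Lemma mean_value_bound (f df g dg : R -> R) (a b : R) : a <= b ->
  (forall s, a <= s <= b -> is_derive s 1 f (df s)) ->
  (forall s, a <= s <= b -> is_derive s 1 g (dg s)) ->
  (forall s, a <= s <= b -> `|df s| <= dg s) ->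
  `|f b - f a| <= g b - g a.
Proof.
move=> ab df_f dg_g le_d.
have homo (h dh : R -> R) : (forall s, a <= s <= b -> is_derive s 1 h (dh s)) ->
    (forall s, a <= s <= b -> 0 <= dh s) -> h a <= h b.
  move=> dh_h dh0; have dh_in s : s \in `[a, b] -> derivable h s 1.
    by rewrite in_itv /= => /dh_h hs; apply: ex_derive.
  apply: (@ger0_derive1_le_cc _ h a b); rewrite ?in_itv /= ?lexx ?ab //.
  - by move=> s; rewrite in_itv /= => /andP[/ltW h1 /ltW h2]; apply: dh_in; rewrite in_itv /= h1.
  - move=> s; rewrite in_itv /= => /andP[/ltW h1 /ltW h2].
    have sab : a <= s <= b by rewrite h1.
    by have ds := dh_h s sab; rewrite derive1E derive_val dh0.
  - by apply: derivable_within_continuous => s; exact: dh_in.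
have le1 := homo (g - f) (fun s => dg s - df s).
have le2 := homo (g + f) (fun s => dg s + df s).
rewrite ler_norml; apply/andP; split.
  suff : g a + f a <= g b + f b by lra.
  apply: le2 => s sab; first by apply: is_deriveD; [exact: dg_g|exact: df_f].
  by have := le_d s sab; rewrite ler_norml => /andP[]; lra.
suff : g a - f a <= g b - f b by lra.
apply: le1 => s sab; first by apply: is_deriveB; [exact: dg_g|exact: df_f].
by have := le_d s sab; rewrite ler_norml => /andP[]; lra.
Qed.

(** The square of the modulus of [1 - s * r * e ^ (i * phi)]. *)
Definition poisson_denom r phi s : R := 1 - 2 * (s * r) * cos phi + (s * r) ^+ 2.

(** The partial sums of the expansion of [- ln `|1 - r * e ^ (i * phi)|]. *)
Definition cos_series r phi N : R := \sum_(k < N) r ^+ k.+1 * cos (k.+1%:R * phi) / k.+1%:R.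

Lemma cos_mulSS (N : nat) phi :
  cos (N.+2%:R * phi) = 2 * cos phi * cos (N.+1%:R * phi) - cos (N%:R * phi).
Proof.
have -> : N.+2%:R * phi = N.+1%:R * phi + phi by rewrite -[N.+2%:R]natr1; ring.
have -> : N%:R * phi = N.+1%:R * phi - phi by rewrite -[N.+1%:R]natr1; ring.
by rewrite cosB cosD; ring.
Qed.

(** The derivative in [s] of the logarithm is the sum of a geometric series in
    [s * r * e ^ (+- i * phi)]; that of the partial sum is a geometric sum. The
    difference is the remainder in closed form, and induction on [N] verifies it. *)
Lemma is_derive_log_remainder r phi N s : 0 < poisson_denom r phi s ->
  is_derive s 1 (fun t => ln (poisson_denom r phi t) + 2 * cos_series (t * r) phi N)
    (2 * r ^+ N.+1 * s ^+ N * (s * r * cos (N%:R * phi) - cos (N.+1%:R * phi))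
     / poisson_denom r phi s).
Proof.
move=> D0; elim: N => [|N IHN].
  have -> : (fun t => ln (poisson_denom r phi t) + 2 * cos_series (t * r) phi 0)
      = @ln R \o poisson_denom r phi.
    by apply/funext => t /=; rewrite /cos_series big_ord0 mulr0 addr0.
  have dD : is_derive s 1 (poisson_denom r phi) (2 * r * (s * r - cos phi)).
    by rewrite /poisson_denom; apply: is_derive_eq; rewrite /GRing.scale /=; ring.
  have dln : is_derive (poisson_denom r phi s) 1 (@ln R) (poisson_denom r phi s)^-1.
    exact: is_derive1_ln.
  apply: is_derive_eq; rewrite /GRing.scale /= expr1 expr0 mul0r cos0 mul1r.
  by field; rewrite lt0r_neq0.
have -> : (fun t => ln (poisson_denom r phi t) + 2 * cos_series (t * r) phi N.+1)
    = (fun t => ln (poisson_denom r phi t) + 2 * cos_series (t * r) phi N)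
      + (fun t => 2 * ((t * r) ^+ N.+1 * (cos (N.+1%:R * phi) / N.+1%:R))).
  by apply/funext => t /=; rewrite /cos_series big_ord_recr /= !fctE mulrDr !addrA !mulrA.
have dpow : is_derive s 1 (fun t => 2 * ((t * r) ^+ N.+1 * (cos (N.+1%:R * phi) / N.+1%:R)))
    (2 * r ^+ N.+1 * s ^+ N * cos (N.+1%:R * phi)).
  have -> : (fun t => 2 * ((t * r) ^+ N.+1 * (cos (N.+1%:R * phi) / N.+1%:R)))
      = (2 * r ^+ N.+1 * cos (N.+1%:R * phi) / N.+1%:R) \*: ((@id R) ^+ N.+1).
    by apply/funext => t /=; rewrite !fctE exprMn /GRing.scale /=; ring.
  apply: is_derive_eq; rewrite /GRing.scale /= ?fctE mulr1.
  by field; rewrite ?natr1 ?nat1r pnatr_eq0.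
apply: is_derive_eq; rewrite cos_mulSS.
have D0' : poisson_denom r phi s != 0 by rewrite lt0r_neq0.
apply: (mulIf D0'); rewrite mulrDl !divfK //.
rewrite /poisson_denom !exprS; ring.
Qed.

(** The remainder at [s = 1] is bounded by integrating its derivative over [0 <= s <= 1]:
    the numerator is at most [4 * s ^ N], which produces the factor [1 / N.+1]. The
    bound reaches [`|r| = 1] as long as [1 - s * r * e ^ (i * phi)] stays away from
    zero. *)
Lemma log_cos_series r phi N (delta : R) : `|r| <= 1 -> 0 < delta ->
  (forall s, 0 <= s <= 1 -> delta <= poisson_denom r phi s) ->
  `|ln (1 - 2 * r * cos phi + r ^+ 2) + 2 * cos_series r phi N| <= 4 / delta / N.+1%:R.
Proof.
move=> r1 d0 d_le.
have := @mean_value_bound _ _ (fun s => 4 / delta / N.+1%:R * s ^+ N.+1)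
  (fun s => 4 / delta * s ^+ N) 0 1 ler01
  (fun s s01 => is_derive_log_remainder N (lt_le_trans d0 (d_le s s01))).
have at1 : poisson_denom r phi 1 = 1 - 2 * r * cos phi + r ^+ 2.
  by rewrite /poisson_denom mul1r.
have at0 : poisson_denom r phi 0 = 1 by rewrite /poisson_denom mul0r expr0n /=; ring.
have ser0 : cos_series (0 * r) phi N = 0.
  by rewrite /cos_series big1 // => k _; rewrite mul0r expr0n !mul0r.
rewrite at1 at0 ser0 mul1r ln1 mulr0 addr0 subr0 expr1n expr0n mulr1 mulr0 subr0.
apply => s /andP[s0 s1].
  rewrite (_ : (fun t => 4 / delta / N.+1%:R * t ^+ N.+1)
      = (4 / delta / N.+1%:R) \*: ((@id R) ^+ N.+1)); last first.
    by apply/funext => t /=; rewrite !fctE.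
  apply: is_derive_eq; rewrite /GRing.scale /= ?fctE mulr1.
  by field; rewrite ?natr1 ?nat1r pnatr_eq0 lt0r_neq0.
have D_ge := d_le s _; rewrite s0 s1 in D_ge; have {}D_ge := D_ge isT.
have D0 := lt_le_trans d0 D_ge.
rewrite normrM normfV (gtr0_norm D0) ler_pdivrMr //.
have sN0 : 0 <= s ^+ N by rewrite exprn_ge0.
have num_le : `|2 * r ^+ N.+1 * s ^+ N * (s * r * cos (N%:R * phi) - cos (N.+1%:R * phi))|
    <= 4 * s ^+ N.
  rewrite !normrM normr_nat normrX (ger0_norm sN0).
  have rN : `|r| ^+ N.+1 <= 1 by rewrite exprn_ile1.
  have cos_le : `|s * r * cos (N%:R * phi) - cos (N.+1%:R * phi)| <= 2.
    apply: le_trans (ler_normB _ _) _; rewrite !normrM (ger0_norm s0).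
    have := cos_max (N.+1%:R * phi); have cN := cos_max (N%:R * phi).
    have : s * `|r| * `|cos (N%:R * phi)| <= 1 by rewrite !mulr_ile1 // mulr_ge0.
    by lra.
  have step : 2 * `|r| ^+ N.+1 * s ^+ N <= 2 * s ^+ N.
    by apply: ler_wpM2r => //; rewrite -[leRHS]mulr1; apply: ler_wpM2l.
  apply: le_trans (ler_pM _ _ step cos_le) _ => //; last by lra.
  by rewrite !mulr_ge0 // exprn_ge0.
apply: le_trans num_le _.
have -> : 4 * s ^+ N = 4 / delta * s ^+ N * delta by field; rewrite lt0r_neq0.
by apply: ler_wpM2l => //; rewrite mulr_ge0 // divr_ge0 // ltW.
Qed.

End LogSeries.

(** * Term by term integration *)

Section ApproxIntegral.
Context {R : realType}.
Implicit Types (a b r phi x : R) (f g G : R -> R).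
Notation mu := (@lebesgue_measure R).

Lemma Rintegral_FTC a b g G : a < b ->
  (forall x, derivable g x 1) -> (forall x, is_derive x 1 G (g x)) ->
  \int[mu]_(x in `[a, b]) g x = G b - G a.
Proof.
move=> ab dg dG; rewrite /Rintegral (@continuous_FTC2 _ g G) //.
- by apply: derivable_within_continuous => x _; exact: dg.
- have cG x : {for x, continuous G}.
    by apply: differentiable_continuous; apply/derivable1_diffP; apply: ex_derive.
  split; first by move=> x _; apply: ex_derive.
  + exact/cvg_at_right_filter/cG.
  + exact/cvg_at_left_filter/cG.
- by move=> x _; rewrite derive1E derive_val.
Qed.

Lemma integrable_itv a b f : {within `[a, b], continuous f} ->
  mu.-integrable `[a, b] (EFin \o f).
Proof. by move=> cf; apply: continuous_compact_integrable => //; exact: segment_compact. Qed.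

(** Term by term integration, in the form of a uniform approximation of [f] by
    functions [g N] with explicit antiderivatives [G N]. *)
Lemma Rintegral_by_approximation a b f (g G : nat -> R -> R) (eps : nat -> R) (l : R) :
  a < b -> {within `[a, b], continuous f} ->
  (forall N x, derivable (g N) x 1) -> (forall N x, is_derive x 1 (G N) (g N x)) ->
  (forall N x, a <= x <= b -> `|f x - g N x| <= eps N) ->
  eps @ \oo --> (0 : R) -> (fun N => G N b - G N a) @ \oo --> l ->
  \int[mu]_(x in `[a, b]) f x = l.
Proof.
move=> ab cf dg dG le_eps eps0 cvG.
have if_ := integrable_itv cf.
have ig N : mu.-integrable `[a, b] (EFin \o g N).
  by apply: integrable_itv; apply: derivable_within_continuous => x _; exact: dg.
apply: (@cvg_seq_unique _ (fun N => G N b - G N a)) => //.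
apply/cvgrPdist_le => e e0.
have eb0 : 0 < e / (b - a) by rewrite divr_gt0 // subr_gt0.
move/cvgrPdist_le : eps0 => /(_ _ eb0); apply: filterS => N.
rewrite sub0r normrN => epsN.
rewrite -(Rintegral_FTC ab (dg N) (dG N)) -RintegralB //.
have ifg : mu.-integrable `[a, b] (EFin \o (fun x => f x - g N x)).
  exact: (@integrableB _ _ _ mu _ _ (EFin \o f) (EFin \o g N)).
apply: le_trans (le_normr_Rintegral _ ifg) _ => //.
apply: (@le_trans _ _ (\int[mu]_(x in `[a, b]) (e / (b - a)))).
  apply: le_Rintegral => //.
  - exact: integrable_norm ifg.
  - by apply: integrable_itv => x; exact: cst_continuous.
  - move=> x /=; rewrite in_itv /= => xab.
    by apply: le_trans (le_eps N x xab) (le_trans (ler_norm _) epsN).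
rewrite Rintegral_cst //; have := lebesgue_measure_itv `[a, b]; rewrite /= lte_fin ab /= => ->.
by rewrite /= divfK // gt_eqF // subr_gt0.
Qed.

Definition cos_series_primitive r gamma N x : R :=
  \sum_(k < N) r ^+ k.+1 * sin (k.+1%:R * (x + gamma)) / k.+1%:R ^+ 2.

Lemma is_derive_cos_series_primitive r gamma N x :
  is_derive x 1 (cos_series_primitive r gamma N) (cos_series r (x + gamma) N).
Proof.
elim: N => [|N IHN].
  rewrite /cos_series_primitive /cos_series; under eq_fun do rewrite big_ord0.
  by rewrite big_ord0; exact: is_derive_cst.
have -> : cos_series_primitive r gamma N.+1 = cos_series_primitive r gamma N
    + (fun y => r ^+ N.+1 / N.+1%:R ^+ 2 * sin (N.+1%:R * (y + gamma))).
  apply/funext => y /=; rewrite /cos_series_primitive big_ord_recr /= fctE.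
  by congr (_ + _); rewrite mulrAC.
rewrite /cos_series big_ord_recr /=; apply: is_deriveD.
by apply: is_derive_eq; rewrite /GRing.scale /=; field; rewrite ?natr1 ?nat1r pnatr_eq0.
Qed.

Lemma derivable_cos_series r gamma N x : derivable (fun y => cos_series r (y + gamma) N) x 1.
Proof.
elim: N => [|N IHN].
  by rewrite /cos_series; under eq_fun do rewrite big_ord0; exact: derivable_cst.
rewrite (_ : (fun y => _) = (fun y => cos_series r (y + gamma) N)
    + (fun y => r ^+ N.+1 / N.+1%:R * cos (N.+1%:R * (y + gamma)))); last first.
  apply/funext => y /=; rewrite /cos_series big_ord_recr /= fctE.
  by congr (_ + _); rewrite mulrAC.
apply: derivableD => //; exact: ex_derive.
Qed.

End ApproxIntegral.

(** * The inner integral *)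

Section InnerIntegral.
Context {R : realType}.
Implicit Types (a b r phi x gamma : R).
Notation mu := (@lebesgue_measure R).

(** Twice the logarithm of the modulus of [1 - r * e ^ (i * (x + gamma))]. *)
Definition log_poisson r gamma x : R := ln (1 - 2 * r * cos (x + gamma) + r ^+ 2).

Lemma continuous_log_poisson a b r gamma (delta : R) : 0 < delta ->
  (forall x, a <= x <= b -> delta <= 1 - 2 * r * cos (x + gamma) + r ^+ 2) ->
  {within `[a, b], continuous (log_poisson r gamma)}.
Proof.
move=> d0 d_le; apply: derivable_within_continuous => x; rewrite in_itv /= => xab.
have D0 := lt_le_trans d0 (d_le x xab).
have -> : log_poisson r gamma = @ln R \o (fun y => 1 - 2 * r * cos (y + gamma) + r ^+ 2) by [].
have dln : is_derive (1 - 2 * r * cos (x + gamma) + r ^+ 2) 1 (@ln R)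
    (1 - 2 * r * cos (x + gamma) + r ^+ 2)^-1 by exact: is_derive1_ln.
exact: ex_derive.
Qed.

Lemma sin_natM_pi (n : nat) : sin (n%:R * pi) = 0 :> R.
Proof.
elim: n => [|n IHn]; first by rewrite mul0r sin0.
by rewrite -natr1 mulrDl mul1r sinDpi IHn oppr0.
Qed.

Lemma poisson_ge r phi : (1 - `|r|) ^+ 2 <= 1 - 2 * r * cos phi + r ^+ 2.
Proof.
have : r * cos phi <= `|r|.
  by apply: le_trans (ler_norm _) _; rewrite normrM ler_piMr // cos_max.
have -> : r ^+ 2 = `|r| ^+ 2 by rewrite real_normK // num_real.
have -> : (1 - `|r|) ^+ 2 = 1 - 2 * `|r| + `|r| ^+ 2 by ring.
lra.
Qed.

Lemma poisson_gt0 r phi : `|r| < 1 -> 0 < 1 - 2 * r * cos phi + r ^+ 2.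
Proof. by move=> r1; apply: lt_le_trans (poisson_ge r phi); rewrite exprn_gt0 // subr_gt0. Qed.

(** Jensen's formula for [1 - r z], which has no zero in the closed unit disc: each
    term of the cosine series integrates to [0] over a full period. *)
Lemma Rintegral_log_poisson_circle r : `|r| < 1 ->
  \int[mu]_(x in `[0, 2 * pi]) log_poisson r 0 x = 0.
Proof.
move=> r1; pose delta := (1 - `|r|) ^+ 2.
have d0 : 0 < delta by rewrite exprn_gt0 // subr_gt0.
have d_le x s : 0 <= s <= 1 -> delta <= poisson_denom r x s.
  move=> /andP[s0 s1].
  have sr : `|s * r| <= `|r| by rewrite normrM (ger0_norm s0) ler_piMl.
  apply: le_trans (poisson_ge (s * r) x); rewrite /delta ler_sqr ?nnegrE; lra.
have pi0 : 0 < 2 * pi :> R by rewrite mulr_gt0 // pi_gt0.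
apply: (@Rintegral_by_approximation _ 0 (2 * pi) _ (fun N x => - 2 * cos_series r (x + 0) N)
  (fun N x => - 2 * cos_series_primitive r 0 N x) (fun N => 4 / delta / N.+1%:R)) => //.
- apply: (continuous_log_poisson d0) => x _.
  by have := d_le (x + 0) 1; rewrite ler01 lexx => /(_ isT); rewrite /poisson_denom !mul1r.
- by move=> N x; apply: derivableZ; exact: derivable_cos_series.
- by move=> N x; apply: is_deriveZ; exact: is_derive_cos_series_primitive.
- move=> N x _; rewrite /log_poisson mulNr opprK.
  by apply: log_cos_series => //; [exact: ltW|move=> s; exact: d_le].
- rewrite -(mulr0 (4 / delta)); apply: cvgM; first exact: cvg_cst.
  exact: cvg_harmonic.
- rewrite (_ : (fun N => _) = fun=> 0); first exact: cvg_cst.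
  apply/funext => N; rewrite -mulrBr /cos_series_primitive -sumrB big1 ?mulr0 // => k _.
  rewrite !addr0 mulr0 sin0 (mulrC 2) mulrA [_ * pi * 2]mulrC mulrA -natrM sin_natM_pi.
  by rewrite !mulr0 mul0r subrr.
Qed.

(** The absolute value of [torus_poly] on the torus: see [torus_poly_norm]. *)
Definition torus_modulus (theta phi : R) : R := 4 * (2 - cos (2 * theta) * (1 - cos phi)).

(** The mean value over [phi] of the logarithm of [torus_modulus theta phi]. *)
Definition inner_value (theta : R) : R := ln 2 + 2 * ln (1 + Num.sqrt 2 * `|sin theta|).

(** As a function of [phi], the modulus is a multiple of [`|1 - r * e ^ (i * phi)| ^ 2],
    where [r = (w - 1) / (1 + w)] is the Cayley transform of [w]. *)
Lemma torus_modulus_factor theta phi (w := Num.sqrt 2 * `|sin theta|) :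
  torus_modulus theta phi =
  2 * (1 + w) ^+ 2 * (1 - 2 * ((w - 1) / (1 + w)) * cos phi + ((w - 1) / (1 + w)) ^+ 2).
Proof.
have w2 : w ^+ 2 = 2 * sin theta ^+ 2.
  by rewrite exprMn sqr_sqrtr // real_normK // num_real.
have w0 : 0 <= w by rewrite mulr_ge0 // sqrtr_ge0.
rewrite /torus_modulus (_ : 2 * theta = theta *+ 2); last by rewrite mulr_natl.
have -> : cos (theta *+ 2) = 1 - w ^+ 2 by rewrite cos_mulr2n cos2sin2 w2 -mulr_natl; ring.
move: w w0 w2 => w w0 _; field; lra.
Qed.

Lemma norm_cayley (w : R) : 0 < w -> `|(w - 1) / (1 + w)| < 1.
Proof.
move=> w0; rewrite normrM normfV [`|1 + w|]gtr0_norm ?ltr_pdivrMr; try lra.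
by rewrite mul1r ltr_norml; lra.
Qed.

Lemma log_torus_modulus theta phi (w := Num.sqrt 2 * `|sin theta|) : sin theta != 0 ->
  ln (torus_modulus theta phi) = inner_value theta + log_poisson ((w - 1) / (1 + w)) 0 phi.
Proof.
move=> s0; have w0 : 0 < w by rewrite mulr_gt0 ?sqrtr_gt0 ?normr_gt0.
have w1 : 0 < 1 + w by rewrite addr_gt0.
rewrite torus_modulus_factor -/w /log_poisson addr0 /inner_value -/w.
have D0 := poisson_gt0 phi (norm_cayley w0).
rewrite lnM ?posrE ?mulr_gt0 ?exprn_gt0 // lnM ?posrE ?exprn_gt0 // lnXn //.
by rewrite [in RHS]mulr_natl.
Qed.

Lemma Rintegral_log_torus_modulus theta : sin theta != 0 ->
  \int[mu]_(phi in `[0, 2 * pi]) ln (torus_modulus theta phi) = 2 * pi * inner_value theta.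
Proof.
move=> s0; pose w := Num.sqrt 2 * `|sin theta|.
have w0 : 0 < w by rewrite mulr_gt0 ?sqrtr_gt0 ?normr_gt0.
have r1 := norm_cayley w0.
have pi0 : 0 < 2 * pi :> R by rewrite mulr_gt0 // pi_gt0.
under eq_Rintegral => phi _ do rewrite log_torus_modulus //.
rewrite RintegralD //.
- rewrite Rintegral_log_poisson_circle // addr0 Rintegral_cst //.
  have := lebesgue_measure_itv `[0, 2 * pi :> R]; rewrite /= lte_fin pi0 /= => ->.
  by rewrite /= subr0 mulrC.
- by apply: integrable_itv => x; exact: cst_continuous.
- apply: integrable_itv; apply: (@continuous_log_poisson _ _ _ _ ((1 - `|(w - 1) / (1 + w)|) ^+ 2)).
    by rewrite exprn_gt0 // subr_gt0.
  by move=> x _; exact: poisson_ge.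
Qed.

End InnerIntegral.

(** * The outer integral *)

Section OuterIntegral.
Context {R : realType}.
Implicit Types (a b r phi x y gamma : R).
Notation mu := (@lebesgue_measure R).

Lemma pi_quarter : [/\ 0 < cos (pi / 4) :> R, sin (pi / 4) = cos (pi / 4) :> R
  & cos (pi / 4) ^+ 2 = 1 / 2 :> R].
Proof.
have pi0 := pi_gt0 R.
have cs : sin (pi / 4) = cos (pi / 4) :> R.
  rewrite -cosBpihalf -cosN; congr cos; by field.
split=> //; first by apply: cos_gt0_pihalf; lra.
by have := cos2Dsin2 (pi / 4 : R); rewrite cs; lra.
Qed.

Lemma sqrt2_pi_quarter : Num.sqrt 2 = 2 * cos (pi / 4) :> R.
Proof.
have [c0 _ c2] := pi_quarter.
have -> : (2 : R) = (2 * cos (pi / 4)) ^+ 2 by rewrite exprMn c2; field.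
by rewrite sqrtr_sqr ger0_norm // ?mulr_ge0 ?ltW //; rewrite exprMn c2; field.
Qed.

Lemma sin_add_natM_pi (n : nat) x : sin (x + n%:R * pi) = (-1) ^+ n * sin x.
Proof.
elim: n => [|n IHn]; first by rewrite mul0r addr0 mul1r.
by rewrite -[n.+1%:R]natr1 mulrDl mul1r addrA sinDpi IHn exprS mulN1r mulNr.
Qed.

Lemma cos_quarter_shift y :
  cos (y + pi / 4) = cos (pi / 4) * (cos y - sin y) /\
  cos (y + 3 * pi / 4) = - cos (pi / 4) * (cos y + sin y).
Proof.
have [_ cs _] := pi_quarter; split; first by rewrite cosD cs; ring.
have -> : y + 3 * pi / 4 = y + pi / 4 + pi / 2 by field.
by rewrite cosDpihalf sinD cs; ring.
Qed.

(** For the angles [pi/4] and [3pi/4], and only over the half period between two zeros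
    of [sin], the arguments keep a distance of at least [pi/4] from the zeros of
    [1 - cos], which is where the logarithm is singular. *)
Lemma cos_quarter_shift_le (n : nat) x (a := n%:R * pi) : a <= x <= a + pi ->
  cos (x + (pi / 4 - a)) <= cos (pi / 4) /\ cos (x + (3 * pi / 4 - a)) <= cos (pi / 4).
Proof.
move=> /andP[ax xa]; have [c0 _ _] := pi_quarter.
have s0 : 0 <= sin (x - a) by apply: sin_ge0_pi; lra.
have [e1 e2] := cos_quarter_shift (x - a).
have -> : x + (pi / 4 - a) = x - a + pi / 4 by ring.
have -> : x + (3 * pi / 4 - a) = x - a + 3 * pi / 4 by ring.
rewrite e1 e2; have := cos_le1 (x - a); have := cos_geN1 (x - a).
move: (cos (x - a)) (sin (x - a)) s0 => u v v0 u1 u2.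
by split; nra.
Qed.

(** With [y = x - a], the number [1 + sqrt 2 * `|sin x|] is a multiple of
    [sin (pi / 4) + sin y], hence of a product of two sines of half angles; their
    squares are [(1 - cos (y + pi / 4)) / 2] and [(1 - cos (y + 3 * pi / 4)) / 2]. *)
Lemma inner_valueE (n : nat) x (a := n%:R * pi) : a <= x <= a + pi ->
  inner_value x = log_poisson 1 (pi / 4 - a) x + log_poisson 1 (3 * pi / 4 - a) x.
Proof.
move=> xa; have [c0 _ c2] := pi_quarter; have [le1 le2] := cos_quarter_shift_le xa.
have c1 : cos (pi / 4) < 1 :> R by move: c0 c2; move: (cos _) => c; nra.
have s0 : 0 <= sin (x - a) by apply: sin_ge0_pi; move/andP: xa => [? ?]; lra.
have sx : `|sin x| = sin (x - a).
  have -> : x = (x - a) + n%:R * pi by rewrite /a; ring.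
  rewrite sin_add_natM_pi normrM normrX normrN1 expr1n mul1r /a addrK.
  by rewrite ger0_norm.
rewrite /inner_value sx sqrt2_pi_quarter /log_poisson.
rewrite !mulr1 !expr1n -lnM ?posrE; try lra.
have w0 : 0 < 1 + 2 * cos (pi / 4) * sin (x - a).
  by rewrite ltr_pwDl // !mulr_ge0 // ltW.
rewrite [X in ln 2 + X]mulr_natl -lnXn // -lnM ?posrE ?exprn_gt0 //; congr ln.
have [e1 e2] := cos_quarter_shift (x - a).
have -> : x + (pi / 4 - a) = x - a + pi / 4 by ring.
have -> : x + (3 * pi / 4 - a) = x - a + 3 * pi / 4 by ring.
rewrite e1 e2; have := cos2Dsin2 (x - a); move: c2.
move: (cos (pi / 4)) (cos (x - a)) (sin (x - a)) => c u v c2 uv.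
have -> : (2 : R) * (1 + 2 * c * v) ^+ 2 = 2 + 8 * c * v + 8 * c ^+ 2 * v ^+ 2 by ring.
have -> : (1 - 2 * (c * (u - v)) + 1) * (1 - 2 * (- c * (u + v)) + 1)
  = 4 + 8 * c * v + 4 * c ^+ 2 * (v ^+ 2 - u ^+ 2) by ring.
have -> : u ^+ 2 = 1 - v ^+ 2 by lra.
by rewrite c2; field.
Qed.

Definition chi_partial (M : nat) : R :=
  \sum_(0 <= j < M) (-1) ^+ j * ((4 * j%:R + 1) ^- 2 + (4 * j%:R + 3) ^- 2).

Lemma chi_partial_cvg : chi_partial @ \oo --> (1 + chi_period / 16 : R).
Proof.
have quarter : `|4^-1 : R| = 4^-1 by rewrite ger0_norm // invr_ge0.
have Nquarter : `|- 4^-1 : R| = 4^-1 by rewrite normrN.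
rewrite -(cvg_shiftn 1).
have -> : [sequence chi_partial (M + 1)]_M = (fun M => 1 +
    (alt_inv2 4^-1 (M + 1)%N - alt_inv2 (- 4^-1) (M + 2)%N) / 16).
  apply/funext => M /=; rewrite /chi_partial /alt_inv2 /alt_sum addn1 addn2.
  elim: M => [|M IHM].
    rewrite !big_nat1 !(@big_geq _ _ _ 1 1) // /=.
    by field.
  rewrite big_nat_recr //= IHM [in RHS]big_nat_recr //=.
  rewrite [X in _ = _ + (_ - X) / _]big_nat_recr //=.
  rewrite !exprS -[M.+2%:R]natr1 -[M.+1%:R]natr1; set A := \sum_(_ <= _ < M.+1) _.
  set B := \sum_(_ <= _ < M.+2) _.
  have : 0 <= M%:R :> R by [].
  move: (M%:R : R) => x x0.
  by field; do ![apply/andP; split]; lra.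
apply: cvgD; first exact: cvg_cst.
apply: cvgM; last exact: cvg_cst.
apply: cvgB.
  rewrite (cvg_shiftn 1 (alt_inv2 4^-1)); exact: is_cvg_alt_inv2.
rewrite (cvg_shiftn 2 (alt_inv2 (- 4^-1))); exact: is_cvg_alt_inv2.
Qed.

(** Even indices have coefficient [0]. At an odd index [k] the sum of the two sines is
    [2 * cos (pi / 4)] times a sign, which depends on [k] modulo [8] and is that of
    [chi_period]. *)
Lemma sum_odd_quarter_sines M :
  \sum_(k < 4 * M) ((-1) ^+ k.+1 - 1) / k.+1%:R ^+ 2
    * (sin (k.+1%:R * (pi / 4)) + sin (k.+1%:R * (3 * pi / 4)))
  = - 4 * cos (pi / 4) * chi_partial M.
Proof.
elim: M => [|M IHM]; first by rewrite big_ord0 /chi_partial big_geq // mulr0.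
have -> : (4 * M.+1 = (4 * M).+4)%N by lia.
rewrite 4!big_ord_recr /= IHM /chi_partial big_nat_recr //=.
have [_ cs _] := pi_quarter.
have sgn4 : (-1) ^+ (4 * M) = 1 :> R by rewrite -signr_odd oddM.
have sgn3 : (-1) ^+ (3 * M) = (-1) ^+ M :> R by rewrite -signr_odd oddM signr_odd.
have sin3 : sin (3 * pi / 4) = cos (pi / 4) :> R.
  have -> : 3 * pi / 4 = pi / 4 + pi / 2 :> R by field.
  by rewrite sinDpihalf.
have sin9 : sin (9 * pi / 4) = cos (pi / 4) :> R.
  have -> : 9 * pi / 4 = pi / 4 + pi + pi :> R by field.
  by rewrite !sinDpi opprK cs.
have e1 : sin ((4 * M).+1%:R * (pi / 4)) = (-1) ^+ M * cos (pi / 4) :> R.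
  by rewrite -cs -sin_add_natM_pi; congr sin; rewrite -natr1 natrM; field.
have e1' : sin ((4 * M).+1%:R * (3 * pi / 4)) = (-1) ^+ M * cos (pi / 4) :> R.
  by rewrite -sin3 -sgn3 -sin_add_natM_pi; congr sin; rewrite -natr1 !natrM; field.
have e3 : sin ((4 * M).+3%:R * (pi / 4)) = (-1) ^+ M * cos (pi / 4) :> R.
  by rewrite -sin3 -sin_add_natM_pi; congr sin; rewrite -addn3 natrD natrM; field.
have e3' : sin ((4 * M).+3%:R * (3 * pi / 4)) = (-1) ^+ M * cos (pi / 4) :> R.
  by rewrite -sin9 -sgn3 -sin_add_natM_pi; congr sin; rewrite -addn3 natrD !natrM; field.
have z1 : (-1) ^+ (4 * M).+1 - 1 = - 2 :> R by rewrite exprS sgn4; ring.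
have z2 : (-1) ^+ (4 * M).+2 - 1 = 0 :> R by rewrite !exprS sgn4; ring.
have z3 : (-1) ^+ (4 * M).+3 - 1 = - 2 :> R by rewrite !exprS sgn4; ring.
have z4 : (-1) ^+ (4 * M).+4 - 1 = 0 :> R by rewrite !exprS sgn4; ring.
rewrite z1 z2 z3 z4 e1 e1' e3 e3' !mul0r !addr0.
have -> : (4 * M).+1%:R = 4 * M%:R + 1 :> R by ring.
have -> : (4 * M).+3%:R = 4 * M%:R + 3 :> R by ring.
have : 0 <= M%:R :> R by [].
set A := \sum_(_ <= _ < _) _; move: (M%:R : R) => x x0.
by field; do ![apply/andP; split]; lra.
Qed.

(** Over an interval of length [pi], the [k]-th terms of the two cosine series integrate
    to multiples of [((-1) ^ k - 1) / k ^ 2] times the sines of [sum_odd_quarter_sines].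
    Partial sums of length [4 * M] contain whole blocks of these only. *)
Lemma Rintegral_inner_value (n : nat) (a := n%:R * pi : R) :
  \int[mu]_(x in `[a, a + pi]) inner_value x = 4 * Num.sqrt 2 * (1 + chi_period / 16).
Proof.
have [c0 cs c2] := pi_quarter; have pi0 := pi_gt0 R.
have c1 : cos (pi / 4) < 1 :> R by move: c0 c2; move: (cos _) => c; nra.
pose g1 : R := pi / 4 - a; pose g2 : R := 3 * pi / 4 - a.
have -> : \int[mu]_(x in `[a, a + pi]) inner_value x
    = \int[mu]_(x in `[a, a + pi]) (log_poisson 1 g1 x + log_poisson 1 g2 x).
  by apply: eq_Rintegral => x; rewrite inE /= in_itv /=; exact: inner_valueE.
have denom_ge phi s : 0 <= s <= 1 -> cos phi <= cos (pi / 4) -> 2^-1 <= poisson_denom 1 phi s.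
  move=> /andP[s0 s1] le_c; rewrite /poisson_denom mulr1; move: c2 le_c c0.
  move: (cos (pi / 4)) (cos phi) => c d c2 dc c0.
  have : s * d <= s * c by apply: ler_wpM2l.
  by have := sqr_ge0 (s - c); rewrite expr2; nra.
have d0 : 0 < 2^-1 :> R by rewrite invr_gt0.
have cont g : (forall x, a <= x <= a + pi -> cos (x + g) <= cos (pi / 4)) ->
    {within `[a, a + pi], continuous (log_poisson 1 g)}.
  move=> le_g; apply: (continuous_log_poisson d0) => x xa.
  by have := denom_ge _ 1 _ (le_g x xa); rewrite /poisson_denom !mul1r ler01 lexx => ->.
apply: (@Rintegral_by_approximation _ a (a + pi) _
  (fun M x => - 2 * cos_series 1 (x + g1) (4 * M) + - 2 * cos_series 1 (x + g2) (4 * M))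
  (fun M x => - 2 * cos_series_primitive 1 g1 (4 * M) x
              + - 2 * cos_series_primitive 1 g2 (4 * M) x)
  (fun M => 16 / M.+1%:R)).
- by rewrite ltrDl.
- by move=> x; apply: cvgD; apply: cont => y /cos_quarter_shift_le[].
- by move=> M x; apply: derivableD; apply: derivableZ; exact: derivable_cos_series.
- by move=> M x; apply: is_deriveD; apply: is_deriveZ; exact: is_derive_cos_series_primitive.
- move=> M x /cos_quarter_shift_le[le1 le2].
  have one1 : `|1 : R| <= 1 by rewrite normr1.
  have b1 : `|log_poisson 1 g1 x + 2 * cos_series 1 (x + g1) (4 * M)|
      <= 4 / 2^-1 / (4 * M).+1%:R.
    exact: (log_cos_series _ one1 d0 (fun s s01 => denom_ge _ _ s01 le1)).
  have b2 : `|log_poisson 1 g2 x + 2 * cos_series 1 (x + g2) (4 * M)|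
      <= 4 / 2^-1 / (4 * M).+1%:R.
    exact: (log_cos_series _ one1 d0 (fun s s01 => denom_ge _ _ s01 le2)).
  have le8 : 4 / 2^-1 / (4 * M).+1%:R <= 8 / M.+1%:R :> R.
    rewrite invrK; have -> : 4 * 2 = 8 :> R by ring.
    by rewrite ler_wpM2l // lef_pV2 ?posrE ?ltr0n // ler_nat; lia.
  have -> : log_poisson 1 g1 x + log_poisson 1 g2 x
    - (- 2 * cos_series 1 (x + g1) (4 * M) + - 2 * cos_series 1 (x + g2) (4 * M))
    = log_poisson 1 g1 x + 2 * cos_series 1 (x + g1) (4 * M)
      + (log_poisson 1 g2 x + 2 * cos_series 1 (x + g2) (4 * M)) by ring.
  apply: le_trans (ler_normD _ _) _.
  have -> : 16 / M.+1%:R = 8 / M.+1%:R + 8 / M.+1%:R :> R by rewrite -mulrDl -natrD.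
  by apply: lerD; [exact: le_trans b1 le8|exact: le_trans b2 le8].
- rewrite -(mulr0 16); apply: cvgM; first exact: cvg_cst.
  exact: cvg_harmonic.
- rewrite (_ : (fun M => _) = (fun M => 4 * Num.sqrt 2 * chi_partial M)).
    by apply: cvgM; [exact: cvg_cst|exact: chi_partial_cvg].
  apply/funext => M; rewrite sqrt2_pi_quarter.
  have -> : 4 * (2 * cos (pi / 4)) * chi_partial M
    = - 2 * (- 4 * cos (pi / 4) * chi_partial M) by ring.
  rewrite -sum_odd_quarter_sines /cos_series_primitive.
  have regroup (A B C D : R) : - 2 * A + - 2 * B - (- 2 * C + - 2 * D) = - 2 * (A + B - (C + D)).
    by ring.
  rewrite regroup -!big_split /= -sumrB; congr (_ * _); apply: eq_bigr => k _.
  have shift (b : R) : sin (k.+1%:R * (a + pi + (b - a))) = (-1) ^+ k.+1 * sin (k.+1%:R * b).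
    by rewrite -sin_add_natM_pi; congr sin; ring.
  rewrite !expr1n !mul1r /g1 /g2 !shift.
  have unshift (b : R) : a + (b - a) = b by ring.
  rewrite !unshift.
  by field; rewrite ?natr1 ?nat1r pnatr_eq0.
Qed.

End OuterIntegral.

Local Open Scope complex_scope.

(** * The polynomial on the torus *)

Section TorusNorm.
Context {R : realType}.
Implicit Types (t theta phi : R).

Lemma expi_mul_conj t : expi t * (cos t -i* sin t) = 1.
Proof. by rewrite /expi; simpc; rewrite -!expr2 cos2Dsin2 mulrC addrC subrr. Qed.

Lemma expi_neq0 t : expi t != 0.
Proof.
apply/eqP => e0; have := expi_mul_conj t; rewrite e0 mul0r => /eqP.
by rewrite eq_sym oner_eq0.
Qed.

Lemma norm_expi t : `|expi t| = 1.
Proof. by rewrite normc_def /= cos2Dsin2 sqrtr1. Qed.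

Lemma expiV t : (expi t)^-1 = cos t -i* sin t.
Proof. by apply: (mulfI (expi_neq0 t)); rewrite divff ?expi_neq0 // expi_mul_conj. Qed.

Lemma cosC t : (cos t)%:C = (expi t + (expi t)^-1) / 2.
Proof.
apply: (mulIf (x := 2)); first by rewrite pnatr_eq0.
by rewrite divfK ?pnatr_eq0 // expiV /expi; simpc; rewrite mulrDr mulr1.
Qed.

Lemma expi_mulr2n t : expi (2 * t) = expi t ^+ 2.
Proof.
rewrite (_ : 2 * t = t *+ 2); last by rewrite mulr_natl.
rewrite /expi cos_mulr2n sin_mulr2n [RHS]expr2; simpc; congr (_ +i* _); last by ring.
by have := cos2Dsin2 t; rewrite -!expr2 => <-; ring.
Qed.

Lemma torus_poly_factor theta phi :
  torus_poly (expi theta) (expi phi) =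
  expi theta ^+ 2 * expi phi * (torus_modulus theta phi)%:C.
Proof.
have x0 := expi_neq0 theta; have y0 := expi_neq0 phi.
rewrite /torus_modulus /torus_poly rmorphM rmorphB rmorphM rmorphB /= !cosC.
rewrite expi_mulr2n !rmorph_nat rmorph1.
by move: (expi theta) (expi phi) x0 y0 => x y x0 y0; field; rewrite x0 y0.
Qed.

Lemma torus_modulus_ge0 theta phi : 0 <= torus_modulus theta phi.
Proof.
rewrite /torus_modulus; have := cos_le1 (2 * theta); have := cos_geN1 (2 * theta).
have := cos_le1 phi; have := cos_geN1 phi.
by move: (cos _) (cos _) => u v; nra.
Qed.

Lemma torus_modulus_le theta phi : torus_modulus theta phi <= 16.
Proof.
rewrite /torus_modulus; have := cos_le1 (2 * theta); have := cos_geN1 (2 * theta).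
have := cos_le1 phi; have := cos_geN1 phi.
by move: (cos _) (cos _) => u v; nra.
Qed.

Lemma torus_poly_norm theta phi :
  complex.Re `|torus_poly (expi theta) (expi phi)| = torus_modulus theta phi.
Proof.
rewrite torus_poly_factor !normrM !norm_expi !mul1r.
by rewrite normc_def /= expr0n addr0 sqrtr_sqr ger0_norm // torus_modulus_ge0.
Qed.

(** The factors [1 / x] and [1 / y] of the integrand cancel the [x] and [y] of the
    differentials, whose factors [i] multiply to [-1]. *)
Lemma torus_pullback_log (z : R * R) :
  torus_pullback log_integrand z = (- ln (torus_modulus z.1 z.2))%:C.
Proof.
rewrite /torus_pullback /log_integrand torus_poly_norm rmorphN /=.
have := sqr_i R; have x0 := expi_neq0 z.1; have y0 := expi_neq0 z.2.
move: (expi z.1) (expi z.2) x0 y0 (_%:C) => x y x0 y0 L i2.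
transitivity (L * 'i%C ^+ 2); first by field; rewrite x0 y0.
by rewrite i2 mulrN1.
Qed.

End TorusNorm.

(** * Tonelli on a square *)

Section Tonelli.
Context {R : realType}.
Implicit Types (theta phi : R).
Notation mu := (@lebesgue_measure R).
Notation mu2 := (@lebesgue_measure R \x @lebesgue_measure R)%E.

Lemma tonelli_rectangle (a b : R) (f : R * R -> R)
    (F : R -> \bar R := fun x => (\int[mu]_(y in `[a, b]) (f (x, y))%:E)%E) :
  measurable_fun setT f -> (forall z, 0 <= f z) ->
  [/\ measurable_fun `[a, b] F &
    (\int[mu2]_(z in `[a, b] `*` `[a, b]) (f z)%:E =
     \int[mu]_(x in `[a, b]) F x)%E].
Proof.
move=> mf f0; set D := `[a, b]%classic.
have mD : measurable D by exact: measurable_itv.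
have mDD : measurable (D `*` D) by exact: measurableX.
set g := (EFin \o f) \_ (D `*` D).
have mg : measurable_fun setT g.
  apply/(measurable_restrictT _ _).1 => //.
  by apply: measurable_funTS; exact/measurable_EFinP.
have g0 z : (0 <= g z)%E by rewrite /g patchE; case: ifP => // _; rewrite lee_fin.
have gE : fubini_F mu g = F \_ D.
  apply/funext => x; rewrite /fubini_F [RHS]patchE; case: ifPn => [xD|xD].
    rewrite [RHS]integral_mkcond; apply: eq_integral => y _.
    by rewrite /g !patchE in_setX /= xD.
  rewrite integral0_eq // => y _; by rewrite /g patchE in_setX /= (negbTE xD).
split.
  apply/(measurable_restrictT _ mD); rewrite -gE.
  exact: measurable_fun_fubini_tonelli_F.
rewrite integral_mkcond fubini_tonelli1 // [in RHS]integral_mkcond.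
by rewrite -gE.
Qed.

Lemma measurable_torus_modulus : measurable_fun setT (fun z : R * R => torus_modulus z.1 z.2).
Proof.
have mcos : measurable_fun setT (@cos R).
  by apply: continuous_measurable_fun => x; exact: continuous_cos.
rewrite /torus_modulus; apply: measurable_funM => //; apply: measurable_funB => //.
apply: measurable_funM.
  apply: (measurableT_comp (f := cos)) => //; exact: measurable_funM.
apply: measurable_funB => //; exact: (measurableT_comp (f := cos)).
Qed.

Lemma measurable_log_torus_modulus :
  measurable_fun setT (fun z : R * R => ln (torus_modulus z.1 z.2)).
Proof. exact: (measurableT_comp (@measurable_ln R) measurable_torus_modulus). Qed.

Lemma continuous_inner_value : continuous (@inner_value R).
Proof.
move=> x.
have c1 : {for x, continuous (fun y : R => 1 + Num.sqrt 2 * `|sin y|)}.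
  apply: cvgD; first exact: cvg_cst.
  by apply: cvgM; [exact: cvg_cst|apply: cvg_norm; exact: continuous_sin].
have c2 : {for x, continuous (fun y : R => ln (1 + Num.sqrt 2 * `|sin y|))}.
  apply: (continuous_comp c1); apply: continuous_ln.
  by rewrite ltr_pwDl // mulr_ge0 // sqrtr_ge0.
by apply: cvgD; [exact: cvg_cst|apply: cvgM; [exact: cvg_cst|exact: c2]].
Qed.

Lemma integrable_inner_value (a b : R) : mu.-integrable `[a, b] (EFin \o inner_value).
Proof. by apply: integrable_itv; apply: continuous_subspaceT; exact: continuous_inner_value. Qed.

Lemma Rintegral_inner_value_period :
  \int[mu]_(x in `[0, 2 * pi]) inner_value x = 8 * Num.sqrt 2 * (1 + chi_period / 16) :> R.
Proof.
have pi0 := pi_gt0 R.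
have := @Rintegral_itvB _ inner_value (BLeft 0) (BRight (2 * pi)) pi (integrable_inner_value _ _).
rewrite !bnd_simp => /(_ (ltW pi0)) H.
have {}H := H ltac:(lra).
have := @Rintegral_inner_value R 0; have := @Rintegral_inner_value R 1.
cbv zeta; rewrite mulr0n mulr1n !mul0r !mul1r add0r (_ : pi + pi = 2 * pi); last by ring.
rewrite -Rintegral_itv_obnd_cbnd; last first.
  apply: (integrableS _ _ _ (integrable_inner_value pi (2 * pi))) => //.
  exact: subset_itv_oc_cc.
move=> E1 E0; rewrite E0 E1 in H; move/eqP: H; rewrite subr_eq => /eqP ->; ring.
Qed.

End Tonelli.

(** * The integral over the torus *)

Section LogGap.
Context {R : realType}.
Implicit Types (theta phi : R) (z : R * R).
Notation mu := (@lebesgue_measure R).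
Notation mu2 := (@lebesgue_measure R \x @lebesgue_measure R)%E.

(** The integrand, up to an additive constant that makes it nonnegative: Tonelli's
    theorem then gives its integrability and its integral at once. *)
Definition log_gap z : R := ln 16 - ln (torus_modulus z.1 z.2).

Lemma log_gap_ge0 z : 0 <= log_gap z.
Proof.
rewrite /log_gap subr_ge0; have [T0|T0] := ltP 0 (torus_modulus z.1 z.2).
  by rewrite ler_ln ?posrE // torus_modulus_le.
by rewrite ln0 // ln_ge0 // ler1n.
Qed.

Lemma measurable_log_gap : measurable_fun setT log_gap.
Proof. by apply: measurable_funB => //; exact: measurable_log_torus_modulus. Qed.

Lemma integral_EFin_Rintegral (a b : R) (g : R -> R) : mu.-integrable `[a, b] (EFin \o g) ->
  (\int[mu]_(x in `[a, b]) (g x)%:E)%E = (\int[mu]_(x in `[a, b]) g x)%:E.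
Proof. by move=> ig; rewrite /Rintegral fineK // integrable_fin_num. Qed.

Lemma integral_log_gap theta : sin theta != 0 ->
  (\int[mu]_(phi in `[0%R, (2 * pi)%R]) (log_gap (theta, phi))%:E)%E =
  (2 * pi * (ln 16 - inner_value theta))%:E.
Proof.
move=> s0; have pi0 := pi_gt0 R; pose w := Num.sqrt 2 * `|sin theta|.
have w0 : 0 < w by rewrite mulr_gt0 ?sqrtr_gt0 ?normr_gt0.
pose r := (w - 1) / (1 + w); have r1 : `|r| < 1 by exact: norm_cayley.
have iT : mu.-integrable `[0, 2 * pi] (EFin \o (fun phi => ln (torus_modulus theta phi))).
  rewrite (_ : (fun _ => _) = (fun x => inner_value theta +
    log_poisson r 0 x)).
    apply: (@integrableD _ _ _ mu _ _ (EFin \o (fun=> inner_value theta))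
      (EFin \o log_poisson _ _)) => //.
      by apply: integrable_itv => x; exact: cst_continuous.
    apply: integrable_itv; apply: (@continuous_log_poisson _ _ _ _ _ ((1 - `|r|) ^+ 2)).
      by rewrite exprn_gt0 // subr_gt0.
    by move=> x _; exact: poisson_ge.
  by apply/funext => x; exact: log_torus_modulus.
have ic : mu.-integrable `[0, 2 * pi] (EFin \o (fun=> ln 16)).
  by apply: integrable_itv => x; exact: cst_continuous.
rewrite (@integral_EFin_Rintegral _ _ (fun phi => log_gap (theta, phi))); last first.
  exact: (@integrableB _ _ _ mu _ _ (EFin \o (fun=> ln 16))
    (EFin \o (fun phi => ln (torus_modulus theta phi)))).
congr _%:E; rewrite /log_gap /= RintegralB // Rintegral_log_torus_modulus //.
rewrite Rintegral_cst //.
have := lebesgue_measure_itv `[0, 2 * pi :> R].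
rewrite /= lte_fin mulr_gt0 // /= => ->; rewrite /= subr0; ring.
Qed.

Lemma sin_eq0_itv theta : 0 <= theta <= 2 * pi -> sin theta = 0 ->
  theta \in [:: 0; pi; 2 * pi].
Proof.
move=> /andP[t0 t2] s0; rewrite !inE; have pi0 := pi_gt0 R.
have [//|tn0] := eqVneq theta 0; have [//|tnpi] := eqVneq theta pi.
have [//|tn2] := eqVneq theta (2 * pi); exfalso.
have [tp|tp] := ltP theta pi.
  have : 0 < sin theta by apply: sin_gt0_pi; rewrite tp lt_neqAle eq_sym tn0 t0.
  by rewrite s0 ltxx.
have : 0 < sin (theta - pi).
  apply: sin_gt0_pi; rewrite subr_gt0 lt_neqAle eq_sym tnpi tp /=.
  by rewrite ltrBlDr (_ : pi + pi = 2 * pi) ?lt_neqAle ?tn2 ?t2 //; ring.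
by rewrite sinB s0 sinpi mul0r mulr0 subr0 ltxx.
Qed.

(** The inner integral is known except where [sin] vanishes, which happens at three
    points of the interval. *)
Lemma integral_log_gap_torus :
  (\int[mu2]_(z in torus_square) (log_gap z)%:E)%E =
   (4 * pi ^+ 2 * ln 16 - 16 * pi * Num.sqrt 2 * (1 + chi_period / 16))%:E.
Proof.
have pi0 := pi_gt0 R.
have [mF ->] := tonelli_rectangle 0 (2 * pi) measurable_log_gap log_gap_ge0.
pose H theta := 2 * pi * (ln 16 - inner_value theta).
have cH : continuous H.
  move=> x; apply: cvgM; first exact: cvg_cst.
  by apply: cvgB; [exact: cvg_cst|exact: continuous_inner_value].
have iH : mu.-integrable `[0, 2 * pi] (EFin \o H).
  by apply: integrable_itv; exact: continuous_subspaceT.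
transitivity (\int[mu]_(x in `[0%R, (2 * pi)%R]) (H x)%:E)%E.
  apply: ae_eq_integral => //; first exact: measurable_int iH.
  have cN : countable [set` [:: 0; pi; 2 * pi : R]].
    by apply: finite_set_countable; exact: finite_seq.
  exists [set` [:: 0; pi; 2 * pi]]; split.
  - exact: countable_measurable.
  - exact: countable_lebesgue_measure0.
  - move=> x /=; apply: contra_notP => nx; rewrite in_itv /= => xI.
    by apply: integral_log_gap; apply/eqP => /(sin_eq0_itv xI).
rewrite integral_EFin_Rintegral //; congr _%:E; rewrite /H.
have iI := @integrable_inner_value R 0 (2 * pi).
have ic : mu.-integrable `[0, 2 * pi] (EFin \o (fun=> ln 16)).
  by apply: integrable_itv => x; exact: cst_continuous.
rewrite RintegralZl //; last first.
  exact: (@integrableB _ _ _ mu _ _ (EFin \o (fun=> ln 16)) (EFin \o inner_value)).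
rewrite RintegralB // Rintegral_cst // Rintegral_inner_value_period.
have := lebesgue_measure_itv `[0, 2 * pi :> R].
rewrite /= lte_fin mulr_gt0 // /= => ->; rewrite /= subr0; ring.
Qed.

Lemma measure_torus_square : mu2 torus_square = ((2 * pi) * (2 * pi))%:E.
Proof.
have := lebesgue_measure_itv `[0, 2 * pi :> R].
rewrite /= lte_fin mulr_gt0 ?pi_gt0 // /= => E.
rewrite /torus_square product_measure1E //= E -EFinM !subr0 //.
Qed.

End LogGap.

Section TorusValue.
Context {R : realType}.
Implicit Types (z : R * R).
Notation mu := (@lebesgue_measure R).
Notation mu2 := (@lebesgue_measure R \x @lebesgue_measure R)%E.

Lemma measurable_torus_square : measurable (torus_square : set (R * R)).
Proof. by apply: measurableX; exact: measurable_itv. Qed.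

Lemma integrable_log_gap : mu2.-integrable torus_square (EFin \o (@log_gap R)).
Proof.
apply/integrableP; split.
  by apply: measurable_funTS; apply/measurable_EFinP; exact: measurable_log_gap.
apply: (@le_lt_trans _ _ (\int[mu2]_(z in torus_square) (log_gap z)%:E)%E).
  rewrite le_eqVlt; apply/orP; left; apply/eqP; apply: eq_integral => z _ /=.
  by rewrite ger0_norm // log_gap_ge0.
by rewrite integral_log_gap_torus ltry.
Qed.

Lemma integrable_cst_torus (c : R) : mu2.-integrable torus_square (EFin \o (fun=> c)).
Proof.
apply/integrableP; split; first exact: measurable_cst.
rewrite (_ : (fun _ => _) = fun=> `|c|%:E) // integral_cst; last exact: measurable_torus_square.
by rewrite [X in (_ * X < _)%E]measure_torus_square -EFinM ltry.
Qed.

Lemma log_torus_modulus_gap :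
  (fun z => - ln (torus_modulus z.1 z.2)) = (fun z => log_gap z - ln 16) :> (R * R -> R).
Proof. by apply/funext => z; rewrite /log_gap; ring. Qed.

Lemma integrable_log_torus :
  mu2.-integrable torus_square (EFin \o (fun z => - ln (torus_modulus z.1 z.2))).
Proof.
rewrite log_torus_modulus_gap.
apply: (@integrableB _ _ _ mu2 _ _ (EFin \o (@log_gap R)) (EFin \o (fun=> ln 16))).
- exact: measurable_torus_square.
- exact: integrable_log_gap.
- exact: integrable_cst_torus.
Qed.

Lemma Rintegral_log_torus :
  \int[mu2]_(z in torus_square) (- ln (torus_modulus z.1 z.2)) =
  - (16 * pi * Num.sqrt 2 * (1 + chi_period / 16)).
Proof.
have mT := measurable_torus_square.
rewrite log_torus_modulus_gap RintegralB //; last 2 first.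
- exact: integrable_log_gap.
- exact: integrable_cst_torus.
rewrite Rintegral_cst // [X in fine X]measure_torus_square [X in X - _](_ : _ =
  4 * pi ^+ 2 * ln 16 - 16 * pi * Num.sqrt 2 * (1 + chi_period / 16)); first by rewrite /=; ring.
by rewrite /Rintegral integral_log_gap_torus.
Qed.

Lemma log_integrand_torus :
  torus_integrable (@log_integrand R) /\
  torus_integral (@log_integrand R) =
    (- (16 * pi * Num.sqrt 2 * (1 + chi_period / 16)))%:C.
Proof.
have E1 : (fun z => complex.Re (torus_pullback (@log_integrand R) z)) =
    (fun z => - ln (torus_modulus z.1 z.2)).
  by apply/funext => z; rewrite torus_pullback_log.
have E2 : (fun z => complex.Im (torus_pullback (@log_integrand R) z)) = (fun=> 0).
  by apply/funext => z; rewrite torus_pullback_log.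
split; last first.
  rewrite /torus_integral; congr (_ +i* _).
    by rewrite E1 Rintegral_log_torus.
  by rewrite E2 Rintegral_cst ?mul0r //; exact: measurable_torus_square.
split.
- have := integrable_log_torus; rewrite -E1; exact.
- have := integrable_cst_torus 0; rewrite -E2; exact.
Qed.

End TorusValue.

Theorem mainTheorem1 (p q : nat -> R)
    (hp : satisfies_recursion p) (hq : satisfies_recursion q)
    (hq0 : q 0%N = 1) (hp0 : p 0%N = 1)
    (hq1 : q 1%N = (1289 / 160)%coqR) (hp1 : p 1%N = (136185509 / 15876000)%coqR) :
  torus_integrable (@log_integrand R) /\
  exists2 l : R, (fun n => p n / q n) @ \oo --> l &
    l%:C = - (1 / (16 * pi * Num.sqrt 2))%:C * torus_integral (@log_integrand R).
Proof.
have [itg ->] := @log_integrand_torus R; split=> //.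
exists (1 + chi_period / 16); first exact: approximants_cvg.
have pi0 : pi != 0 :> R by rewrite gt_eqF // pi_gt0.
have s0 : Num.sqrt 2 != 0 :> R by rewrite gt_eqF // sqrtr_gt0.
rewrite rmorphN /= mulrNN -rmorphM /=; congr (_%:C).
rewrite div1r mulrA mulVf ?mul1r // !mulf_neq0 // pnatr_eq0 //.
Qed.
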